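(* Fix any $\lambda\in\mathbb{R}$. (i) For $G=\mathrm{Sp}(2)$, among the $2$-dimensional space of local $G$-invariant Laplacian solitons with dilation constant $\lambda$ defined on $I\times\mathbb{CP}^3$ for some interval $I\subset\mathbb{R}$, there is a $1$-parameter family of distinct smoothly-closing $G$-invariant Laplacian solitons, i.e. $G$-invariant Laplacian solitons that extend smoothly over the zero-section $\mathbb{S}^4\subset\Lambda^2_-\mathbb{S}^4$. (ii) For $G=\mathrm{SU}(3)$, among the $4$-dimensional space of local $G$-invariant Laplacian solitons with dilation constant $\lambda$ defined on $I\times \mathrm{SU}(3)/T^2$ for some interval $I\subset\mathbb{R}$, there is a $2$-parameter family of distinct smoothly-closing $G$-invariant Laplacian solitons, i.e. $G$-invariant Laplacian solitons that extend smoothly over the zero-section $\mathbb{CP}^2\subset\Lambda^2_-\mathbb{CP}^2$.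
   Context: A Laplacian soliton on a 7-manifold is a triple $(\varphi,X,\lambda)$ with $\varphi$ a $G_2$-structure, $X$ a vector field, $\lambda\in\mathbb{R}$ (the dilation constant), such that $d\varphi=0$ and $\Delta_\varphi\varphi=\lambda\varphi+\mathcal{L}_X\varphi$. $\mathrm{SU}(3)$-invariant solitons on $I\times \mathrm{SU}(3)/T^2$ are (up to discrete symmetries) given by functions $f_1,f_2,f_3:I\to(0,\infty)$, $u:I\to\mathbb{R}$ satisfying $2(f_1f_2f_3)'=f_1^2+f_2^2+f_3^2$, $\;(\tau_i-uf_i^2)'=\lambda f_i^2$ for $i=1,2,3$, and $\tau_1+\tau_2+\tau_3=u(f_1^2+f_2^2+f_3^2)+2\lambda f_1f_2f_3$, where $\tau_i:=(f_i^2)'+\frac{f_i^2}{f_1f_2f_3}\bigl(2f_i^2-(f_1^2+f_2^2+f_3^2)\bigr)$. Here $X=u\,\partial_t$, $\tau=\sum\tau_i\omega_i$ is the torsion 2-form, and the metric is $dt^2+\sum f_i^2g_i$ with $g_i,\omega_i$ the invariant metrics and 2-forms on the three irreducible summands of the isotropy representation. $\mathrm{Sp}(2)$-invariant solitons on $I\times\mathbb{CP}^3$, $\mathbb{CP}^3=\mathrm{Sp}(2)/(\mathrm{Sp}(1)\times \mathrm{U}(1))$, are given by the same system with $f_2=f_3$, $\tau_2=\tau_3$. Smooth closing (singular orbit at $t=0$): the $\mathrm{SU}(3)$-invariant structure on $(0,\epsilon)\times \mathrm{SU}(3)/T^2$ extends smoothly over the zero section $\mathbb{CP}^2$ of $\Lambda^2_-\mathbb{CP}^2$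 iff (after the discrete symmetries) the $f_i$ extend smoothly to a neighbourhood of $t=0$ with $f_1$ odd in $t$, $f_1'(0)=1$, $f_2^2(t)=f_3^2(-t)$, $f_2(0)=f_3(0)>0$; smoothness of $X$ means $u$ is odd. In the $\mathrm{Sp}(2)$-invariant case the conditions over $\mathbb{S}^4$ are: $f_1$ odd, $f_1'(0)=1$, $f_2$ even, $f_2(0)>0$, $u$ odd. *)

(* Defs.v *)
(* Stdlib reals, with Coquelicot for derivatives and topology. *)
From Stdlib Require Import Reals.
From Coquelicot Require Import Coquelicot.
Open Scope R_scope.

(* The three irreducible summands of the isotropy representation. *)
Inductive summand := s1 | s2 | s3.

Definition sum3 (a : summand -> R) : R := a s1 + a s2 + a s3.

(* An invariant pair (phi, X) on I x G/H, with I the open interval (lo, hi),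
   metric dt^2 + sum_i (f i)^2 g_i and vector field X = u d/dt.
   The values of f and u outside I carry no meaning. *)
Record profile := Profile {
  lo : Rbar;
  hi : Rbar;
  f : summand -> R -> R;
  u : R -> R
}.

Definition dom (s : profile) (t : R) : Prop := Rbar_lt (lo s) t /\ Rbar_lt t (hi s).

Definition vol (s : profile) (t : R) : R := f s s1 t * f s s2 t * f s s3 t.

Definition sumsq (s : profile) (t : R) : R := sum3 (fun i => f s i t ^ 2).

(* The components of the torsion 2-form tau = sum_i (tau i) omega_i. *)
Definition tau (s : profile) (i : summand) (t : R) : R :=
  Derive (fun x => f s i x ^ 2) t
  + f s i t ^ 2 / vol s t * (2 * f s i t ^ 2 - sumsq s t).

Definition smooth_on (D : R -> Prop) (g : R -> R) : Prop :=
  forall (n : nat) (t : R), D t -> ex_derive_n g n t.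

Definition SU3_soliton (lam : R) (s : profile) : Prop :=
  Rbar_lt (lo s) (hi s)
  /\ (forall i, smooth_on (dom s) (f s i))
  /\ smooth_on (dom s) (u s)
  /\ forall t, dom s t ->
       (forall i, 0 < f s i t)
       /\ 2 * Derive (vol s) t = sumsq s t
       /\ (forall i, Derive (fun x => tau s i x - u s x * f s i x ^ 2) t
                     = lam * f s i t ^ 2)
       /\ sum3 (fun i => tau s i t) = u s t * sumsq s t + 2 * lam * vol s t.

Definition Sp2_soliton (lam : R) (s : profile) : Prop :=
  SU3_soliton lam s
  /\ forall t, dom s t -> f s s2 t = f s s3 t /\ tau s s2 t = tau s s3 t.

(* g and v are smooth on (-d, d) and agree with f and u for small t > 0. *)
Definition extends (s : profile) (d : R) (g : summand -> R -> R) (v : R -> R) : Prop :=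
  lo s = Finite 0
  /\ 0 < d
  /\ (forall i, smooth_on (fun t => -d < t < d) (g i))
  /\ smooth_on (fun t => -d < t < d) v
  /\ forall t, dom s t -> t < d -> (forall i, f s i t = g i t) /\ u s t = v t.

(* Smooth extension over the zero section of Lambda^2_- S^4, placed at t = 0. *)
Definition closes_S4 (s : profile) : Prop :=
  exists d g v, extends s d g v
    /\ (forall t, -d < t < d ->
          g s1 (-t) = - g s1 t
          /\ g s2 (-t) = g s2 t /\ g s3 (-t) = g s3 t
          /\ v (-t) = - v t)
    /\ Derive (g s1) 0 = 1
    /\ g s2 0 = g s3 0 /\ 0 < g s2 0.

(* Smooth extension over the zero section of Lambda^2_- CP^2, placed at t = 0,
   with the discrete symmetries used to make s1 the collapsing summand. *)
Definition closes_CP2 (s : profile) : Prop :=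
  exists d g v, extends s d g v
    /\ (forall t, -d < t < d ->
          g s1 (-t) = - g s1 t
          /\ g s2 t ^ 2 = g s3 (-t) ^ 2
          /\ v (-t) = - v t)
    /\ Derive (g s1) 0 = 1
    /\ g s2 0 = g s3 0 /\ 0 < g s2 0.

(* Equality of local solitons: the system is autonomous, so profiles are
   compared up to a translation c of t; since solutions continue uniquely, it is
   enough that they agree on some nonempty open interval. *)
Definition same (s s' : profile) : Prop :=
  exists a b c, a < b /\ forall t, a < t < b ->
    dom s t /\ dom s' (t - c)
    /\ (forall i, f s i t = f s' i (t - c)) /\ u s t = u s' (t - c).

Definition permute (sg : summand -> summand) (s : profile) : profile :=
  Profile (lo s) (hi s) (fun i => f s (sg i)) (u s).

(* Equality up to the discrete symmetries, which permute the summands. *)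
Definition same_up_to_symmetry (s s' : profile) : Prop :=
  exists sg : summand -> summand,
    (forall i j, sg i = sg j -> i = j) /\ same s (permute sg s').

(* S is a family, parametrised by the nonempty open set U of P, of pairwise
   distinct (with respect to eqv) profiles satisfying A.  The phase-space
   coordinates (f, tau, u) depend continuously on (p, t) jointly; without this
   the number of parameters would have no meaning. *)
Definition is_family {P : UniformSpace} (eqv : profile -> profile -> Prop)
    (A : profile -> Prop) (U : P -> Prop) (S : P -> profile) : Prop :=
  open U
  /\ (exists p, U p)
  /\ (forall p, U p -> A (S p))
  /\ (forall p q, U p -> U q -> eqv (S p) (S q) -> p = q)
  /\ forall p t, U p -> dom (S p) t ->
       locally (p, t) (fun z : P * R => dom (S (fst z)) (snd z))
       /\ (forall i, continuous (fun z : P * R => f (S (fst z)) i (snd z)) (p, t)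
                     /\ continuous (fun z : P * R => tau (S (fst z)) i (snd z)) (p, t))
       /\ continuous (fun z : P * R => u (S (fst z)) (snd z)) (p, t).

Definition has_family (P : UniformSpace) (eqv : profile -> profile -> Prop)
    (A : profile -> Prop) : Prop :=
  exists (U : P -> Prop) (S : P -> profile), is_family eqv A U S.

(* Phase-space points of s' at t' and of s at t are delta-close. *)
Definition close (delta : R) (s' : profile) (t' : R) (s : profile) (t : R) : Prop :=
  (forall i, Rabs (f s' i t' - f s i t) < delta
             /\ Rabs (tau s' i t' - tau s i t) < delta)
  /\ Rabs (u s' t' - u s t) < delta.

(* The local solitons satisfying A, modulo same, form a space locally modelled
   on P: near each point of each of them there is a chart, i.e. a family
   parametrised by an open set of P that contains every soliton satisfying A
   which passes sufficiently close to that point of phase space. *)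
Definition locally_modelled_on (P : UniformSpace) (A : profile -> Prop) : Prop :=
  forall s t, A s -> dom s t ->
    exists (U : P -> Prop) (S : P -> profile) (delta : R),
      is_family same A U S
      /\ 0 < delta
      /\ forall s' t', A s' -> dom s' t' -> close delta s' t' s t ->
           exists p, U p /\ same s' (S p).

Definition Euclid1 : UniformSpace := R_UniformSpace.
Definition Euclid2 : UniformSpace := prod_UniformSpace Euclid1 Euclid1.
Definition Euclid4 : UniformSpace := prod_UniformSpace Euclid2 Euclid2.

(* Main.v *)
From Stdlib Require Import Reals Ranalysis5 Lra Lia List Arith.
From Coquelicot Require Import Coquelicot.
Require Import Defs.
Open Scope R_scope.

(* Put F_i = f_i^2, sigma_i = tau_i - u F_i and V = f_1 f_2 f_3.  The first and last equations
   give sum_i sigma_i / F_i = -3 u, so u is a function of (F, sigma) and the system becomes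
   F_i' = sigma_i + u F_i - F_i (2 F_i - sum_j F_j) / V, sigma_i' = lam F_i on the hypersurface
   sum_i sigma_i = 2 lam V.  With 1/F_i and 1/V as further unknowns it is polynomial.  Since
   2 V' = sum_j F_j > 0, every level set of V is a transversal that an orbit meets at most once,
   so the level sets are charts of the space of local solitons.

   For smooth closing write r = t^2, F_1 = r A, F_2 + F_3 = S, F_2 - F_3 = t E, V = t W,
   sigma_1 = t^3 B, sigma_2 + sigma_3 = t L, sigma_2 - sigma_3 = K, u = t v.  The coefficients are
   functions of r, which builds the parity conditions in, and they solve a system of Fuchsian type
   2 r x' = - k (x - x(0)) + r P(x) with k >= 0.  It has no resonance: b = F_2(0) and c = E(0) are
   free and determine everything else; c = 0 is the Sp(2)-invariant case.

   Both systems are solved by power series.  A majorant uniform in the initial values gives a common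
   radius of convergence and joint continuity. *)

(** * Power series solutions of polynomial systems *)

(** Working with [sigma_i] instead of [tau_i] keeps [u'] out of the equations. The reciprocals are
    independent unknowns, so that no series is ever divided. That they are reciprocals of the right
    functions is an algebraic relation whose defect satisfies a homogeneous linear equation and
    vanishes initially, hence always; the relations then prevent zeros, and positivity persists.

    Dimension count: six unknowns [F_i], [sigma_i], less one constraint and one translation, leave
    4; with [F_2 = F_3] and [sigma_2 = sigma_3] there are four unknowns, and 2 remain.

    At the singular orbit the coefficients are obtained by dividing by [2 n + 2 + k], which vanishes
    for no [n]; the choice [Y = W - S / 2] serves to reach this diagonal form. The constraint is
    solved for [L = 2 lam W - r B], and [A = W ^ 2 / (F_2 F_3)] is derived, not an unknown, so
    [A(0) = 1], that is [f_1'(0) = 1], holds automatically.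

    Distinctness: [V = 0] at the orbit fixes the translation, and [F_1(0) = 0] fixes the collapsing
    summand. The remaining symmetry exchanges [s2] and [s3] and sends [c] to [- c], whence the
    restriction to [c > 0] for SU(3). *)

Inductive expr (I : Type) : Type :=
| Cst (c : R)
| Var (i : I)
| Add (e1 e2 : expr I)
| Mul (e1 e2 : expr I)
| Shift (e : expr I)
| Int (k : nat) (e : expr I).

Arguments Cst {I} c.
Arguments Var {I} i.
Arguments Add {I} e1 e2.
Arguments Mul {I} e1 e2.
Arguments Shift {I} e.
Arguments Int {I} k e.

(* [Shift e] stands for [r e(r)]; [Int k e] for the solution [y] of [2 r y' + (k + 2) y = e] that is
   regular at [r = 0]. *)
Fixpoint coef {I : Type} (x : I -> nat -> R) (e : expr I) : nat -> R :=
  match e with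
  | Cst c => fun n => match n with O => c | S _ => 0 end
  | Var i => x i
  | Add e1 e2 => PS_plus (coef x e1) (coef x e2)
  | Mul e1 e2 => PS_mult (coef x e1) (coef x e2)
  | Shift e => PS_incr_1 (coef x e)
  | Int k e => fun n => coef x e n / INR (2 * n + 2 + k)
  end.

(** No constructor looks at higher orders than the one it produces. This is what makes the recursion
    for the coefficients of a solution well founded. *)
Lemma coef_causal {I : Type} (x y : I -> nat -> R) (e : expr I) (n : nat) :
  (forall i k, (k <= n)%nat -> x i k = y i k) ->
  forall k, (k <= n)%nat -> coef x e k = coef y e k.
Proof.
  intros H; induction e as [c|i|e1 H1 e2 H2|e1 H1 e2 H2|e H1|m e H1]; intros k Hk; simpl.
  - reflexivity.
  - now apply H.
  - unfold PS_plus; rewrite H1, H2; auto.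
  - apply sum_eq; intros j Hj; rewrite H1, H2; auto; lia.
  - destruct k as [|k]; simpl; [reflexivity|apply H1; lia].
  - rewrite H1; auto.
Qed.

(** Each coefficient needs all lower ones of all unknowns, which is not a structural recursion. The
    depth [m] makes it one: the iterate is correct up to order [m], as [iterate_stable] shows. *)
Fixpoint iterate {I : Type} (P : I -> expr I) (ks : I -> nat) (z : I -> R) (m : nat)
    : I -> nat -> R :=
  match m with
  | O => fun i n => match n with O => z i | S _ => 0 end
  | S m => fun i n => match n with
      | O => z i
      | S n => coef (iterate P ks z m) (P i) n / INR (2 * n + 2 + ks i)
      end
  end.

(* [fun r => PSeries (sol P ks z i) r] solves [2 r x_i' + ks i (x_i - z i) = r P_i(x)], [x_i 0 = z i]. *)
Definition sol {I : Type} (P : I -> expr I) (ks : I -> nat) (z : I -> R)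
    : I -> nat -> R :=
  fun i n => iterate P ks z n i n.

Lemma iterate_stable {I : Type} (P : I -> expr I) ks z (m n : nat) i :
  (n <= m)%nat -> iterate P ks z m i n = sol P ks z i n.
Proof.
  unfold sol; revert n m i.
  induction n as [n IH] using lt_wf_ind; intros m i Hm.
  destruct n as [|n]; [now destruct m|].
  destruct m as [|m]; [lia|]; simpl.
  f_equal; apply (coef_causal _ _ _ n); [|lia].
  intros j k Hk; rewrite (IH k) by lia; symmetry; apply IH; lia.
Qed.

Lemma sol_0 {I : Type} (P : I -> expr I) ks z i : sol P ks z i 0 = z i.
Proof. reflexivity. Qed.

Lemma sol_S {I : Type} (P : I -> expr I) ks z i n :
  sol P ks z i (S n) = coef (sol P ks z) (P i) n / INR (2 * n + 2 + ks i).
Proof.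
  unfold sol at 1; simpl; f_equal.
  apply (coef_causal _ _ _ n); [|lia].
  intros; now apply iterate_stable.
Qed.

(** * Majorants, uniform in the initial values *)

(** A purely geometric bound [C * M ^ n] is not stable under Cauchy products, which produce a factor
    [n + 1]. With the summable weight [1 / (n + 1) ^ 2] only a constant is lost, in products and in
    index shifts. *)
Definition wt (n : nat) : R := / (INR n + 1) ^ 2.

Lemma wt_pos n : 0 < wt n.
Proof. apply Rinv_0_lt_compat, pow_lt; generalize (pos_INR n); lra. Qed.

Lemma wt_le_1 n : wt n <= 1.
Proof.
  unfold wt; rewrite <- Rinv_1; apply Rinv_le_contravar; [lra|].
  generalize (pos_INR n); nra.
Qed.

Lemma wt_S n : wt n <= 4 * wt (S n).
Proof.
  unfold wt; rewrite S_INR; generalize (pos_INR n); intros H.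
  apply Rmult_le_reg_r with ((INR n + 1) ^ 2 * (INR n + 1 + 1) ^ 2).
  - apply Rmult_lt_0_compat; apply pow_lt; lra.
  - field_simplify; nra.
Qed.

(** Telescoping, from [1 / (n + 2) ^ 2 <= 1 / (n + 1) - 1 / (n + 2)]. *)
Lemma sum_wt n : sum_f_R0 wt n <= 2 - / (INR n + 1).
Proof.
  induction n as [|n IH].
  - unfold wt; simpl; field_simplify; lra.
  - rewrite tech5.
    enough (wt (S n) <= / (INR n + 1) - / (INR (S n) + 1)) by lra.
    unfold wt; rewrite S_INR; generalize (pos_INR n); intros H.
    apply Rmult_le_reg_r with ((INR n + 1) * (INR n + 1 + 1) ^ 2).
    + apply Rmult_lt_0_compat; [lra|apply pow_lt; lra].
    + replace (/ (INR n + 1 + 1) ^ 2 * ((INR n + 1) * (INR n + 1 + 1) ^ 2))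
        with (INR n + 1) by (field; lra).
      replace ((/ (INR n + 1) - / (INR n + 1 + 1)) * ((INR n + 1) * (INR n + 1 + 1) ^ 2))
        with (INR n + 1 + 1) by (field; lra).
      lra.
Qed.

Lemma sum_reverse (g : nat -> R) n :
  sum_f_R0 (fun k => g (n - k)%nat) n = sum_f_R0 g n.
Proof.
  induction n as [|n IH]; [reflexivity|].
  rewrite decomp_sum by lia; simpl pred.
  rewrite tech5, <- IH, Rplus_comm; f_equal; simpl; f_equal.
Qed.

(* From 1/(ab) = (1/a + 1/b)/(a + b): the weights [wt] are a convolution algebra up to a constant. *)
Lemma wt_mult k n : (k <= n)%nat -> wt k * wt (n - k) <= 2 * wt n * (wt k + wt (n - k)).
Proof.
  intros Hk; unfold wt; rewrite minus_INR by lia.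
  apply le_INR in Hk; generalize (pos_INR k) (pos_INR n).
  set (a := INR k + 1); set (b := INR n - INR k + 1); intros H1 H2.
  replace (INR n + 1) with (a + b - 1) by (unfold a, b; ring).
  assert (Ha : 1 <= a) by (unfold a; lra).
  assert (Hb : 1 <= b) by (unfold b; lra).
  apply Rmult_le_reg_r with (a ^ 2 * b ^ 2 * (a + b - 1) ^ 2).
  - repeat apply Rmult_lt_0_compat; try lra; apply pow_lt; lra.
  - replace (/ a ^ 2 * / b ^ 2 * (a ^ 2 * b ^ 2 * (a + b - 1) ^ 2))
      with ((a + b - 1) ^ 2) by (field; lra).
    replace (2 * / (a + b - 1) ^ 2 * (/ a ^ 2 + / b ^ 2) * (a ^ 2 * b ^ 2 * (a + b - 1) ^ 2))
      with (2 * (a ^ 2 + b ^ 2)) by (field; lra).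
    assert ((a + b - 1) ^ 2 <= (a + b) ^ 2) by (apply pow_incr; lra).
    generalize (pow2_ge_0 (a - b)); lra.
Qed.

(** By [wt_mult] and reversal of one sum, the constant is [2 * (2 + 2)], each 2 in the bracket
    bounding the total weight. *)
Lemma wt_conv n : sum_f_R0 (fun k => wt k * wt (n - k)) n <= 8 * wt n.
Proof.
  apply Rle_trans with (sum_f_R0 (fun k => (wt k + wt (n - k)) * (2 * wt n)) n).
  - apply sum_Rle; intros k Hk; generalize (wt_mult k n Hk); lra.
  - rewrite <- scal_sum, plus_sum, (sum_reverse wt).
    assert (H : sum_f_R0 wt n <= 2).
    { generalize (sum_wt n) (pos_INR n); intros H1 H2.
      assert (0 < / (INR n + 1)) by (apply Rinv_0_lt_compat; lra); lra. }
    generalize (wt_pos n); nra.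
Qed.

(** The point is the order of the quantifiers: [C'] depends on [e] and [C] but not on [M], so [M]
    can be chosen afterwards to absorb [C']. The bound is stated up to order [n] only, as an
    induction on the order requires. A product costs the factor 8 of [wt_conv], a shift the factor 4
    of [wt_S]. *)
Lemma coef_bound {I : Type} (e : expr I) (C : R) :
  0 <= C -> exists C', 0 <= C' /\ forall (M : R) (x : I -> nat -> R) (n : nat),
    1 <= M -> (forall i k, (k <= n)%nat -> Rabs (x i k) <= C * M ^ k * wt k) ->
    forall k, (k <= n)%nat -> Rabs (coef x e k) <= C' * M ^ k * wt k.
Proof.
  intros HC; induction e as [c|i|e1 [C1 [P1 H1]] e2 [C2 [P2 H2]]|e1 [C1 [P1 H1]] e2 [C2 [P2 H2]]
    |e [C1 [P1 H1]]|m e [C1 [P1 H1]]].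
  - exists (Rabs c); split; [apply Rabs_pos|]; intros M x n HM _ k _; simpl.
    destruct k as [|k].
    + unfold wt; simpl; right; field.
    + rewrite Rabs_R0; repeat apply Rmult_le_pos;
        try apply Rabs_pos; try lra; [apply pow_le; lra|left; apply wt_pos].
  - exists C; split; [exact HC|]; intros M x n HM H k Hk; now apply H.
  - exists (C1 + C2); split; [lra|]; intros M x n HM H k Hk; simpl.
    specialize (H1 M x n HM H k Hk); specialize (H2 M x n HM H k Hk).
    eapply Rle_trans; [apply Rabs_triang|]; lra.
  - exists (C1 * C2 * 8); split; [nra|]; intros M x n HM H k Hk; simpl; unfold PS_mult.
    eapply Rle_trans; [apply Rsum_abs|].
    apply Rle_trans with
      (sum_f_R0 (fun j => (wt j * wt (k - j)) * (C1 * C2 * M ^ k)) k).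
    + apply sum_Rle; intros j Hj; rewrite Rabs_mult.
      replace (M ^ k) with (M ^ j * M ^ (k - j)) by (rewrite <- pow_add; f_equal; lia).
      replace (wt j * wt (k - j) * (C1 * C2 * (M ^ j * M ^ (k - j)))) with
        ((C1 * M ^ j * wt j) * (C2 * M ^ (k - j) * wt (k - j))) by ring.
      apply Rmult_le_compat; try apply Rabs_pos;
        [apply (H1 M x n)|apply (H2 M x n)]; auto; lia.
    + rewrite <- scal_sum.
      replace (C1 * C2 * 8 * M ^ k * wt k) with (C1 * C2 * M ^ k * (8 * wt k)) by ring.
      apply Rmult_le_compat_l; [|apply wt_conv].
      repeat apply Rmult_le_pos; auto; apply pow_le; lra.
  - exists (4 * C1); split; [lra|]; intros M x n HM H k Hk; destruct k as [|k]; simpl.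
    + change (@zero _) with 0; rewrite Rabs_R0; generalize (wt_pos 0); intros.
      repeat apply Rmult_le_pos; lra.
    + eapply Rle_trans; [apply (H1 M x n HM H k); lia|].
      assert (HMk : 0 < M ^ k) by (apply pow_lt; lra).
      replace (4 * C1 * (M * M ^ k) * wt (S k)) with (C1 * (M * M ^ k * (4 * wt (S k)))) by ring.
      replace (C1 * M ^ k * wt k) with (C1 * (1 * M ^ k * wt k)) by ring.
      apply Rmult_le_compat_l; [lra|].
      generalize (wt_pos k) (wt_S k); intros.
      apply Rmult_le_compat; try nra.
  - exists C1; split; [lra|]; intros M x n HM H k Hk; cbn [coef].
    specialize (H1 M x n HM H k Hk).
    assert (HI : 1 <= INR (2 * k + 2 + m)) by (apply (le_INR 1); lia).
    unfold Rdiv; rewrite Rabs_mult, Rabs_inv, (Rabs_right (INR _)) by lra.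
    eapply Rle_trans; [|exact H1].
    rewrite <- (Rmult_1_r (Rabs (coef x e k))) at 2.
    apply Rmult_le_compat_l; [apply Rabs_pos|].
    rewrite <- Rinv_1; apply Rinv_le_contravar; lra.
Qed.

Lemma coef_bound_list {I : Type} (P : I -> expr I) (l : list I) (C : R) :
  0 <= C -> exists C', 0 <= C' /\ forall (M : R) (x : I -> nat -> R) (n : nat),
    1 <= M -> (forall i k, (k <= n)%nat -> Rabs (x i k) <= C * M ^ k * wt k) ->
    forall i, In i l -> Rabs (coef x (P i) n) <= C' * M ^ n * wt n.
Proof.
  intros HC; induction l as [|a l [C1 [P1 H1]]].
  - exists 0; split; [lra|]; intros M x n _ _ i [].
  - destruct (coef_bound (P a) C HC) as [C2 [P2 H2]].
    exists (C1 + C2); split; [lra|]; intros M x n HM H i Hi.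
    assert (W : 0 <= M ^ n * wt n).
    { apply Rmult_le_pos; [apply pow_le; lra|left; apply wt_pos]. }
    destruct Hi as [<-|Hi].
    + specialize (H2 M x n HM H n (Nat.le_refl n)); nra.
    + specialize (H1 M x n HM H i Hi); nra.
Qed.

Definition geo (M C : R) (a : nat -> R) : Prop := forall n, Rabs (a n) <= C * M ^ n.

(** [M] serves all initial values in the box of size [C] and all expressions; only [C'] varies with
    the expression. A common radius of convergence and uniform tails follow. *)
Lemma sol_bound {I : Type} (P : I -> expr I) ks (l : list I) (C : R) :
  0 < C -> (forall i, In i l) ->
  exists M, 1 <= M /\ forall e : expr I, exists C', forall z : I -> R,
    (forall i, Rabs (z i) <= C) -> geo M C' (coef (sol P ks z) e).
Proof.
  intros HC Hl.
  destruct (coef_bound_list P l C) as [C1 [P1 H1]]; [lra|].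
  (* Large enough that [C1 * M ^ n * wt n <= C * M ^ (n + 1) * wt (n + 1)], which closes the
     induction; the 4 comes from [wt_S]. *)
  exists (1 + 4 * C1 / C).
  assert (HM : 1 <= 1 + 4 * C1 / C).
  { enough (0 <= 4 * C1 / C) by lra.
    apply Rmult_le_pos; [lra|left; now apply Rinv_0_lt_compat]. }
  split; [exact HM|].
  set (M := 1 + 4 * C1 / C) in *.
  assert (HMC : 4 * C1 <= M * C).
  { unfold M; replace ((1 + 4 * C1 / C) * C) with (C + 4 * C1) by (field; lra); lra. }
  assert (B : forall z : I -> R, (forall i, Rabs (z i) <= C) ->
    forall n i, Rabs (sol P ks z i n) <= C * M ^ n * wt n).
  { intros z Hz; induction n as [n IH] using lt_wf_ind; intros i.
    destruct n as [|n].
    - rewrite sol_0; unfold wt; simpl.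
      replace (C * 1 * / ((0 + 1) * ((0 + 1) * 1))) with C by field; apply Hz.
    - rewrite sol_S.
      assert (HI : 1 <= INR (2 * n + 2 + ks i)) by (apply (le_INR 1); lia).
      unfold Rdiv; rewrite Rabs_mult, Rabs_inv, (Rabs_right (INR _)) by lra.
      apply Rle_trans with (Rabs (coef (sol P ks z) (P i) n) * 1).
      { apply Rmult_le_compat_l; [apply Rabs_pos|].
        rewrite <- Rinv_1; apply Rinv_le_contravar; lra. }
      rewrite Rmult_1_r.
      eapply Rle_trans; [apply (H1 M _ n HM); [|apply Hl]|].
      + intros j k Hk; apply IH; lia.
      + assert (0 < M ^ n) by (apply pow_lt; lra).
        generalize (wt_pos n) (wt_S n) (wt_pos (S n)); intros.
        apply Rle_trans with (C1 * M ^ n * (4 * wt (S n))).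
        * apply Rmult_le_compat_l; [nra|assumption].
        * simpl; replace (C1 * M ^ n * (4 * wt (S n))) with (4 * C1 * (M ^ n * wt (S n))) by ring.
          replace (C * (M * M ^ n) * wt (S n)) with (M * C * (M ^ n * wt (S n))) by ring.
          apply Rmult_le_compat_r; [nra|assumption]. }
  intros e; destruct (coef_bound e C) as [C2 [P2 H2]]; [lra|].
  exists C2; intros z Hz n.
  eapply Rle_trans; [apply (H2 M _ n HM); [|apply Nat.le_refl]; intros; now apply B|].
  rewrite <- (Rmult_1_r (C2 * M ^ n)) at 2; apply Rmult_le_compat_l; [|apply wt_le_1].
  apply Rmult_le_pos; [assumption|apply pow_le; lra].
Qed.

Lemma geo_radius M C a r :
  1 <= M -> geo M C a -> Rabs r < / M -> Rbar_lt (Rabs r) (CV_radius a).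
Proof.
  intros HM Ha Hr.
  apply Rbar_lt_le_trans with (/ M); [exact Hr|].
  destruct (CV_radius_bounded a) as [H _]; apply H.
  exists C; intros n; rewrite Rabs_mult, <- RPow_abs, Rabs_inv, (Rabs_right M), pow_inv by lra.
  assert (0 < M ^ n) by (apply pow_lt; lra).
  apply Rmult_le_reg_r with (M ^ n); [assumption|].
  rewrite Rmult_assoc, Rinv_l, Rmult_1_r by lra; apply Ha.
Qed.

(** On half of the guaranteed disk the terms are at most [C * 2 ^ (- n)], so the tail estimate
    depends on the coefficients through [C] alone. *)
Lemma geo_tail M C a r N :
  1 <= M -> geo M C a -> Rabs r <= / (2 * M) ->
  Rabs (PSeries a r - sum_f_R0 (fun k => a k * r ^ k) N) <= C * (/ 2) ^ N.
Proof.
  intros HM Ha Hr.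
  assert (T : forall n, Rabs (a n * r ^ n) <= C * (/ 2) ^ n).
  { intros n; rewrite Rabs_mult, <- RPow_abs.
    apply Rle_trans with (C * M ^ n * (/ (2 * M)) ^ n).
    - apply Rmult_le_compat; [apply Rabs_pos|apply pow_le, Rabs_pos|apply Ha|].
      apply pow_incr; split; [apply Rabs_pos|assumption].
    - rewrite Rmult_assoc, <- Rpow_mult_distr.
      right; do 2 f_equal; field; lra. }
  assert (G : ex_series (fun n => C * (/ 2) ^ n)).
  { apply (ex_series_scal_l (V := R_NormedModule) C), ex_series_geom; rewrite Rabs_right; lra. }
  assert (E : ex_series (fun n => Rabs (a n * r ^ n))).
  { apply (@ex_series_le R_AbsRing R_CompleteNormedModule) with (2 := G).
    intros n; unfold norm; simpl; unfold abs; simpl; rewrite Rabs_Rabsolu; apply T. }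
  assert (Q : PSeries a r = sum_f_R0 (fun k => a k * r ^ k) N
      + Series (fun k => a (S N + k)%nat * r ^ (S N + k))).
  { unfold PSeries; rewrite (Series_incr_n _ (S N)); [reflexivity|lia|].
    now apply ex_series_Rabs. }
  rewrite Q; unfold Rminus; rewrite Rplus_assoc, (Rplus_comm (Series _)), <- Rplus_assoc,
    Rplus_opp_r, Rplus_0_l.
  eapply Rle_trans; [apply Series_Rabs|].
  - apply (ex_series_incr_n (fun n => Rabs (a n * r ^ n)) (S N)); exact E.
  - apply Rle_trans with (Series (fun k => C * (/ 2) ^ S N * (/ 2) ^ k)).
    + apply Series_le.
      * intros n; split; [apply Rabs_pos|].
        rewrite Rmult_assoc, <- pow_add; apply T.
      * apply (ex_series_scal_l (V := R_NormedModule)), ex_series_geom; rewrite Rabs_right; lra.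
    + rewrite Series_scal_l, Series_geom by (rewrite Rabs_right; lra).
      simpl; right; field.
Qed.

(** * Joint continuity in the initial values and the argument *)

Lemma continuous_add {U : UniformSpace} (g h : U -> R) x :
  continuous g x -> continuous h x -> continuous (fun y => g y + h y) x.
Proof. exact (continuous_plus (V := R_NormedModule) g h x). Qed.

Lemma continuous_sub {U : UniformSpace} (g h : U -> R) x :
  continuous g x -> continuous h x -> continuous (fun y => g y - h y) x.
Proof. exact (continuous_minus (V := R_NormedModule) g h x). Qed.

Lemma continuous_mul {U : UniformSpace} (g h : U -> R) x :
  continuous g x -> continuous h x -> continuous (fun y => g y * h y) x.
Proof. exact (continuous_mult (K := R_AbsRing) g h x). Qed.

Lemma continuous_inv {U : UniformSpace} (g : U -> R) x :
  continuous g x -> g x <> 0 -> continuous (fun y => / g y) x.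
Proof.
  intros H1 H2; apply (continuous_comp g Rinv); [exact H1|now apply continuous_Rinv].
Qed.

Lemma continuous_pow {U : UniformSpace} (g : U -> R) n x :
  continuous g x -> continuous (fun y => g y ^ n) x.
Proof.
  intros H; induction n as [|n IH]; [apply continuous_const|].
  now apply continuous_mul.
Qed.

Lemma continuous_sum {U : UniformSpace} (g : nat -> U -> R) n x :
  (forall k, (k <= n)%nat -> continuous (g k) x) ->
  continuous (fun y => sum_f_R0 (fun k => g k y) n) x.
Proof.
  induction n as [|n IH]; intros H; [now apply H|].
  apply continuous_add; [apply IH; intros; apply H; lia|now apply H].
Qed.

Lemma continuous_coef {U : UniformSpace} {I : Type} (X : U -> I -> nat -> R) (z : U) e :
  (forall i k, continuous (fun y => X y i k) z) ->
  forall n, continuous (fun y => coef (X y) e n) z.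
Proof.
  intros H; induction e as [c|i|e1 H1 e2 H2|e1 H1 e2 H2|e H1|m e H1]; intros n; simpl.
  - apply continuous_const.
  - apply H.
  - now apply continuous_add.
  - apply (continuous_sum (fun k y => coef (X y) e1 k * coef (X y) e2 (n - k))).
    intros; now apply continuous_mul.
  - destruct n as [|n]; [apply continuous_const|apply H1].
  - apply (continuous_mul (fun y => coef (X y) e n)); [apply H1|apply continuous_const].
Qed.

Lemma continuous_sol {I : Type} (P : I -> expr I) ks (z : fct_UniformSpace I R_UniformSpace) i n :
  continuous (fun y : fct_UniformSpace I R_UniformSpace => sol P ks y i n) z.
Proof.
  unfold sol; generalize n at 1; intros m; revert i n.
  assert (Hz : forall i, continuous (fun y : fct_UniformSpace I R_UniformSpace => y i) z).
  { intros i; apply filterlim_locally; intros eps; exists eps; intros y Hy; apply Hy. }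
  induction m as [|m IH]; intros i [|n]; simpl; try apply Hz; try apply continuous_const.
  apply (continuous_mul (fun y : fct_UniformSpace I R_UniformSpace =>
    coef (iterate P ks y m) (P i) n)); [|apply continuous_const].
  now apply continuous_coef.
Qed.

Definition ev {I : Type} (x : I -> nat -> R) (e : expr I) (r : R) : R := PSeries (coef x e) r.

(** Demanded for all expressions at once, since evaluating a sum or a product needs the radii of
    both operands. *)
Definition converges {I : Type} (x : I -> nat -> R) (rho : R) : Prop :=
  forall e r, Rabs r < rho -> Rbar_lt (Rabs r) (CV_radius (coef x e)).

(** A three-epsilon argument: the partial sums are polynomial in [r] with coefficients continuous in
    the initial values, and [geo_tail] bounds the remainder uniformly on the box. *)
Lemma series_flow {I : Type} (P : I -> expr I) ks (l : list I) (C : R) :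
  0 < C -> (forall i, In i l) ->
  exists rho, 0 < rho
    /\ (forall z, (forall i, Rabs (z i) <= C) -> converges (sol P ks z) rho)
    /\ forall e z r,
      locally (z : fct_UniformSpace I R_UniformSpace) (fun y => forall i, Rabs (y i) <= C) ->
      Rabs r < rho ->
      continuous (fun w : fct_UniformSpace I R_UniformSpace * R =>
        ev (sol P ks (fst w)) e (snd w)) (z, r).
Proof.
  intros HC Hl; destruct (sol_bound P ks l C HC Hl) as [M [HM H]].
  exists (/ (2 * M)); split; [apply Rinv_0_lt_compat; lra|split].
  - intros z Hz e r Hr; destruct (H e) as [C' H'].
    apply (geo_radius M C'); auto.
    eapply Rlt_le_trans; [exact Hr|]; apply Rinv_le_contravar; lra.
  - intros e z r Hz Hr; destruct (H e) as [C' H'].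
    assert (HC' : 0 <= C').
    { specialize (H' z (locally_singleton _ _ Hz) 0%nat); simpl in H'.
      generalize (Rabs_pos (coef (sol P ks z) e 0)); lra. }
    apply filterlim_locally; intros eps.
    (* [C' + 1] because [C'] may be 0. *)
    destruct (pow_lt_1_zero (/ 2)) with (y := eps / (3 * (C' + 1))) as [N HN].
    { rewrite Rabs_right; lra. }
    { apply Rdiv_lt_0_compat; [apply cond_pos|lra]. }
    assert (T : C' * (/ 2) ^ N < eps / 3).
    { specialize (HN N (le_n _)); rewrite Rabs_right in HN by (apply Rle_ge, pow_le; lra).
      apply Rle_lt_trans with ((C' + 1) * (/ 2) ^ N).
      - apply Rmult_le_compat_r; [apply pow_le|]; lra.
      - apply Rmult_lt_compat_l with (r := C' + 1) in HN; [|lra].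
        replace ((C' + 1) * (eps / (3 * (C' + 1)))) with (eps / 3) in HN by (field; lra).
        exact HN. }
    set (S := fun w : fct_UniformSpace I R_UniformSpace * R =>
      sum_f_R0 (fun k => coef (sol P ks (fst w)) e k * snd w ^ k) N).
    assert (HS : continuous S (z, r)).
    { apply (continuous_sum (fun k (w : prod_UniformSpace (fct_UniformSpace I R_UniformSpace)
        R_UniformSpace) => coef (sol P ks (fst w)) e k * snd w ^ k)); intros k _.
      apply continuous_mul.
      - apply (continuous_comp fst (fun y : fct_UniformSpace I R_UniformSpace =>
          coef (sol P ks y) e k)); [apply continuous_fst|].
        apply (continuous_coef (fun y : fct_UniformSpace I R_UniformSpace => sol P ks y)).
        intros; apply continuous_sol.
      - apply continuous_pow, continuous_snd. }
    assert (e3 : 0 < eps / 3) by (apply Rdiv_lt_0_compat; [apply cond_pos|lra]).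
    specialize (proj1 (filterlim_locally _ _) HS (mkposreal _ e3)); intros L.
    assert (L1 : locally ((z, r) : prod_UniformSpace (fct_UniformSpace I R_UniformSpace)
        R_UniformSpace) (fun w => (forall i, Rabs (fst w i) <= C) /\ Rabs (snd w) < / (2 * M))).
    { apply filter_and.
      - destruct Hz as [d Hd]; exists d; intros w [Hw _]; now apply Hd.
      - assert (d0 : 0 < / (2 * M) - Rabs r) by lra.
        exists (mkposreal _ d0); intros w [_ Hw].
        change (Rabs (snd w - r) < / (2 * M) - Rabs r) in Hw.
        replace (snd w) with (snd w - r + r) by ring.
        eapply Rle_lt_trans; [apply Rabs_triang|]; lra. }
    generalize (filter_and _ _ L L1); apply filter_imp; clear L L1.
    intros [y s] [K1 [K2 K3]]; simpl in K2, K3.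
    change (Rabs (S (y, s) - S (z, r)) < eps / 3) in K1.
    change (Rabs (ev (sol P ks y) e s - ev (sol P ks z) e r) < eps).
    generalize (geo_tail M C' _ s N HM (H' y K2) (Rlt_le _ _ K3))
      (geo_tail M C' _ r N HM (H' z (locally_singleton _ _ Hz)) (Rlt_le _ _ Hr)).
    fold (ev (sol P ks y) e s) (ev (sol P ks z) e r).
    change (sum_f_R0 (fun k => coef (sol P ks y) e k * s ^ k) N) with (S (y, s)).
    change (sum_f_R0 (fun k => coef (sol P ks z) e k * r ^ k) N) with (S (z, r)).
    intros K4 K5; apply Rle_lt_trans with (C' * (/2)^N + eps / 3 + C' * (/2)^N); [|lra].
    revert K1 K4 K5; unfold Rabs; repeat destruct Rcase_abs; lra.
Qed.

(** * From coefficients to differential equations *)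

Lemma ev_Cst {I : Type} (x : I -> nat -> R) c r : ev x (Cst c) r = c.
Proof.
  apply is_series_unique, (filterlim_ext (fun _ => c)); [|apply filterlim_const].
  intros n; induction n as [|n IH].
  - rewrite sum_O; simpl; ring.
  - rewrite sum_Sn, <- IH; unfold plus; simpl; ring.
Qed.

Lemma ev_Add {I : Type} (x : I -> nat -> R) e1 e2 r rho :
  converges x rho -> Rabs r < rho -> ev x (Add e1 e2) r = ev x e1 r + ev x e2 r.
Proof.
  intros H Hr; apply PSeries_plus; apply CV_radius_inside; now apply H.
Qed.

Lemma ev_Mul {I : Type} (x : I -> nat -> R) e1 e2 r rho :
  converges x rho -> Rabs r < rho -> ev x (Mul e1 e2) r = ev x e1 r * ev x e2 r.
Proof.
  intros H Hr; apply PSeries_mult; now apply H.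
Qed.

Lemma ev_Shift {I : Type} (x : I -> nat -> R) e r : ev x (Shift e) r = r * ev x e r.
Proof. apply PSeries_incr_1. Qed.

Lemma ev_derivable {I : Type} (x : I -> nat -> R) e r rho :
  converges x rho -> Rabs r < rho ->
  is_derive (ev x e) r (PSeries (PS_derive (coef x e)) r).
Proof. intros H Hr; apply is_derive_PSeries; now apply H. Qed.

(** [2 r d/dr] is [t d/dt] for [r = t ^ 2]; it acts on the monomial of degree [n] as multiplication
    by [2 n]. *)
Lemma euler_operator (a b : nat -> R) k r :
  Rbar_lt (Rabs r) (CV_radius a) ->
  (forall n, INR (2 * n + k) * a n = b n) ->
  2 * r * PSeries (PS_derive a) r + INR k * PSeries a r = PSeries b r.
Proof.
  intros Ha Hb.
  rewrite (PSeries_ext b (PS_plus (PS_incr_1 (PS_scal 2 (PS_derive a))) (PS_scal (INR k) a))).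
  - rewrite PSeries_plus, PSeries_incr_1, !PSeries_scal; [ring| |].
    + apply ex_pseries_incr_1, ex_pseries_scal; [apply Rmult_comm|].
      now apply ex_pseries_derive.
    + apply ex_pseries_scal; [apply Rmult_comm|now apply CV_radius_inside].
  - intros n; rewrite <- Hb, plus_INR, mult_INR.
    unfold PS_plus, PS_scal, PS_incr_1, PS_derive, plus, scal, mult; simpl.
    destruct n as [|n]; [simpl; change (@zero _) with 0; unfold mult; simpl; ring|].
    change (INR (S n)) with (match n with O => 1 | S _ => INR n + 1 end); unfold mult; simpl; ring.
Qed.

Lemma ev_Int {I : Type} (x : I -> nat -> R) k e r rho :
  converges x rho -> Rabs r < rho ->
  2 * r * Derive (ev x (Int k e)) r + INR (2 + k) * ev x (Int k e) r = ev x e r.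
Proof.
  intros H Hr; rewrite (is_derive_unique _ _ _ (ev_derivable x _ r rho H Hr)).
  apply euler_operator; [now apply H|].
  intros n; cbn [coef]; rewrite Nat.add_assoc; field.
  apply not_0_INR; lia.
Qed.

Lemma ev_sol_euler {I : Type} (P : I -> expr I) ks z i r rho :
  converges (sol P ks z) rho -> Rabs r < rho ->
  2 * r * Derive (ev (sol P ks z) (Var i)) r + INR (ks i) * (ev (sol P ks z) (Var i) r - z i)
  = r * ev (sol P ks z) (P i) r.
Proof.
  intros H Hr; rewrite (is_derive_unique _ _ _ (ev_derivable _ _ r rho H Hr)).
  rewrite <- ev_Shift.
  rewrite <- (ev_Cst (sol P ks z) (z i) r).
  (* The constant takes care of order 0, where [Shift] contributes nothing and [ks i * z i] remains
     on the left. *)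
  set (e := Add (Shift (P i)) (Cst (INR (ks i) * z i))).
  replace (ev (sol P ks z) (Shift (P i)) r)
    with (ev (sol P ks z) e r - INR (ks i) * z i)
    by (unfold e; rewrite (ev_Add _ _ _ _ rho), ev_Cst; auto; ring).
  change (ev (sol P ks z) e r) with (PSeries (coef (sol P ks z) e) r).
  rewrite <- (euler_operator (coef (sol P ks z) (Var i)) (coef (sol P ks z) e) (ks i)).
  - rewrite ev_Cst; unfold ev; ring.
  - now apply H.
  - intros [|n]; unfold e; cbn [coef PS_plus PS_incr_1].
    + rewrite sol_0; unfold PS_plus, plus; simpl; change (@zero _) with 0; ring.
    + rewrite sol_S; unfold PS_plus, plus; simpl PS_incr_1; cbn -[Nat.mul INR].
      replace (2 * S n + ks i)%nat with (2 * n + 2 + ks i)%nat by lia.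
      rewrite Rplus_0_r; field; apply not_0_INR; lia.
Qed.

(** For [ks i = 0] the factor [r] is cancelled in the coefficients, so the equation holds at [r = 0]
    too, where [ev_sol_euler] carries no information. *)
Lemma ev_sol_regular {I : Type} (P : I -> expr I) ks z i r rho :
  ks i = O -> converges (sol P ks z) rho -> Rabs r < rho ->
  is_derive (ev (sol P ks z) (Var i)) r (ev (sol P ks z) (P i) r / 2).
Proof.
  intros Hi H Hr.
  replace (ev (sol P ks z) (P i) r / 2)
    with (PSeries (PS_derive (coef (sol P ks z) (Var i))) r).
  - now apply ev_derivable with rho.
  - unfold Rdiv.
    replace (ev (sol P ks z) (P i) r * / 2) with (PSeries (PS_scal (/ 2) (coef (sol P ks z) (P i))) r)
      by (rewrite PSeries_scal; unfold ev; ring).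
    apply PSeries_ext; intros n.
    change (INR (S n) * sol P ks z i (S n) = / 2 * coef (sol P ks z) (P i) n).
    rewrite sol_S, Hi.
    replace (2 * n + 2 + 0)%nat with (2 * S n)%nat by lia.
    rewrite mult_INR; change (INR 2) with 2; field; apply not_0_INR; lia.
Qed.

Lemma ev_sol_0 {I : Type} (P : I -> expr I) ks z i : ev (sol P ks z) (Var i) 0 = z i.
Proof. unfold ev; now rewrite PSeries_0. Qed.

Lemma ev_smooth {I : Type} (x : I -> nat -> R) e rho :
  converges x rho -> smooth_on (fun r => Rabs r < rho) (ev x e).
Proof. intros H n r Hr; apply ex_derive_n_PSeries; now apply H. Qed.

(** * Smooth functions and uniqueness for ordinary differential equations *)

(** The derivative is exhibited as a function, so that products, compositions and roots are handled
    by induction on [n] without iterated Leibniz or chain rules. On an open [D] it agrees with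
    [smooth_on] when taken for all [n]. *)
Fixpoint Ck (D : R -> Prop) (n : nat) (g : R -> R) : Prop :=
  match n with
  | O => True
  | S n => exists g', (forall t, D t -> is_derive g t (g' t)) /\ Ck D n g'
  end.

Lemma smooth_Ck D g : smooth_on D g -> forall n, Ck D n g.
Proof.
  intros H n; change g with (Derive_n g 0); generalize O.
  induction n as [|n IH]; intros m; [exact I|].
  exists (Derive_n g (S m)); split; [|apply IH].
  intros t Ht; apply Derive_correct, (H (S m) t Ht).
Qed.

Lemma Ck_smooth D g : open D -> (forall n, Ck D n g) -> smooth_on D g.
Proof.
  intros HD H n; specialize (H n); revert g H.
  induction n as [|n IH]; intros g H t Ht; [exact I|].
  destruct H as [g' [H1 H2]]; destruct n as [|n]; [exists (g' t); now apply H1|].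
  change (ex_derive (Derive_n g (S n)) t).
  apply (ex_derive_ext (Derive_n (Derive_n g 1) n)).
  - intros x; rewrite Derive_n_comp; now rewrite Nat.add_1_r.
  - apply (ex_derive_n_ext_loc g' (Derive_n g 1) (S n)); [|now apply IH].
    apply (filter_imp D); [|now apply HD].
    intros x Hx; symmetry; apply is_derive_unique; now apply H1.
Qed.

Lemma Ck_pred D n g : Ck D (S n) g -> Ck D n g.
Proof.
  revert g; induction n as [|n IH]; intros g H; [exact I|].
  destruct H as [g' [H1 H2]]; exists g'; split; [exact H1|now apply IH].
Qed.

Lemma Ck_const D n c : Ck D n (fun _ => c).
Proof.
  revert c; induction n as [|n IH]; intros c; [exact I|].
  exists (fun _ => 0); split; [|apply IH].
  intros t _; exact (is_derive_const (V := R_NormedModule) c t).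
Qed.

Lemma Ck_add D n g h : Ck D n g -> Ck D n h -> Ck D n (fun t => g t + h t).
Proof.
  revert g h; induction n as [|n IH]; intros g h; [auto|].
  intros [g' [G1 G2]] [h' [H1 H2]]; exists (fun t => g' t + h' t); split; [|now apply IH].
  intros t Ht; apply (is_derive_plus (V := R_NormedModule)); auto.
Qed.

Lemma is_derive_mul (g h : R -> R) t g' h' :
  is_derive g t g' -> is_derive h t h' -> is_derive (fun x => g x * h x) t (g' * h t + g t * h').
Proof.
  intros Hg Hh; apply (is_derive_mult g h t g' h' Hg Hh); intros; apply Rmult_comm.
Qed.

Lemma is_derive_sq (g : R -> R) t g' :
  is_derive g t g' -> is_derive (fun x => g x ^ 2) t (2 * g t * g').
Proof.
  intros H; apply (is_derive_ext (fun x => g x * g x)); [intros x; simpl; change (g x * g x = g x * (g x * 1)); ring|].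
  replace (2 * g t * g') with (g' * g t + g t * g') by ring; now apply is_derive_mul.
Qed.

Lemma Ck_mul D n g h : Ck D n g -> Ck D n h -> Ck D n (fun t => g t * h t).
Proof.
  revert g h; induction n as [|n IH]; intros g h; [auto|].
  intros Hg Hh; generalize (Ck_pred _ _ _ Hg) (Ck_pred _ _ _ Hh); intros Pg Ph.
  destruct Hg as [g' [G1 G2]]; destruct Hh as [h' [H1 H2]].
  exists (fun t => g' t * h t + g t * h' t); split.
  - intros t Ht; apply is_derive_mul; auto.
  - apply Ck_add; now apply IH.
Qed.

Lemma Ck_comp D D' n g h :
  (forall t, D t -> D' (h t)) -> Ck D' n g -> Ck D n h -> Ck D n (fun t => g (h t)).
Proof.
  intros HD; revert g; induction n as [|n IH]; intros g Hg Hh; [exact I|].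
  generalize (Ck_pred _ _ _ Hh); intros Ph.
  destruct Hg as [g' [G1 G2]]; destruct Hh as [h' [H1 H2]].
  exists (fun t => h' t * g' (h t)); split.
  - intros t Ht; apply (is_derive_comp g h t); auto.
  - apply Ck_mul; [exact H2|now apply IH].
Qed.

(* The derivatives of [sqrt g] and [/ sqrt g] are polynomials in these two functions and [g']. *)
Lemma Ck_sqrt D n g :
  (forall t, D t -> 0 < g t) -> Ck D n g ->
  Ck D n (fun t => sqrt (g t)) /\ Ck D n (fun t => / sqrt (g t)).
Proof.
  intros Hp; induction n as [|n IH]; intros Hg; [split; exact I|].
  destruct (IH (Ck_pred _ _ _ Hg)) as [A B].
  destruct Hg as [g' [G1 G2]]; split.
  - exists (fun t => / 2 * (g' t * / sqrt (g t))); split.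
    + intros t Ht; specialize (Hp t Ht).
      generalize (is_derive_sqrt g t (g' t) (G1 t Ht) Hp).
      replace (g' t / (2 * sqrt (g t))) with (/ 2 * (g' t * / sqrt (g t))); auto.
      field; apply Rgt_not_eq, sqrt_lt_R0, Hp.
    + apply Ck_mul; [apply Ck_const|now apply Ck_mul].
  - exists (fun t => - / 2 * (g' t * (/ sqrt (g t) * (/ sqrt (g t) * / sqrt (g t))))); split.
    + intros t Ht; specialize (Hp t Ht).
      assert (Hs : 0 < sqrt (g t)) by (apply sqrt_lt_R0, Hp).
      generalize (is_derive_inv (fun t => sqrt (g t)) t _
        (is_derive_sqrt g t (g' t) (G1 t Ht) Hp)); intros H.
      replace (- / 2 * (g' t * (/ sqrt (g t) * (/ sqrt (g t) * / sqrt (g t)))))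
        with (- (g' t / (2 * sqrt (g t))) / sqrt (g t) ^ 2) by (field; lra).
      apply H; lra.
    + apply Ck_mul; [apply Ck_const|]; repeat apply Ck_mul; auto.
Qed.

Lemma smooth_const D c : open D -> smooth_on D (fun _ => c).
Proof. intros HD; apply Ck_smooth; auto; intros; apply Ck_const. Qed.

Lemma smooth_id D : open D -> smooth_on D (fun t => t).
Proof.
  intros HD; apply Ck_smooth; auto; intros [|n]; [exact I|].
  exists (fun _ => 1); split; [intros; apply (is_derive_id (K := R_AbsRing))|apply Ck_const].
Qed.

Lemma smooth_add D g h : open D -> smooth_on D g -> smooth_on D h -> smooth_on D (fun t => g t + h t).
Proof. intros HD Hg Hh; apply Ck_smooth; auto; intros; apply Ck_add; now apply smooth_Ck. Qed.

Lemma smooth_mul D g h : open D -> smooth_on D g -> smooth_on D h -> smooth_on D (fun t => g t * h t).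
Proof. intros HD Hg Hh; apply Ck_smooth; auto; intros; apply Ck_mul; now apply smooth_Ck. Qed.

Lemma smooth_comp D D' g h :
  open D -> (forall t, D t -> D' (h t)) -> smooth_on D' g -> smooth_on D h ->
  smooth_on D (fun t => g (h t)).
Proof.
  intros HD HDD Hg Hh; apply Ck_smooth; auto; intros; apply Ck_comp with D'; auto;
    now apply smooth_Ck.
Qed.

Lemma smooth_sqrt D g :
  open D -> (forall t, D t -> 0 < g t) -> smooth_on D g -> smooth_on D (fun t => sqrt (g t)).
Proof.
  intros HD Hp Hg; apply Ck_smooth; auto; intros; apply (Ck_sqrt D n g Hp); now apply smooth_Ck.
Qed.

Lemma smooth_ext D g h :
  open D -> (forall t, D t -> g t = h t) -> smooth_on D g -> smooth_on D h.
Proof.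
  intros HD E Hg n t Ht; apply (ex_derive_n_ext_loc g); [|now apply Hg].
  apply (filter_imp D); [exact E|now apply HD].
Qed.

Lemma smooth_derivable D g t : smooth_on D g -> D t -> ex_derive g t.
Proof. intros H Ht; exact (H 1%nat t Ht). Qed.

(** To the right of [t0] the product [N * exp (- K t)] does not increase, to the left
    [N * exp (K t)] does not decrease; both vanish at [t0], and [N >= 0]. *)
Lemma gronwall_zero (N N' : R -> R) (a b K t0 : R) :
  a <= t0 <= b -> 
  (forall t, a <= t <= b -> is_derive N t (N' t) /\ 0 <= N t /\ Rabs (N' t) <= K * N t) ->
  N t0 = 0 -> forall t, a <= t <= b -> N t = 0.
Proof.
  intros Ht0 H H0 t Ht.
  assert (X : forall k, (k = K \/ k = - K) -> forall s, a <= s <= b ->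
    is_derive (fun s => N s * exp (k * s)) s ((N' s + k * N s) * exp (k * s))).
  { intros k _ s Hs; destruct (H s Hs) as [H1 _].
    replace ((N' s + k * N s) * exp (k * s))
      with (N' s * exp (k * s) + N s * (k * exp (k * s))) by ring.
    apply (is_derive_mul N (fun s => exp (k * s))); [exact H1|auto_derive; [exact I|ring]]. }
  assert (E : forall k s, 0 < exp (k * s)) by (intros; apply exp_pos).
  apply Rle_antisym; [|apply (H t Ht)].
  destruct (Rle_dec t0 t) as [L|L].
  - destruct (MVT_gen (fun s => N s * exp (- K * s)) t0 t
      (fun s => (N' s + - K * N s) * exp (- K * s))) as [c [Hc E1]].
    + rewrite Rmin_left, Rmax_right by lra; intros x Hx; apply X; lra.
    + rewrite Rmin_left, Rmax_right by lra; intros x Hx.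
      apply derivable_continuous_pt; eexists; apply is_derive_Reals, X; lra.
    + rewrite Rmin_left, Rmax_right in Hc by lra; rewrite H0 in E1.
      destruct (H c) as [_ [P1 P2]]; [lra|].
      assert (N' c + - K * N c <= 0) by (generalize (Rle_abs (N' c)); lra).
      assert (((N' c + - K * N c) * exp (- K * c)) * (t - t0) <= 0).
      { generalize (E (- K) c); intros. 
        assert (0 <= - (N' c + - K * N c) * exp (- K * c)) by (apply Rmult_le_pos; lra).
        assert (0 <= (- (N' c + - K * N c) * exp (- K * c)) * (t - t0))
          by (apply Rmult_le_pos; lra). lra. }
      generalize (E (- K) t); intros; apply Rnot_lt_le; intros Hn.
      assert (0 < N t * exp (- K * t)) by (apply Rmult_lt_0_compat; auto); lra.
  - destruct (MVT_gen (fun s => N s * exp (K * s)) t t0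
      (fun s => (N' s + K * N s) * exp (K * s))) as [c [Hc E1]].
    + rewrite Rmin_left, Rmax_right by lra; intros x Hx; apply X; auto; lra.
    + rewrite Rmin_left, Rmax_right by lra; intros x Hx.
      apply derivable_continuous_pt; eexists; apply is_derive_Reals, X; auto; lra.
    + rewrite Rmin_left, Rmax_right in Hc by lra; rewrite H0 in E1.
      destruct (H c) as [_ [P1 P2]]; [lra|].
      assert (0 <= N' c + K * N c) by (generalize (Rle_abs (- N' c)); rewrite Rabs_Ropp; lra).
      assert (0 <= ((N' c + K * N c) * exp (K * c)) * (t0 - t)).
      { generalize (E K c); intros; repeat apply Rmult_le_pos; lra. }
      generalize (E K t); intros; apply Rnot_lt_le; intros Hn.
      assert (0 < N t * exp (K * t)) by (apply Rmult_lt_0_compat; auto); lra.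
Qed.

Lemma bounded_on (g : R -> R) a b :
  a <= b -> (forall t, a <= t <= b -> continuous g t) ->
  exists B, 0 <= B /\ forall t, a <= t <= b -> Rabs (g t) <= B.
Proof.
  intros Hab H.
  destruct (continuity_ab_maj (fun t => Rabs (g t)) a b Hab) as [m [Hm _]].
  - intros c Hc; apply continuity_pt_filterlim.
    apply (continuous_comp g Rabs); [now apply H|apply continuous_Rabs].
  - exists (Rabs (g m)); split; [apply Rabs_pos|exact Hm].
Qed.

(** The tool for propagating algebraic relations along a flow, with [e] the defect of the relation.
    Gronwall applies to [e ^ 2]. *)
Lemma linear_ode_zero (e h : R -> R) a b t0 :
  a <= t0 <= b ->
  (forall t, a <= t <= b -> is_derive e t (h t * e t) /\ continuous h t) ->
  e t0 = 0 -> forall t, a <= t <= b -> e t = 0.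
Proof.
  intros Ht0 H H0 t Ht.
  destruct (bounded_on h a b) as [B [HB1 HB2]]; [lra|intros; now apply H|].
  assert (Z : e t ^ 2 = 0).
  { apply (gronwall_zero (fun s => e s ^ 2) (fun s => 2 * h s * e s ^ 2) a b (2 * B) t0); auto.
    - intros s Hs; split; [|split].
      + destruct (H s Hs) as [H1 _]; rewrite Rmult_assoc.
        replace (2 * (h s * e s ^ 2)) with (2 * e s * (h s * e s)) by ring.
        now apply is_derive_sq.
      + apply pow2_ge_0.
      + rewrite Rabs_mult, (Rabs_right (e s ^ 2)) by apply Rle_ge, pow2_ge_0.
        apply Rmult_le_compat_r; [apply pow2_ge_0|].
        rewrite Rabs_mult, (Rabs_right 2) by lra.
        apply Rmult_le_compat_l; [lra|now apply HB2].
    - rewrite H0; ring. }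
  nra.
Qed.

(** Expressions whose value at [r] is a function of the values of the unknowns at [r], that is,
    polynomial autonomous vector fields. For the other constructors [eval] returns the dummy value
    0. *)
Fixpoint plain {I : Type} (e : expr I) : Prop :=
  match e with
  | Cst _ | Var _ => True
  | Add e1 e2 | Mul e1 e2 => plain e1 /\ plain e2
  | Shift _ | Int _ _ => False
  end.

Fixpoint eval {I : Type} (v : I -> R) (e : expr I) : R :=
  match e with
  | Cst c => c
  | Var i => v i
  | Add e1 e2 => eval v e1 + eval v e2
  | Mul e1 e2 => eval v e1 * eval v e2
  | Shift _ | Int _ _ => 0
  end.

Lemma ev_plain {I : Type} (x : I -> nat -> R) e r rho :
  converges x rho -> Rabs r < rho -> plain e ->
  ev x e r = eval (fun i => ev x (Var i) r) e.
Proof.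
  intros H Hr; induction e as [c|i|e1 H1 e2 H2|e1 H1 e2 H2|e H1|m e H1]; simpl; try tauto.
  - intros _; apply ev_Cst.
  - intros [P1 P2]; rewrite (ev_Add _ _ _ _ rho), H1, H2; auto.
  - intros [P1 P2]; rewrite (ev_Mul _ _ _ _ rho), H1, H2; auto.
Qed.

Lemma eval_lipschitz {I : Type} (e : expr I) B :
  0 <= B -> exists L, 0 <= L /\ forall v w d,
    (forall i, Rabs (v i) <= B) -> (forall i, Rabs (w i) <= B) ->
    0 <= d -> (forall i, Rabs (v i - w i) <= d) ->
    Rabs (eval v e) <= L /\ Rabs (eval w e) <= L /\ Rabs (eval v e - eval w e) <= L * d.
Proof.
  intros HB; induction e as [c|i|e1 [L1 [P1 H1]] e2 [L2 [P2 H2]]|e1 [L1 [P1 H1]] e2 [L2 [P2 H2]]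
    |e _|m e _]; simpl.
  - exists (Rabs c); split; [apply Rabs_pos|]; intros v w d _ _ Hd _.
    rewrite Rminus_diag, Rabs_R0; generalize (Rabs_pos c); intros; repeat split; try lra.
    now apply Rmult_le_pos.
  (* [B] for the value, 1 for the Lipschitz constant. *)
  - exists (B + 1); split; [lra|]; intros v w d Hv Hw Hd Hvw.
    generalize (Hv i) (Hw i) (Hvw i); intros; repeat split; try lra; nra.
  - exists (L1 + L2); split; [lra|]; intros v w d Hv Hw Hd Hvw.
    destruct (H1 v w d Hv Hw Hd Hvw) as [A1 [A2 A3]].
    destruct (H2 v w d Hv Hw Hd Hvw) as [B1 [B2 B3]].
    repeat split.
    + eapply Rle_trans; [apply Rabs_triang|]; lra.
    + eapply Rle_trans; [apply Rabs_triang|]; lra.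
    + replace (eval v e1 + eval v e2 - (eval w e1 + eval w e2))
        with ((eval v e1 - eval w e1) + (eval v e2 - eval w e2)) by ring.
      eapply Rle_trans; [apply Rabs_triang|]; lra.
  - exists (2 * L1 * L2); split; [nra|]; intros v w d Hv Hw Hd Hvw.
    destruct (H1 v w d Hv Hw Hd Hvw) as [A1 [A2 A3]].
    destruct (H2 v w d Hv Hw Hd Hvw) as [B1 [B2 B3]].
    assert (0 <= L1 * L2) by nra.
    repeat split.
    + rewrite Rabs_mult; apply Rle_trans with (L1 * L2); [|lra].
      apply Rmult_le_compat; auto using Rabs_pos.
    + rewrite Rabs_mult; apply Rle_trans with (L1 * L2); [|lra].
      apply Rmult_le_compat; auto using Rabs_pos.
    + replace (eval v e1 * eval v e2 - eval w e1 * eval w e2)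
        with ((eval v e1 - eval w e1) * eval v e2 + eval w e1 * (eval v e2 - eval w e2)) by ring.
      eapply Rle_trans; [apply Rabs_triang|]; rewrite !Rabs_mult.
      replace (2 * L1 * L2 * d) with (L1 * d * L2 + L1 * (L2 * d)) by ring.
      apply Rplus_le_compat; apply Rmult_le_compat; auto using Rabs_pos.
  - exists 0; split; [lra|]; intros; rewrite Rminus_diag, Rabs_R0; lra.
  - exists 0; split; [lra|]; intros; rewrite Rminus_diag, Rabs_R0; lra.
Qed.

Lemma common_bound {I : Type} (l : list I) (Q : I -> R -> Prop) :
  (forall i b b', Q i b -> b <= b' -> Q i b') ->
  (forall i, In i l -> exists b, 0 <= b /\ Q i b) ->
  exists b, 0 <= b /\ forall i, In i l -> Q i b.
Proof.
  intros mono; induction l as [|a l IH]; intros H.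
  - exists 0; split; [lra|intros i []].
  - destruct IH as [b [Hb IH]]; [intros; apply H; now right|].
    destruct (H a) as [b' [Hb' Ha]]; [now left|].
    exists (b + b'); split; [lra|]; intros i [<-|Hi].
    + apply (mono a b'); [assumption|lra].
    + apply (mono i b); [auto|lra].
Qed.

Fixpoint sum_list {I : Type} (l : list I) (g : I -> R) : R :=
  match l with nil => 0 | i :: l => g i + sum_list l g end.

Lemma sum_list_ge {I : Type} (l : list I) (g : I -> R) :
  (forall i, 0 <= g i) -> 0 <= sum_list l g /\ forall i, In i l -> g i <= sum_list l g.
Proof.
  intros H; induction l as [|a l [H1 H2]]; simpl; [split; [lra|tauto]|].
  split; [generalize (H a); lra|].
  intros i [<-|Hi]; [lra|]; generalize (H2 i Hi) (H a); lra.
Qed.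

Lemma sum_list_le {I : Type} (l : list I) (g : I -> R) c :
  (forall i, Rabs (g i) <= c) -> Rabs (sum_list l g) <= INR (length l) * c.
Proof.
  intros H; induction l as [|a l IH]; [simpl; rewrite Rabs_R0; lra|].
  cbn [sum_list length]; rewrite S_INR.
  eapply Rle_trans; [apply Rabs_triang|]; generalize (H a); lra.
Qed.

Lemma is_derive_sum_list {I : Type} (l : list I) (g g' : I -> R -> R) t :
  (forall i, is_derive (g i) t (g' i t)) ->
  is_derive (fun s => sum_list l (fun i => g i s)) t (sum_list l (fun i => g' i t)).
Proof.
  intros H; induction l as [|a l IH]; simpl.
  - exact (is_derive_const (V := R_NormedModule) 0 t).
  - now apply (is_derive_plus (V := R_NormedModule)).
Qed.

(** Gronwall for the squared Euclidean distance. Both trajectories are bounded on the compact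
    interval, and a polynomial field is Lipschitz on bounded sets. *)
Lemma ode_unique {I : Type} (P : I -> expr I) (l : list I) (v w : I -> R -> R) (a b t0 : R) :
  (forall i, In i l) -> a <= t0 <= b ->
  (forall t, a <= t <= b -> forall i,
    is_derive (v i) t (eval (fun j => v j t) (P i))
    /\ is_derive (w i) t (eval (fun j => w j t) (P i))) ->
  (forall i, v i t0 = w i t0) ->
  forall t, a <= t <= b -> forall i, v i t = w i t.
Proof.
  intros Hl Ht0 H H0 t Ht i.
  destruct (common_bound l (fun i b' => forall t, a <= t <= b ->
    Rabs (v i t) <= b' /\ Rabs (w i t) <= b')) as [B [HB HBB]].
  - intros j b1 b2 H1 H2 s Hs; destruct (H1 s Hs); lra.
  - intros j _.
    destruct (bounded_on (v j) a b) as [b1 [P1 H1]]; [lra| |].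
    { intros s Hs; apply (ex_derive_continuous (V := R_NormedModule)).
      eexists; apply (H s Hs j). }
    destruct (bounded_on (w j) a b) as [b2 [P2 H2]]; [lra| |].
    { intros s Hs; apply (ex_derive_continuous (V := R_NormedModule)).
      eexists; apply (H s Hs j). }
    exists (b1 + b2); split; [lra|]; intros s Hs; generalize (H1 s Hs) (H2 s Hs); lra.
  - destruct (common_bound l (fun i L => forall v w d,
      (forall i, Rabs (v i) <= B) -> (forall i, Rabs (w i) <= B) ->
      0 <= d -> (forall i, Rabs (v i - w i) <= d) ->
      Rabs (eval v (P i) - eval w (P i)) <= L * d)) as [L [HL HLL]].
    + intros j b1 b2 H1 H2 v' w' d K1 K2 K3 K4; specialize (H1 v' w' d K1 K2 K3 K4); nra.
    + intros j _; destruct (eval_lipschitz (P j) B HB) as [L [P1 H1]].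
      exists L; split; [exact P1|]; intros v' w' d K1 K2 K3 K4; now apply H1.
    + assert (Z : forall s, 0 <= sum_list l (fun i => (v i s - w i s) ^ 2)
        /\ forall i, (v i s - w i s) ^ 2 <= sum_list l (fun i => (v i s - w i s) ^ 2)).
      { intros s; destruct (sum_list_ge l (fun i => (v i s - w i s) ^ 2)) as [Z1 Z2].
        - intros; apply pow2_ge_0.
        - split; [exact Z1|]; intros j; now apply Z2. }
      assert (E : sum_list l (fun i => (v i t - w i t) ^ 2) = 0).
      { apply (gronwall_zero (fun s => sum_list l (fun i => (v i s - w i s) ^ 2))
          (fun s => sum_list l (fun i => 2 * (v i s - w i s) *
            (eval (fun j => v j s) (P i) - eval (fun j => w j s) (P i))))
          a b (INR (length l) * (2 * L)) t0); auto.
        - intros s Hs; destruct (Z s) as [Z1 Z2]; split; [|split; [exact Z1|]].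
          + apply (is_derive_sum_list l (fun i s => (v i s - w i s) ^ 2)
              (fun i s => 2 * (v i s - w i s) *
                (eval (fun j => v j s) (P i) - eval (fun j => w j s) (P i)))).
            intros j; destruct (H s Hs j) as [H1 H2].
            apply (is_derive_sq (fun x => v j x - w j x)).
            now apply (is_derive_minus (V := R_NormedModule)).
          + set (N := sum_list l (fun i => (v i s - w i s) ^ 2)) in *.
            rewrite Rmult_assoc; apply sum_list_le; intros j.
            assert (D : forall k, Rabs (v k s - w k s) <= sqrt N).
            { intros k; rewrite <- sqrt_Rsqr_abs; apply sqrt_le_1_alt.
              rewrite Rsqr_pow2; apply Z2. }
            rewrite !Rabs_mult, (Rabs_right 2) by lra.
            replace (2 * L * N) with (2 * sqrt N * (L * sqrt N)).
            * apply Rmult_le_compat.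
              -- generalize (Rabs_pos (v j s - w j s)); lra.
              -- apply Rabs_pos.
              -- generalize (D j); lra.
              -- apply (HLL j (Hl j)); auto using sqrt_pos; intros k; now apply HBB.
            * replace (2 * sqrt N * (L * sqrt N)) with (2 * L * (sqrt N * sqrt N)) by ring.
              now rewrite sqrt_sqrt.
        - clear - H0; induction l as [|k m IH]; cbn [sum_list]; [reflexivity|].
          rewrite IH, H0; ring. }
      destruct (Z t) as [_ Z2]; specialize (Z2 i); rewrite E in Z2.
      generalize (pow2_ge_0 (v i t - w i t)); intros; nra.
Qed.

(** * The soliton system as a polynomial system *)

(* [F_i], [1 / F_i], [sigma_i] and [1 / V]. *)
Inductive rvar := vF (i : summand) | vx (i : summand) | vs (i : summand) | vy.

Definition rvars : list rvar :=
  vF s1 :: vF s2 :: vF s3 :: vx s1 :: vx s2 :: vx s3 :: vs s1 :: vs s2 :: vs s3 :: vy :: nil.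

Lemma in_rvars v : In v rvars.
Proof. destruct v as [[]|[]|[]|]; simpl; tauto. Qed.

Definition esum (g : summand -> expr rvar) : expr rvar := Add (Add (g s1) (g s2)) (g s3).

Definition e_u : expr rvar :=
  Mul (Cst (- / 3)) (esum (fun j => Mul (Var (vs j)) (Var (vx j)))).

(** The logarithmic derivative of [F_i] without its part [sigma_i / F_i]; shared by the equations
    for [F_i] and [1 / F_i]. *)
Definition e_slope (i : summand) : expr rvar :=
  Add e_u (Mul (Cst (-1)) (Mul (Var vy)
    (Add (Mul (Cst 2) (Var (vF i))) (Mul (Cst (-1)) (esum (fun j => Var (vF j))))))).

Definition rhs (lam : R) (v : rvar) : expr rvar :=
  match v with
  | vF i => Add (Var (vs i)) (Mul (Var (vF i)) (e_slope i))
  | vx i => Mul (Cst (-1)) (Mul (Var (vx i))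
      (Add (Mul (Var (vs i)) (Var (vx i))) (e_slope i)))
  | vs i => Mul (Cst lam) (Var (vF i))
  | vy => Mul (Cst (- / 2)) (Mul (Mul (Var vy) (Var vy)) (esum (fun j => Var (vF j))))
  end.

Lemma plain_rhs lam v : plain (rhs lam v).
Proof. destruct v; simpl; tauto. Qed.

Definition sdata (s : profile) (t : R) (v : rvar) : R :=
  match v with
  | vF i => f s i t ^ 2
  | vx i => / f s i t ^ 2
  | vs i => tau s i t - u s t * f s i t ^ 2
  | vy => / vol s t
  end.

(** The invariant set on which the enlarged polynomial system is the soliton system. Since only the
    [F_i] are at hand, [1 / V] is tied to them through its square, and its sign is prescribed
    separately. *)
Definition admissible (lam : R) (d : rvar -> R) : Prop :=
  (forall i, 0 < d (vF i)) /\ (forall i, d (vx i) = / d (vF i))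
  /\ 0 < d vy /\ d vy ^ 2 * (d (vF s1) * d (vF s2) * d (vF s3)) = 1
  /\ sum3 (fun i => d (vs i)) = 2 * lam / d vy.

Lemma open_dom s : open (dom s).
Proof. apply open_and; [apply open_Rbar_gt|apply open_Rbar_lt]. Qed.

Lemma dom_convex s a b t : dom s a -> dom s b -> a <= t <= b -> dom s t.
Proof.
  intros [A _] [_ B] [H1 H2]; split.
  - apply Rbar_lt_le_trans with a; [exact A|exact H1].
  - apply Rbar_le_lt_trans with b; [exact H2|exact B].
Qed.

Lemma sum3_ext (g h : summand -> R) : (forall i, g i = h i) -> sum3 g = sum3 h.
Proof. intros H; unfold sum3; now rewrite !H. Qed.

Lemma vol_pos lam s t : SU3_soliton lam s -> dom s t -> 0 < vol s t.
Proof.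
  intros [_ [_ [_ H]]] Ht; destruct (H t Ht) as [Hf _].
  unfold vol; apply Rmult_lt_0_compat; auto; apply Rmult_lt_0_compat; auto.
Qed.

Lemma soliton_admissible lam s t :
  SU3_soliton lam s -> dom s t -> admissible lam (sdata s t).
Proof.
  intros HS Ht; generalize (vol_pos _ _ _ HS Ht); intros HV.
  destruct HS as [_ [_ [_ H]]]; destruct (H t Ht) as [Hf [_ [_ H3]]].
  split; [|split; [|split; [|split]]]; simpl.
  - intros i; generalize (Hf i); intros; nra.
  - reflexivity.
  - now apply Rinv_0_lt_compat.
  - generalize (Hf s1) (Hf s2) (Hf s3); unfold vol; intros; field; lra.
  - unfold sum3 in *; unfold sumsq, sum3 in H3.
    replace (2 * lam / / vol s t) with (2 * lam * vol s t) by (field; lra); lra.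
Qed.

Lemma eval_e_slope d i :
  eval d (e_slope i) = eval d e_u - d vy * (2 * d (vF i) - sum3 (fun j => d (vF j))).
Proof. unfold e_slope, sum3; cbn -[e_u]; ring. Qed.

Lemma is_derive_vol s t :
  (forall i, ex_derive (f s i) t) ->
  is_derive (vol s) t (Derive (f s s1) t * f s s2 t * f s s3 t
    + f s s1 t * Derive (f s s2) t * f s s3 t + f s s1 t * f s s2 t * Derive (f s s3) t).
Proof.
  intros H; unfold vol.
  replace (Derive (f s s1) t * f s s2 t * f s s3 t
    + f s s1 t * Derive (f s s2) t * f s s3 t + f s s1 t * f s s2 t * Derive (f s s3) t)
    with ((Derive (f s s1) t * f s s2 t + f s s1 t * Derive (f s s2) t) * f s s3 t
    + f s s1 t * f s s2 t * Derive (f s s3) t) by ring.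
  apply (is_derive_mul (fun x => f s s1 x * f s s2 x)); [|now apply Derive_correct].
  apply is_derive_mul; now apply Derive_correct.
Qed.

Lemma soliton_tau lam s t i :
  SU3_soliton lam s -> dom s t ->
  tau s i t = 2 * f s i t * Derive (f s i) t
    + f s i t ^ 2 / vol s t * (2 * f s i t ^ 2 - sumsq s t).
Proof.
  intros [_ [Hf _]] Ht; unfold tau; f_equal.
  apply is_derive_unique, is_derive_sq, Derive_correct.
  apply (smooth_derivable (dom s)); auto.
Qed.

(** As [2 V' / V = sum F_i' / F_i], the equation [2 V' = sum F_j] says exactly that
    [sum tau_i / F_i = 0]. Substituting [tau_i = sigma_i + u F_i] gives
    [sum sigma_i / F_i = - 3 u]. *)
Lemma soliton_u lam s t : SU3_soliton lam s -> dom s t -> u s t = eval (sdata s t) e_u.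
Proof.
  intros HS Ht; generalize (vol_pos _ _ _ HS Ht); intros HV.
  assert (T := fun i => soliton_tau lam s t i HS Ht).
  destruct HS as [_ [Hs [_ H]]]; destruct (H t Ht) as [Hf [H1 _]].
  rewrite (is_derive_unique _ _ _ (is_derive_vol s t
    (fun i => smooth_derivable _ _ _ (Hs i) Ht))) in H1.
  simpl; rewrite !T.
  unfold sumsq, sum3 in *; unfold vol in *.
  generalize (Hf s1) (Hf s2) (Hf s3); intros P1 P2 P3; clear - H1 P1 P2 P3.
  set (a := f s s1 t) in *; set (b := f s s2 t) in *; set (c := f s s3 t) in *.
  assert (E : Derive (f s s1) t = ((a ^ 2 + b ^ 2 + c ^ 2) / 2 - a * Derive (f s s2) t * c
    - a * b * Derive (f s s3) t) / (b * c)).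
  { rewrite <- H1; field; lra. }
  rewrite E; field; lra.
Qed.

Lemma soliton_u_tau lam s t i :
  SU3_soliton lam s -> dom s t ->
  u s t = eval (sdata s t) e_u
  /\ tau s i t = sdata s t (vs i) + eval (sdata s t) e_u * sdata s t (vF i).
Proof.
  intros HS Ht; rewrite <- (soliton_u lam s t HS Ht); split; [reflexivity|simpl; ring].
Qed.

Lemma smooth_sq D g : open D -> smooth_on D g -> smooth_on D (fun t => g t ^ 2).
Proof.
  intros HD Hg; apply (smooth_ext D (fun t => g t * g t)); auto; [intros; ring|].
  now apply smooth_mul.
Qed.

Lemma smooth_vol s : (forall i, smooth_on (dom s) (f s i)) -> smooth_on (dom s) (vol s).
Proof.
  intros H; apply (smooth_mul _ (fun x => f s s1 x * f s s2 x)); [apply open_dom| |apply H].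
  apply smooth_mul; auto using open_dom.
Qed.

(** [Derive] is total, so the soliton equation for [tau_i - u F_i] yields a true derivative only
    once [tau_i] is known to be differentiable; this comes from the smoothness of the [f_i]. *)
Lemma ex_derive_tau lam s t i : SU3_soliton lam s -> dom s t -> ex_derive (tau s i) t.
Proof.
  intros HS Ht; generalize (vol_pos _ _ _ HS Ht); intros HV.
  destruct HS as [_ [Hs _]]; assert (HD := open_dom s).
  assert (Hq : forall j, smooth_on (dom s) (fun x => f s j x ^ 2)) by (intros; now apply smooth_sq).
  assert (Hv : smooth_on (dom s) (vol s)) by now apply smooth_vol.
  assert (Hz : smooth_on (dom s) (sumsq s)).
  { apply (smooth_add _ (fun x => f s s1 x ^ 2 + f s s2 x ^ 2)); auto.
    apply smooth_add; auto. }
  assert (E : forall g, smooth_on (dom s) g -> ex_derive g t)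
    by (intros g Hg; now apply (smooth_derivable (dom s))).
  unfold tau; apply (ex_derive_plus (V := R_NormedModule)).
  - exact (Hq i 2%nat t Ht).
  - apply ex_derive_mult; [apply ex_derive_div; [now apply E|now apply E|lra]|].
    apply (ex_derive_minus (V := R_NormedModule)); [|now apply E].
    apply ex_derive_mult; [apply (ex_derive_const (V := R_NormedModule))|now apply E].
Qed.

Lemma soliton_ode lam s t :
  SU3_soliton lam s -> dom s t ->
  forall v, is_derive (fun x => sdata s x v) t (eval (sdata s t) (rhs lam v)).
Proof.
  intros HS Ht; generalize (vol_pos _ _ _ HS Ht); intros HV.
  assert (T := fun i => soliton_tau lam s t i HS Ht).
  assert (HU := soliton_u lam s t HS Ht).
  assert (HT := fun i => ex_derive_tau lam s t i HS Ht).
  destruct HS as [_ [Hs [Hu H]]]; destruct (H t Ht) as [Hf [H1 [H2 _]]].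
  assert (Ef : forall i, ex_derive (f s i) t) by (intros; now apply (smooth_derivable (dom s))).
  assert (HF : forall i, is_derive (fun x => f s i x ^ 2) t (2 * f s i t * Derive (f s i) t))
    by (intros; now apply is_derive_sq, Derive_correct).
  assert (EF : forall i, eval (sdata s t) (rhs lam (vF i)) = 2 * f s i t * Derive (f s i) t).
  { intros i; change (eval (sdata s t) (rhs lam (vF i)))
      with (sdata s t (vs i) + sdata s t (vF i) * eval (sdata s t) (e_slope i)).
    rewrite eval_e_slope, <- HU; cbn [sdata]; rewrite T.
    unfold sumsq; field; lra. }
  intros [i|i|i|].
  - rewrite EF; apply HF.
  - change (eval (sdata s t) (rhs lam (vx i))) with (-1 * (sdata s t (vx i) *
      (sdata s t (vs i) * sdata s t (vx i) + eval (sdata s t) (e_slope i)))).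
    specialize (EF i).
    change (eval (sdata s t) (rhs lam (vF i)))
      with (sdata s t (vs i) + sdata s t (vF i) * eval (sdata s t) (e_slope i)) in EF.
    assert (P : 0 < f s i t ^ 2) by (apply pow_lt, Hf).
    replace (-1 * _) with (- (2 * f s i t * Derive (f s i) t) / (f s i t ^ 2) ^ 2).
    + apply (is_derive_inv (fun x => f s i x ^ 2)); [apply HF|lra].
    + rewrite <- EF; cbn [sdata]; field; specialize (Hf i); lra.
  - change (eval (sdata s t) (rhs lam (vs i))) with (lam * f s i t ^ 2).
    rewrite <- H2; apply Derive_correct.
    apply (ex_derive_minus (V := R_NormedModule)); [apply HT|].
    apply ex_derive_mult; [now apply (smooth_derivable (dom s))|eexists; apply HF].
  - replace (eval (sdata s t) (rhs lam vy)) with (- Derive (vol s) t / vol s t ^ 2).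
    + apply is_derive_inv; [|lra].
      rewrite (is_derive_unique _ _ _ (is_derive_vol s t Ef)); now apply is_derive_vol.
    + replace (Derive (vol s) t) with (sumsq s t / 2) by lra.
      unfold sumsq, sum3; simpl; field; lra.
Qed.

Lemma is_derive_shift (g : R -> R) c t l :
  is_derive g (t - c) l -> is_derive (fun x => g (x - c)) t l.
Proof.
  intros H; replace l with (scal 1 l) by apply (Rmult_1_l l).
  apply (is_derive_comp g (fun x => x - c)); [exact H|].
  auto_derive; [exact I|ring].
Qed.

Lemma soliton_unique lam s s' c t0 :
  SU3_soliton lam s -> SU3_soliton lam s' ->
  dom s t0 -> dom s' (t0 - c) -> (forall v, sdata s t0 v = sdata s' (t0 - c) v) ->
  forall t, dom s t -> dom s' (t - c) -> forall v, sdata s t v = sdata s' (t - c) v.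
Proof.
  intros HS HS' D0 D0' E t Dt Dt' v.
  apply (ode_unique (rhs lam) rvars (fun v x => sdata s x v) (fun v x => sdata s' (x - c) v)
    (Rmin t0 t) (Rmax t0 t) t0).
  - apply in_rvars.
  - split; [apply Rmin_l|apply Rmax_l].
  - intros x Hx i.
    assert (Dx : dom s x).
    { apply (dom_convex s (Rmin t0 t) (Rmax t0 t)); auto;
        [apply Rmin_case|apply Rmax_case]; auto. }
    assert (Dx' : dom s' (x - c)).
    { apply (dom_convex s' (Rmin t0 t - c) (Rmax t0 t - c)); [| |lra];
        [apply Rmin_case|apply Rmax_case]; auto. }
    split.
    + now apply soliton_ode.
    + apply (is_derive_shift (fun x => sdata s' x i)); now apply soliton_ode.
  - exact E.
  - split; [apply Rmin_r|apply Rmax_r].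
Qed.

Lemma sdata_fields lam s s' t t' :
  SU3_soliton lam s -> SU3_soliton lam s' -> dom s t -> dom s' t' ->
  (forall v, sdata s t v = sdata s' t' v) ->
  (forall i, f s i t = f s' i t') /\ (forall i, tau s i t = tau s' i t') /\ u s t = u s' t'.
Proof.
  intros HS HS' D D' E.
  assert (EU : eval (sdata s t) e_u = eval (sdata s' t') e_u) by (cbn [eval e_u esum]; now rewrite !E).
  split; [|split].
  - intros i; specialize (E (vF i)); simpl in E.
    destruct HS as [_ [_ [_ H]]]; destruct (H t D) as [Hf _].
    destruct HS' as [_ [_ [_ H']]]; destruct (H' t' D') as [Hf' _].
    generalize (Hf i) (Hf' i); intros; nra.
  - intros i; destruct (soliton_u_tau lam s t i HS D) as [_ ->].
    destruct (soliton_u_tau lam s' t' i HS' D') as [_ ->]; now rewrite EU, !E.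
  - destruct (soliton_u_tau lam s t s1 HS D) as [-> _].
    now destruct (soliton_u_tau lam s' t' s1 HS' D') as [-> _].
Qed.

(** [same] compares only [f] and [u], but on an open interval, where [f] determines its derivative
    and hence [tau]. Uniqueness carries the agreement to the whole common domain. *)
Lemma same_sdata lam s s' :
  SU3_soliton lam s -> SU3_soliton lam s' -> same s s' ->
  exists c t0, dom s t0 /\ dom s' (t0 - c)
    /\ forall t, dom s t -> dom s' (t - c) -> forall v, sdata s t v = sdata s' (t - c) v.
Proof.
  intros HS HS' [a [b [c [Hab H]]]].
  set (t0 := (a + b) / 2).
  assert (H0 : a < t0 < b) by (unfold t0; lra).
  destruct (H t0 H0) as [D [D' [Ef Eu]]].
  assert (T : forall i, tau s i t0 = tau s' i (t0 - c)).
  { intros i; unfold tau.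
    assert (EV : vol s t0 = vol s' (t0 - c)) by (unfold vol; now rewrite !Ef).
    assert (ES : sumsq s t0 = sumsq s' (t0 - c)) by (unfold sumsq, sum3; now rewrite !Ef).
    rewrite EV, ES, (Ef i); f_equal.
    apply is_derive_unique, (is_derive_ext_loc (fun x => f s' i (x - c) ^ 2)).
    - apply (locally_interval _ t0 a b); try apply H0.
      intros y H1 H2; destruct (H y (conj H1 H2)) as [_ [_ [E _]]]; now rewrite E.
    - apply (is_derive_shift (fun x => f s' i x ^ 2)), Derive_correct.
      destruct HS' as [_ [Hs _]]; apply (smooth_derivable (dom s')); [|exact D'].
      apply smooth_sq; auto using open_dom. }
  exists c, t0; split; [exact D|split; [exact D'|]].
  apply (soliton_unique lam s s' c t0); auto.
  intros [i|i|i|]; simpl; rewrite ?T, ?Ef, ?Eu; auto.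
  unfold vol; now rewrite !Ef.
Qed.

Lemma sdata_same lam s s' c t0 :
  SU3_soliton lam s -> SU3_soliton lam s' -> dom s t0 -> dom s' (t0 - c) ->
  (forall v, sdata s t0 v = sdata s' (t0 - c) v) -> same s s'.
Proof.
  intros HS HS' D D' E.
  destruct (open_dom s t0 D) as [e He]; destruct (open_dom s' _ D') as [e' He'].
  exists (t0 - Rmin e e'), (t0 + Rmin e e'), c; split.
  - generalize (cond_pos e) (cond_pos e'); intros; apply Rmin_case; lra.
  - intros t Ht.
    assert (Dt : dom s t).
    { apply He; change (Rabs (t - t0) < e); apply Rabs_def1; generalize (Rmin_l e e'); lra. }
    assert (Dt' : dom s' (t - c)).
    { apply He'; change (Rabs (t - c - (t0 - c)) < e').
      apply Rabs_def1; generalize (Rmin_r e e'); lra. }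
    split; [exact Dt|split; [exact Dt'|]].
    destruct (sdata_fields lam s s' t (t - c)) as [A [_ B]]; auto.
    now apply (soliton_unique lam s s' c t0).
Qed.

Lemma vol_increasing lam s t t' :
  SU3_soliton lam s -> dom s t -> dom s t' -> t < t' -> vol s t < vol s t'.
Proof.
  intros HS D D' L.
  assert (X : forall x, t <= x <= t' -> is_derive (vol s) x (sumsq s x / 2) /\ 0 < sumsq s x).
  { intros x Hx; assert (Dx : dom s x) by now apply (dom_convex s t t').
    destruct HS as [_ [Hs [_ H]]]; destruct (H x Dx) as [Hf [H1 _]]; split.
    - replace (sumsq s x / 2) with (Derive (vol s) x) by lra.
      apply Derive_correct, (smooth_derivable (dom s)); [|exact Dx].
      now apply smooth_vol.
    - unfold sumsq, sum3; generalize (Hf s1) (Hf s2) (Hf s3); intros; nra. }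
  destruct (MVT_gen (vol s) t t' (fun x => sumsq s x / 2)) as [x [Hx E]].
  - rewrite Rmin_left, Rmax_right by lra; intros x Hx; apply X; lra.
  - rewrite Rmin_left, Rmax_right by lra; intros x Hx.
    apply derivable_continuous_pt; eexists; apply is_derive_Reals, X; lra.
  - rewrite Rmin_left, Rmax_right in Hx by lra; destruct (X x Hx) as [_ P].
    assert (0 < sumsq s x / 2 * (t' - t)) by (apply Rmult_lt_0_compat; lra); lra.
Qed.

(** Converse of [soliton_ode], used for the regular flow and for the singular solutions alike. [V]
    is supplied as a positive square root of [F_1 F_2 F_3] whose derivative is known, so the product
    of the roots [f_i] need not be differentiated. *)
Lemma soliton_of_ode lam (a b : Rbar) (F sg : summand -> R -> R) (w V : R -> R) :
  let s := Profile a b (fun i t => sqrt (F i t)) w in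
  Rbar_lt a b ->
  (forall i, smooth_on (dom s) (F i)) -> smooth_on (dom s) w ->
  (forall t, dom s t ->
     (forall i, 0 < F i t) /\ 0 < V t /\ V t ^ 2 = F s1 t * F s2 t * F s3 t
     /\ is_derive V t (sum3 (fun i => F i t) / 2)
     /\ (forall i, is_derive (F i) t (sg i t + w t * F i t
          - F i t / V t * (2 * F i t - sum3 (fun j => F j t))))
     /\ (forall i, is_derive (sg i) t (lam * F i t))
     /\ sum3 (fun i => sg i t) = 2 * lam * V t) ->
  SU3_soliton lam s
  /\ forall t, dom s t -> vol s t = V t
     /\ forall i, f s i t ^ 2 = F i t /\ tau s i t = sg i t + w t * F i t.
Proof.
  intros s Hab HF Hw H.
  assert (L : forall t (P : R -> Prop), dom s t -> (forall x, dom s x -> P x) -> locally t P).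
  { intros t P Ht HP; apply (filter_imp (dom s)); [exact HP|now apply open_dom]. }
  assert (Q : forall t, dom s t -> forall i, f s i t ^ 2 = F i t).
  { intros t Ht i; simpl; destruct (H t Ht) as [Hp _].
    rewrite Rmult_1_r; apply sqrt_sqrt; left; apply Hp. }
  assert (HV : forall t, dom s t -> vol s t = V t).
  { intros t Ht; destruct (H t Ht) as [Hp [HV [HV2 _]]]; unfold vol; simpl.
    generalize (Hp s1) (Hp s2) (Hp s3); intros.
    rewrite <- !sqrt_mult, <- HV2 by nra; apply sqrt_pow2; lra. }
  assert (HS : forall t, dom s t -> sumsq s t = sum3 (fun i => F i t)).
  { intros t Ht; unfold sumsq; apply sum3_ext; auto. }
  assert (HT : forall t, dom s t -> forall i, tau s i t = sg i t + w t * F i t).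
  { intros t Ht i; destruct (H t Ht) as [Hp [HV0 [HV2 [_ [HF' _]]]]]; unfold tau.
    rewrite HV, HS, Q by assumption.
    rewrite (is_derive_unique _ _ (sg i t + w t * F i t
          - F i t / V t * (2 * F i t - sum3 (fun j => F j t)))); [ring|].
    apply (is_derive_ext_loc (F i)); [|apply HF'].
    apply L; [exact Ht|]; intros x Hx; symmetry; now apply Q. }
  split; [|intros t Ht; split; [now apply HV|intros i; split; [now apply Q|now apply HT]]].
  split; [exact Hab|split; [|split; [exact Hw|]]].
  - intros i; apply smooth_sqrt; [apply open_dom|intros; now apply H|apply HF].
  - intros t Ht; destruct (H t Ht) as [Hp [HV0 [HV2 [HVd [HF' [Hsg HC]]]]]].
    split; [|split; [|split]].
    + intros i; apply sqrt_lt_R0, Hp.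
    + rewrite HS by assumption.
      rewrite (is_derive_unique _ _ (sum3 (fun i => F i t) / 2)); [field|].
      apply (is_derive_ext_loc V); [|exact HVd].
      apply L; [exact Ht|]; intros x Hx; symmetry; now apply HV.
    + intros i; rewrite Q by assumption; apply is_derive_unique.
      apply (is_derive_ext_loc (sg i)); [|apply Hsg].
      apply L; [exact Ht|]; intros x Hx; rewrite HT, Q by assumption; simpl; ring.
    + rewrite HV, HS by assumption.
      rewrite (sum3_ext _ (fun i => sg i t + w t * F i t)) by (intros; now apply HT).
      unfold sum3 in *; simpl; lra.
Qed.

(** * Permutations of the summands *)

Definition injective (sg : summand -> summand) : Prop := forall i j, sg i = sg j -> i = j.

Lemma permute_sums sg (g : summand -> R) :
  injective sg ->
  sum3 (fun i => g (sg i)) = sum3 g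
  /\ g (sg s1) * g (sg s2) * g (sg s3) = g s1 * g s2 * g s3.
Proof.
  intros H; generalize (H s1 s2) (H s1 s3) (H s2 s3); unfold sum3.
  destruct (sg s1), (sg s2), (sg s3); intros A B C;
    try (discriminate A; reflexivity); try (discriminate B; reflexivity);
    try (discriminate C; reflexivity); split; ring.
Qed.

Lemma permute_fields sg s :
  injective sg ->
  (forall t, vol (permute sg s) t = vol s t)
  /\ (forall t, sumsq (permute sg s) t = sumsq s t)
  /\ forall i t, tau (permute sg s) i t = tau s (sg i) t.
Proof.
  intros H.
  assert (A : forall t, vol (permute sg s) t = vol s t).
  { intros t; apply (permute_sums sg (fun i => f s i t) H). }
  assert (B : forall t, sumsq (permute sg s) t = sumsq s t).
  { intros t; apply (permute_sums sg (fun i => f s i t ^ 2) H). }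
  split; [exact A|split; [exact B|]].
  intros i t; unfold tau; rewrite A, B; reflexivity.
Qed.

Lemma permute_soliton lam sg s :
  injective sg -> SU3_soliton lam s -> SU3_soliton lam (permute sg s).
Proof.
  intros H [H1 [H2 [H3 H4]]]; destruct (permute_fields sg s H) as [A [B C]].
  split; [exact H1|split; [intros i; apply H2|split; [exact H3|]]].
  intros t Ht; destruct (H4 t Ht) as [P1 [P2 [P3 P4]]].
  split; [intros i; apply P1|split; [|split]].
  - rewrite B, <- P2; f_equal; now apply Derive_ext.
  - intros i; change (f (permute sg s) i t) with (f s (sg i) t).
    rewrite <- (P3 (sg i)); apply Derive_ext; intros x; now rewrite C.
  - change (u (permute sg s) t) with (u s t); rewrite A, B, <- P4.
    rewrite (sum3_ext _ (fun i => tau s (sg i) t)) by (intros; apply C).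
    apply (permute_sums sg (fun i => tau s i t) H).
Qed.

(** * Local solitons *)

Lemma nonzero_pos (g : R -> R) rho :
  (forall t, Rabs t < rho -> continuous g t) -> (forall t, Rabs t < rho -> g t <> 0) ->
  0 < g 0 -> forall t, Rabs t < rho -> 0 < g t.
Proof.
  intros Hc Hn H0 t Ht; destruct (Rlt_le_dec 0 (g t)) as [|L]; [assumption|exfalso].
  assert (Lt : g t < 0) by (generalize (Hn t Ht); lra).
  apply Rabs_def2 in Ht.
  assert (B : forall x, Rmin 0 t <= x <= Rmax 0 t -> Rabs x < rho).
  { intros x Hx; apply Rabs_def1; [apply Rle_lt_trans with (Rmax 0 t); [lra|apply Rmax_case; lra]
    |apply Rlt_le_trans with (Rmin 0 t); [apply Rmin_case; lra|lra]]. }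
  destruct (Rtotal_order t 0) as [T|[T|T]].
  - rewrite Rmin_right, Rmax_left in B by lra.
    destruct (IVT_interv g t 0) as [x [Hx E]]; auto.
    + intros x Hx; apply continuity_pt_filterlim, Hc, B; lra.
    + apply (Hn x); [apply B; lra|exact E].
  - subst; lra.
  - rewrite Rmin_left, Rmax_right in B by lra.
    destruct (IVT_interv (fun x => - g x) 0 t) as [x [Hx E]]; try lra.
    + intros x Hx; apply continuity_pt_opp, continuity_pt_filterlim, Hc, B; lra.
    + apply (Hn x); [apply B; lra|lra].
Qed.

Lemma linear_ode_zero_at_0 (e h : R -> R) rho :
  (forall t, Rabs t < rho -> is_derive e t (h t * e t) /\ continuous h t) ->
  e 0 = 0 -> forall t, Rabs t < rho -> e t = 0.
Proof.
  intros H H0 t Ht; apply (linear_ode_zero e h (- Rabs t) (Rabs t) 0); auto.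
  - generalize (Rabs_pos t); lra.
  - intros x Hx; apply H; eapply Rle_lt_trans; [|exact Ht]; now apply Rabs_le.
  - unfold Rabs; destruct Rcase_abs; lra.
Qed.

(* The power series solver integrates [2 x' = P(x)], hence the factor. *)
Definition rhs2 (lam : R) (v : rvar) : expr rvar := Mul (Cst 2) (rhs lam v).

Definition rsol (lam : R) (z : rvar -> R) : rvar -> nat -> R := sol (rhs2 lam) (fun _ => O) z.

Definition flow (lam : R) (z : rvar -> R) (t : R) (v : rvar) : R := ev (rsol lam z) (Var v) t.

Lemma flow_0 lam z v : flow lam z 0 v = z v.
Proof. apply ev_sol_0. Qed.

Lemma flow_ode lam z rho t v :
  converges (rsol lam z) rho -> Rabs t < rho ->
  is_derive (fun x => flow lam z x v) t (eval (flow lam z t) (rhs lam v)).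
Proof.
  intros H Ht.
  replace (eval (flow lam z t) (rhs lam v)) with (ev (rsol lam z) (rhs2 lam v) t / 2).
  - now apply ev_sol_regular with rho.
  - rewrite (ev_plain _ _ _ rho H Ht) by (simpl; split; [exact I|apply plain_rhs]).
    change ((2 * eval (flow lam z t) (rhs lam v)) / 2 = eval (flow lam z t) (rhs lam v)); field.
Qed.

Lemma flow_continuous lam z rho t v :
  converges (rsol lam z) rho -> Rabs t < rho -> continuous (fun x => flow lam z x v) t.
Proof.
  intros H Ht; apply (ex_derive_continuous (V := R_NormedModule)).
  eexists; now apply flow_ode with rho.
Qed.

Lemma continuous_opp_mul {U : UniformSpace} (g h : U -> R) x :
  continuous g x -> continuous h x -> continuous (fun y => - (g y * h y)) x.
Proof.
  intros Hg Hh; apply (continuous_opp (V := R_NormedModule) (fun y => g y * h y)).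
  now apply continuous_mul.
Qed.

(** With [x_i], [y] for the unknowns standing for [1 / F_i], [1 / V]: the defects [x_i F_i - 1] and
    [y * sum sigma_i - 2 lam] solve homogeneous linear equations, and [y ^ 2 F_1 F_2 F_3 - 1] is
    constant once [x_i = 1 / F_i] is known. The relations exclude zeros of [F_i] and [y], so their
    signs persist. *)
Lemma flow_admissible lam z rho t :
  converges (rsol lam z) rho -> admissible lam z -> Rabs t < rho ->
  admissible lam (flow lam z t).
Proof.
  intros H [Z1 [Z2 [Z3 [Z4 Z5]]]] Ht.
  assert (C := fun t v => flow_continuous lam z rho t v H).
  assert (Dv := fun t v => flow_ode lam z rho t v H).
  assert (X : forall i t, Rabs t < rho -> flow lam z t (vx i) * flow lam z t (vF i) = 1).
  { intros i x Hx; apply Rminus_diag_uniq.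
    apply (linear_ode_zero_at_0 (fun t => flow lam z t (vx i) * flow lam z t (vF i) - 1)
      (fun t => - (flow lam z t (vx i) * flow lam z t (vs i))) rho); auto.
    - intros y Hy; split; [|now apply continuous_opp_mul; apply C].
      replace (- _ * _) with (eval (flow lam z y) (rhs lam (vx i)) * flow lam z y (vF i)
        + flow lam z y (vx i) * eval (flow lam z y) (rhs lam (vF i)) - 0).
      + apply (is_derive_minus (V := R_NormedModule)
          (fun t => flow lam z t (vx i) * flow lam z t (vF i)) (fun _ => 1)).
        * apply (is_derive_mul (fun t => flow lam z t (vx i)) (fun t => flow lam z t (vF i)));
            now apply Dv.
        * exact (is_derive_const (V := R_NormedModule) 1 y).
      + cbn [rhs eval]; ring.
    - rewrite !flow_0, Z2; generalize (Z1 i); intros; field; lra. }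
  assert (F0 : forall i t, Rabs t < rho -> flow lam z t (vF i) <> 0).
  { intros i x Hx E; specialize (X i x Hx); rewrite E in X; lra. }
  assert (X' : forall i t, Rabs t < rho -> flow lam z t (vx i) = / flow lam z t (vF i)).
  { intros i x Hx; specialize (X i x Hx); specialize (F0 i x Hx).
    apply (Rmult_eq_reg_r (flow lam z x (vF i))); [rewrite X; field; assumption|assumption]. }
  assert (F1 : forall i t, Rabs t < rho -> 0 < flow lam z t (vF i)).
  { intros i; apply nonzero_pos; [intros; now apply C|apply F0|rewrite flow_0; apply Z1]. }
  assert (Y : forall t, Rabs t < rho -> flow lam z t vy ^ 2 *
    (flow lam z t (vF s1) * flow lam z t (vF s2) * flow lam z t (vF s3)) = 1).
  { intros x Hx; apply Rminus_diag_uniq.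
    apply (linear_ode_zero_at_0 (fun t => flow lam z t vy ^ 2 *
      (flow lam z t (vF s1) * flow lam z t (vF s2) * flow lam z t (vF s3)) - 1)
      (fun t => 0) rho); auto.
    - intros y Hy; split; [|apply continuous_const].
      replace (0 * _) with (2 * flow lam z y vy * eval (flow lam z y) (rhs lam vy) *
        (flow lam z y (vF s1) * flow lam z y (vF s2) * flow lam z y (vF s3)) +
        flow lam z y vy ^ 2 * ((eval (flow lam z y) (rhs lam (vF s1)) * flow lam z y (vF s2)
           + flow lam z y (vF s1) * eval (flow lam z y) (rhs lam (vF s2))) * flow lam z y (vF s3)
          + flow lam z y (vF s1) * flow lam z y (vF s2) * eval (flow lam z y) (rhs lam (vF s3)))
        - 0).
      + apply (is_derive_minus (V := R_NormedModule)
          (fun t => flow lam z t vy ^ 2 *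
            (flow lam z t (vF s1) * flow lam z t (vF s2) * flow lam z t (vF s3))) (fun _ => 1));
          [|exact (is_derive_const (V := R_NormedModule) 1 y)].
        apply (is_derive_mul (fun t => flow lam z t vy ^ 2) (fun t =>
          flow lam z t (vF s1) * flow lam z t (vF s2) * flow lam z t (vF s3))).
        * apply (is_derive_sq (fun t => flow lam z t vy)); now apply Dv.
        * apply (is_derive_mul (fun t => flow lam z t (vF s1) * flow lam z t (vF s2))
            (fun t => flow lam z t (vF s3))); [|now apply Dv].
          apply (is_derive_mul (fun t => flow lam z t (vF s1)) (fun t => flow lam z t (vF s2)));
            now apply Dv.
      + cbn [rhs eval e_slope e_u esum]; rewrite !X' by assumption; field.
        repeat split; now apply F0.
    - rewrite !flow_0; lra. }
  assert (Y1 : forall t, Rabs t < rho -> 0 < flow lam z t vy).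
  { apply nonzero_pos; [intros; now apply C| |rewrite flow_0; apply Z3].
    intros x Hx E; specialize (Y x Hx); rewrite E in Y; lra. }
  split; [intros; now apply F1|split; [intros; now apply X'|split; [now apply Y1|split; [now apply Y|]]]].
  assert (Q : flow lam z t vy * sum3 (fun i => flow lam z t (vs i)) - 2 * lam = 0).
  { apply (linear_ode_zero_at_0
      (fun t => flow lam z t vy * sum3 (fun i => flow lam z t (vs i)) - 2 * lam)
      (fun t => - (flow lam z t vy * (/ 2 * sum3 (fun i => flow lam z t (vF i))))) rho); auto.
    - intros y Hy; split.
      + replace (- _ * _) with (eval (flow lam z y) (rhs lam vy) *
            sum3 (fun i => flow lam z y (vs i))
          + flow lam z y vy * sum3 (fun i => eval (flow lam z y) (rhs lam (vs i))) - 0).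
        * apply (is_derive_minus (V := R_NormedModule)
            (fun t => flow lam z t vy * sum3 (fun i => flow lam z t (vs i))) (fun _ => 2 * lam));
            [|exact (is_derive_const (V := R_NormedModule) (2 * lam) y)].
          apply (is_derive_mul (fun t => flow lam z t vy)
            (fun t => sum3 (fun i => flow lam z t (vs i)))); [now apply Dv|].
          unfold sum3; apply (is_derive_plus (V := R_NormedModule)
            (fun t => flow lam z t (vs s1) + flow lam z t (vs s2))
            (fun t => flow lam z t (vs s3))); [|now apply Dv].
          apply (is_derive_plus (V := R_NormedModule) (fun t => flow lam z t (vs s1))
            (fun t => flow lam z t (vs s2))); now apply Dv.
        * unfold sum3; cbn [rhs eval esum]; field.
      + apply continuous_opp_mul; [now apply C|].
        apply (continuous_mul (fun _ => / 2)); [apply continuous_const|].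
        unfold sum3; apply (continuous_add (fun t => flow lam z t (vF s1) + flow lam z t (vF s2)));
          [|now apply C].
        apply continuous_add; now apply C.
    - rewrite flow_0, (sum3_ext _ (fun i => z (vs i))), Z5 by (intros; apply flow_0).
      field; lra. }
  generalize (Y1 t Ht); intros P.
  apply (Rmult_eq_reg_l (flow lam z t vy)); [|lra].
  replace (flow lam z t vy * (2 * lam / flow lam z t vy)) with (2 * lam) by (field; lra); lra.
Qed.

Definition reg (lam rho : R) (z : rvar -> R) : profile :=
  Profile (- rho) rho (fun i t => sqrt (flow lam z t (vF i))) (fun t => eval (flow lam z t) e_u).

Lemma dom_reg lam rho z t : dom (reg lam rho z) t <-> Rabs t < rho.
Proof.
  unfold dom; simpl; split; [intros []; now apply Rabs_def1|].
  intros H; apply Rabs_def2 in H; lra.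
Qed.

Lemma reg_soliton lam rho z :
  0 < rho -> converges (rsol lam z) rho -> admissible lam z ->
  SU3_soliton lam (reg lam rho z)
  /\ forall t, dom (reg lam rho z) t -> forall v, sdata (reg lam rho z) t v = flow lam z t v.
Proof.
  intros Hr H Hz.
  assert (Sm : forall e, smooth_on (dom (reg lam rho z)) (ev (rsol lam z) e)).
  { intros e n t Ht; apply (ev_smooth _ e rho H n), dom_reg with (1 := Ht). }
  destruct (soliton_of_ode lam (- rho) rho (fun i t => flow lam z t (vF i))
    (fun i t => flow lam z t (vs i)) (fun t => eval (flow lam z t) e_u)
    (fun t => / flow lam z t vy)) as [A B].
  - simpl; lra.
  - intros i; apply (Sm (Var (vF i))).
  - apply (smooth_ext _ (ev (rsol lam z) e_u)); [apply open_dom| |apply Sm].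
    intros t Ht; apply dom_reg in Ht.
    apply (ev_plain _ _ _ rho H Ht); simpl; tauto.
  - intros t Ht; apply dom_reg in Ht.
    destruct (flow_admissible lam z rho t H Hz Ht) as [Z1 [Z2 [Z3 [Z4 Z5]]]].
    split; [exact Z1|split; [now apply Rinv_0_lt_compat|split; [|split; [|split; [|split]]]]].
    + apply (Rmult_eq_reg_l (flow lam z t vy ^ 2)); [|apply pow_nonzero; lra].
      rewrite Z4; field; lra.
    + replace (sum3 (fun i => flow lam z t (vF i)) / 2)
        with (- eval (flow lam z t) (rhs lam vy) / flow lam z t vy ^ 2).
      * apply (is_derive_inv (fun t => flow lam z t vy)); [now apply flow_ode with rho|lra].
      * unfold sum3; cbn [rhs eval esum]; field; lra.
    + intros i.
      replace (_ - _) with (eval (flow lam z t) (rhs lam (vF i))); [now apply flow_ode with rho|].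
      change (eval (flow lam z t) (rhs lam (vF i))) with
        (flow lam z t (vs i) + flow lam z t (vF i) * eval (flow lam z t) (e_slope i)).
      rewrite eval_e_slope; field; lra.
    + intros i; exact (flow_ode lam z rho t (vs i) H Ht).
    + rewrite Z5; reflexivity.
  - split; [exact A|]; intros t Ht; destruct (B t Ht) as [B1 B2].
    assert (Ht' := Ht); apply dom_reg in Ht'.
    destruct (flow_admissible lam z rho t H Hz Ht') as [Z1 [Z2 [Z3 _]]].
    intros [i|i|i|]; cbn [sdata].
    + apply B2.
    + rewrite Z2; f_equal; apply B2.
    + destruct (B2 i) as [E1 E2]; unfold reg; rewrite E1, E2; simpl; ring.
    + unfold reg; rewrite B1; apply Rinv_inv.
Qed.

Lemma filter_finite {T I : Type} (F : (T -> Prop) -> Prop) {FF : Filter F}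
    (l : list I) (Q : I -> T -> Prop) :
  (forall i, In i l) -> (forall i, F (Q i)) -> F (fun x => forall i, Q i x).
Proof.
  intros Hl HQ.
  assert (H : F (fun x => forall i, In i l -> Q i x)).
  { clear Hl; induction l as [|a l IH].
    - apply filter_forall; intros x i [].
    - generalize (filter_and _ _ (HQ a) IH); apply filter_imp.
      intros x [H1 H2] i [<-|Hi]; auto. }
  revert H; apply filter_imp; auto.
Qed.

Lemma locally_Rabs {T : UniformSpace} (g : T -> R) x (eps : R) :
  continuous g x -> 0 < eps -> locally x (fun y => Rabs (g y - g x) < eps).
Proof.
  intros H He; exact (proj1 (filterlim_locally _ _) H (mkposreal eps He)).
Qed.

Lemma locally_lt {T : UniformSpace} (g : T -> R) x (c : R) :
  continuous g x -> g x < c -> locally x (fun y => g y < c).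
Proof.
  intros H Hc; assert (P : 0 < c - g x) by lra.
  generalize (locally_Rabs g x _ H P); apply filter_imp; intros y Hy.
  apply Rabs_def2 in Hy; lra.
Qed.

Lemma locally_gt {T : UniformSpace} (g : T -> R) x (c : R) :
  continuous g x -> c < g x -> locally x (fun y => c < g y).
Proof.
  intros H Hc; assert (P : 0 < g x - c) by lra.
  generalize (locally_Rabs g x _ H P); apply filter_imp; intros y Hy.
  apply Rabs_def2 in Hy; lra.
Qed.

Lemma locally_Rabs_lt {T : UniformSpace} (g : T -> R) x (c : R) :
  continuous g x -> Rabs (g x) < c -> locally x (fun y => Rabs (g y) < c).
Proof.
  intros H; apply (locally_lt (fun y => Rabs (g y))).
  apply (continuous_comp g Rabs); [exact H|apply continuous_Rabs].
Qed.

Definition data_space (I : Type) : UniformSpace := fct_UniformSpace I R_UniformSpace.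

Lemma continuous_family {P : UniformSpace} {I : Type} (l : list I)
    (g : data_space I * R -> R) (init : P -> data_space I) (p : P) (t : R) :
  (forall i, In i l) -> (forall i, continuous (fun q => init q i) p) ->
  continuous g (init p, t) ->
  continuous (fun z : P * R => g (init (fst z), snd z)) (p, t).
Proof.
  intros Hl Hi Hg.
  apply (continuous_comp_2 (fun z : P * R => init (fst z)) (fun z : P * R => snd z)
    (fun (a : data_space I) (b : R) => g (a, b)) (p, t)).
  - apply (continuous_comp fst init); [apply continuous_fst|].
    apply filterlim_locally; intros eps.
    apply (filter_finite _ l (fun i q => ball (init p i) eps (init q i)) Hl).
    intros i; apply (proj1 (filterlim_locally _ _) (Hi i)).
  - apply continuous_snd.
  - apply (continuous_ext g); [now intros []|exact Hg].
Qed.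

Lemma continuous_coordinate {I : Type} (z : data_space I) i :
  continuous (fun y : data_space I => y i) z.
Proof. apply filterlim_locally; intros eps; exists eps; intros y Hy; apply Hy. Qed.

Inductive pvar := pf (i : summand) | pt (i : summand) | pu.

Definition phase (s : profile) (t : R) (k : pvar) : R :=
  match k with pf i => f s i t | pt i => tau s i t | pu => u s t end.

Definition to_data (z : pvar -> R) (v : rvar) : R :=
  match v with
  | vF i => z (pf i) ^ 2
  | vx i => / z (pf i) ^ 2
  | vs i => z (pt i) - z pu * z (pf i) ^ 2
  | vy => / (z (pf s1) * z (pf s2) * z (pf s3))
  end.

(** [close] measures [(f, tau, u)], the flow lives on [sdata]; the change of coordinates is
    continuous where the [f_i] do not vanish. *)
Lemma close_sdata s t eps :
  (forall i, 0 < f s i t) -> 0 < eps ->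
  exists delta, 0 < delta /\ forall s' t', close delta s' t' s t ->
    forall v, Rabs (sdata s' t' v - sdata s t v) < eps.
Proof.
  intros Hf He.
  assert (C : forall v, continuous (fun z : data_space pvar => to_data z v) (phase s t)).
  { assert (K := fun k => continuous_coordinate (phase s t) k).
    intros [i|i|i|]; cbn [to_data].
    - apply (continuous_pow (fun z : data_space pvar => z (pf i))); apply K.
    - apply (continuous_inv (fun z : data_space pvar => z (pf i) ^ 2)).
      + apply (continuous_pow (fun z : data_space pvar => z (pf i))); apply K.
      + apply pow_nonzero, Rgt_not_eq, (Hf i).
    - apply (continuous_sub (fun z : data_space pvar => z (pt i))); [apply K|].
      apply (continuous_mul (fun z : data_space pvar => z pu)); [apply K|].
      apply (continuous_pow (fun z : data_space pvar => z (pf i))); apply K.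
    - apply (continuous_inv (fun z : data_space pvar => z (pf s1) * z (pf s2) * z (pf s3))).
      + apply (continuous_mul (fun z : data_space pvar => z (pf s1) * z (pf s2))); [|apply K].
        apply (continuous_mul (fun z : data_space pvar => z (pf s1))); apply K.
      + apply Rgt_not_eq; repeat apply Rmult_lt_0_compat; apply Hf. }
  assert (L : locally (phase s t : data_space pvar)
    (fun z => forall v, Rabs (to_data z v - to_data (phase s t) v) < eps)).
  { apply (filter_finite _ rvars (fun v (z : data_space pvar) =>
      Rabs (to_data z v - to_data (phase s t) v) < eps) in_rvars).
    intros v; exact (locally_Rabs _ _ _ (C v) He). }
  destruct L as [d Hd]; exists d; split; [apply cond_pos|].
  intros s' t' [H1 H2] v.
  assert (E : forall s t, sdata s t v = to_data (phase s t) v) by (now destruct v).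
  rewrite !E; apply Hd; intros [i|i|]; [apply H1|apply H1|exact H2].
Qed.

(* The common value of [vol] at 0 pins down the translation. *)
Lemma no_shift lam (s s' : profile) (rho c t0 : R) :
  SU3_soliton lam s -> SU3_soliton lam s' -> 0 < rho ->
  (forall t, dom s t <-> Rabs t < rho) -> (forall t, dom s' t <-> Rabs t < rho) ->
  vol s 0 = vol s' 0 -> dom s t0 -> dom s' (t0 - c) ->
  (forall t, dom s t -> dom s' (t - c) -> vol s t = vol s' (t - c)) ->
  c <= 0.
Proof.
  intros HS HS' Hr D D' E0 T0 T0' E; apply Rnot_lt_le; intros Hc.
  assert (Z : dom s 0) by (apply D; rewrite Rabs_R0; lra).
  assert (Z' : dom s' 0) by (apply D'; rewrite Rabs_R0; lra).
  destruct (Rlt_le_dec c rho) as [L|L].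
  - assert (Dc : dom s c) by (apply D, Rabs_def1; lra).
    specialize (E c Dc); rewrite Rminus_diag, <- E0 in E; specialize (E Z').
    generalize (vol_increasing lam s 0 c HS Z Dc Hc); lra.
  (* Here [c] lies outside the domain of [s], but any overlap then has [t0 - c < 0 < t0], so the two
     volumes at [t0] lie on opposite sides of their common value at 0. *)
  - specialize (E t0 T0 T0').
    assert (H1 := proj1 (D _) T0); assert (H2 := proj1 (D' _) T0').
    apply Rabs_def2 in H1; apply Rabs_def2 in H2.
    assert (P1 : vol s 0 < vol s t0) by (apply (vol_increasing lam); auto; lra).
    assert (P2 : vol s' (t0 - c) < vol s' 0) by (apply (vol_increasing lam); auto; lra).
    lra.
Qed.

Lemma vol_sdata s t : vol s t = / sdata s t vy.
Proof. simpl; now rewrite Rinv_inv. Qed.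

(** One argument for both groups: [sym] is a flow-invariant condition, trivial for SU(3) and
    [balanced] for Sp(2). The chart near a point is the slice [1 / V = y0] through it, parametrised
    by [init]; a nearby soliton is moved onto the slice by its own flow. *)
Lemma slice_charts (P : UniformSpace) lam (A : profile -> Prop) (sym : (rvar -> R) -> Prop) :
  (forall s, A s <-> SU3_soliton lam s /\ forall t, dom s t -> sym (sdata s t)) ->
  (forall s t0, SU3_soliton lam s -> dom s t0 -> sym (sdata s t0) ->
    forall t, dom s t -> sym (sdata s t)) ->
  (forall d d' : rvar -> R, (forall v, d v = d' v) -> sym d -> sym d') ->
  (forall y0, 0 < y0 -> exists (pos : P -> Prop) (init : P -> rvar -> R),
    (forall p, pos p -> locally p pos /\ (forall v, continuous (fun p => init p v) p)
       /\ admissible lam (init p) /\ sym (init p) /\ init p vy = y0)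
    /\ (forall p q, pos p -> pos q -> (forall v, init p v = init q v) -> p = q)
    /\ (forall d, admissible lam d -> sym d -> d vy = y0 ->
         exists p, pos p /\ forall v, init p v = d v)) ->
  locally_modelled_on P A.
Proof.
  intros HA Hsym Hext Hchart s t As Dt.
  destruct (proj1 (HA s) As) as [HS Ss].
  set (d0 := sdata s t).
  assert (Ad0 : admissible lam d0) by now apply soliton_admissible.
  set (y0 := d0 vy).
  assert (Hy0 : 0 < y0) by apply Ad0.
  destruct (Hchart y0 Hy0) as [pos [init [Hpos [Hinj Hsurj]]]].
  destruct (common_bound rvars (fun v b => Rabs (d0 v) <= b)) as [C0 [HC0 HC0']].
  { intros; lra. }
  { intros v _; exists (Rabs (d0 v)); split; [apply Rabs_pos|lra]. }
  (* The slack 1 leaves a neighbourhood of [d0] inside the box on which the radius [rho] is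
     valid. *)
  set (C := C0 + 1); assert (HC : 0 < C) by (unfold C; lra).
  assert (Bd0 : forall v, Rabs (d0 v) < C).
  { intros v; specialize (HC0' v (in_rvars v)); unfold C; lra. }
  destruct (series_flow (rhs2 lam) (fun _ => O) rvars C HC in_rvars)
    as [rho [Hrho [Hconv Hcont]]].
  assert (Conv : forall z, (forall v, Rabs (z v) < C) -> converges (rsol lam z) rho).
  { intros z Hz; apply Hconv; intros v; left; apply Hz. }
  assert (Lz : forall z : data_space rvar, (forall v, Rabs (z v) < C) ->
    locally z (fun y => forall v, Rabs (y v) < C)).
  { intros z Hz; apply (filter_finite _ rvars (fun v (y : data_space rvar) => Rabs (y v) < C)
      in_rvars); intros v.
    apply (locally_Rabs_lt (fun y : data_space rvar => y v));
      [apply continuous_coordinate|apply Hz]. }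
  assert (Cont : forall e (z : data_space rvar) r, (forall v, Rabs (z v) < C) -> Rabs r < rho ->
    continuous (fun w : data_space rvar * R => ev (rsol lam (fst w)) e (snd w)) (z, r)).
  { intros e z r Hz Hr; apply Hcont; [|exact Hr].
    generalize (Lz z Hz); apply filter_imp; intros y Hy v; left; apply Hy. }
  set (U := fun p => pos p /\ forall v, Rabs (init p v) < C).
  set (S := fun p => reg lam rho (init p)).
  assert (HSp : forall p, U p -> SU3_soliton lam (S p)
      /\ forall t, dom (S p) t -> forall v, sdata (S p) t v = flow lam (init p) t v).
  { intros p [Hp Bp]; apply reg_soliton; auto; now apply Hpos. }
  assert (Dz : forall z, dom (reg lam rho z) 0) by (intros; apply dom_reg; rewrite Rabs_R0; lra).
  assert (S0 : forall p, U p -> forall v, sdata (S p) 0 v = init p v).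
  { intros p Hp v; destruct (HSp p Hp) as [_ ->]; [apply flow_0|apply Dz]. }
  assert (LU : forall p, U p -> locally p U).
  { intros p [Hp Bp]; destruct (Hpos p Hp) as [P1 [P2 _]].
    apply filter_and; [exact P1|].
    apply (filter_finite _ rvars (fun v q => Rabs (init q v) < C) in_rvars); intros v.
    apply (locally_Rabs_lt (fun q => init q v)); auto. }
  assert (V0 : forall p, U p -> vol (S p) 0 = / y0).
  { intros p Hp; rewrite vol_sdata, S0 by assumption; f_equal; apply Hpos, Hp. }
  assert (Fam : is_family same A U S).
  { split; [exact LU|split; [|split; [|split]]].
    - destruct (Hsurj d0 Ad0 (Ss t Dt) eq_refl) as [p [Hp Ep]].
      exists p; split; [exact Hp|intros v; rewrite Ep; apply Bd0].
    - intros p Hp; destruct (HSp p Hp) as [H1 H2]; apply HA; split; [exact H1|].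
      apply (Hsym (S p) 0); [exact H1|apply Dz|].
      apply (Hext (init p)); [intros; now rewrite S0|apply Hpos, Hp].
    (* Equal solitons differ by a translation [c]. Both have [1 / V = y0] at time 0, so [no_shift],
       applied in both directions, forces [c = 0]. *)
    - intros p q Hp Hq Hpq.
      destruct (HSp p Hp) as [H1 _]; destruct (HSp q Hq) as [H2 _].
      destruct (same_sdata lam (S p) (S q) H1 H2 Hpq) as [c [t0 [T1 [T2 E]]]].
      assert (EV : forall t, dom (S p) t -> dom (S q) (t - c) -> vol (S p) t = vol (S q) (t - c))
        by (intros x X1 X2; rewrite !vol_sdata, E; auto).
      assert (c <= 0).
      { apply (no_shift lam (S p) (S q) rho c t0); auto; try (intros; apply dom_reg).
        now rewrite !V0. }
      assert (- c <= 0).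
      { assert (T3 : dom (S p) (t0 - c - - c)) by (replace (t0 - c - - c) with t0 by ring; exact T1).
        apply (no_shift lam (S q) (S p) rho (- c) (t0 - c)); auto; try (intros; apply dom_reg).
        - now rewrite !V0.
        - intros x X1 X2; rewrite (EV (x - - c)); [f_equal; ring|exact X2|].
          replace (x - - c - c) with x by ring; exact X1. }
      assert (c = 0) by lra; subst c.
      apply (Hinj p q); [apply Hp|apply Hq|]; intros v.
      rewrite <- !S0 by assumption; rewrite E; [now rewrite Rminus_diag|apply Dz|].
      rewrite Rminus_diag; apply Dz.
    - intros p x Hp Hx.
      assert (Cf : forall e, continuous (fun z : P * R =>
        ev (rsol lam (init (fst z))) e (snd z)) (p, x)).
      { intros e; apply (continuous_family rvars (fun w : data_space rvar * R =>
          ev (rsol lam (fst w)) e (snd w)) init p x in_rvars).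
        - apply Hpos, Hp.
        - apply Cont; [apply Hp|now apply dom_reg in Hx]. }
      assert (L : locally ((p, x) : P * R) (fun z => U (fst z) /\ dom (S (fst z)) (snd z))).
      { apply filter_and.
        - apply (continuous_fst p x); now apply LU.
        - assert (Hx' := proj1 (dom_reg _ _ _ _) Hx).
          generalize (locally_Rabs_lt (fun z : P * R => snd z) (p, x) rho
            (continuous_snd p x) Hx'); apply filter_imp; intros z Hz; now apply dom_reg. }
      assert (Cu : continuous (fun z : P * R => u (S (fst z)) (snd z)) (p, x)).
      { apply (continuous_ext_loc _ (fun z : P * R => ev (rsol lam (init (fst z))) e_u (snd z)));
          [|apply Cf].
        revert L; apply filter_imp; intros z [Z1 Z2].
        apply dom_reg in Z2; destruct Z1 as [_ Z1].
        apply (ev_plain _ _ _ rho (Conv _ Z1) Z2); simpl; tauto. }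
      split; [|split; [intros i; split|exact Cu]].
      + revert L; apply filter_imp; now intros z [_ Z2].
      + apply (continuous_comp (fun z : P * R => ev (rsol lam (init (fst z))) (Var (vF i)) (snd z))
          sqrt); [apply Cf|apply continuous_sqrt].
      + apply (continuous_ext_loc _ (fun z : P * R =>
          ev (rsol lam (init (fst z))) (Var (vs i)) (snd z)
          + u (S (fst z)) (snd z) * ev (rsol lam (init (fst z))) (Var (vF i)) (snd z))).
        * revert L; apply filter_imp; intros z [Z1 Z2]; destruct (HSp _ Z1) as [H1 H2].
          change (flow lam (init (fst z)) (snd z) (vs i)
            + u (S (fst z)) (snd z) * flow lam (init (fst z)) (snd z) (vF i)
            = tau (S (fst z)) i (snd z)).
          rewrite <- !H2 by assumption; simpl; ring.
        * apply continuous_add; [apply Cf|].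
          apply (continuous_mul (fun z : P * R => u (S (fst z)) (snd z))); [exact Cu|apply Cf]. }
  exists U, S.
  (* For data near [d0] and short times the flow stays in the box, so the point where it crosses the
     slice will have its parameter in [U]. *)
  assert (L1 : locally ((d0, 0) : data_space rvar * R)
    (fun w => forall v, Rabs (flow lam (fst w) (snd w) v) < C)).
  { apply (filter_finite _ rvars (fun v (w : data_space rvar * R) =>
      Rabs (flow lam (fst w) (snd w) v) < C) in_rvars); intros v.
    apply (locally_Rabs_lt (fun w : data_space rvar * R => flow lam (fst w) (snd w) v)).
    - apply (Cont (Var v) d0 0 Bd0); rewrite Rabs_R0; lra.
    - simpl; rewrite flow_0; apply Bd0. }
  destruct L1 as [e1 He1].
  set (t1 := Rmin e1 rho / 2).
  assert (Ht1 : 0 < t1 /\ t1 < e1 /\ t1 < rho).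
  { unfold t1; generalize (cond_pos e1) (Rmin_l e1 rho) (Rmin_r e1 rho); intros.
    assert (0 < Rmin e1 rho) by (apply Rmin_case; auto); lra. }
  destruct (reg_soliton lam rho d0 Hrho (Conv d0 Bd0) Ad0) as [R1 R2].
  assert (Y : forall x x', Rabs x < rho -> Rabs x' < rho -> x < x' ->
    flow lam d0 x' vy < flow lam d0 x vy).
  { intros x x' Hx Hx' L.
    apply dom_reg with (lam := lam) (z := d0) in Hx, Hx'.
    generalize (vol_increasing lam _ x x' R1 Hx Hx' L).
    rewrite !vol_sdata, !R2 by assumption; intros LL; apply Rnot_le_lt; intros Hn.
    destruct (soliton_admissible lam _ _ R1 Hx) as [_ [_ [P1 _]]]; rewrite R2 in P1 by assumption.
    apply Rinv_le_contravar in Hn; lra. }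
  (* The orbit of [d0] is strictly on opposite sides of the slice at times [- t1] and [t1], hence so
     are nearby orbits. The intermediate value theorem then provides the crossing time [c]. *)
  assert (L2 : locally (d0 : data_space rvar) (fun z =>
    flow lam z t1 vy < y0 /\ y0 < flow lam z (- t1) vy)).
  { assert (Q : forall r, Rabs r < rho ->
      continuous (fun z : data_space rvar => flow lam z r vy) d0).
    { intros r Hr; apply (continuous_comp_2 (fun z : data_space rvar => z)
        (fun _ : data_space rvar => r) (fun z r => flow lam z r vy)).
      - apply continuous_id.
      - apply continuous_const.
      - apply (Cont (Var vy) d0 r Bd0 Hr). }
    assert (Rabs t1 < rho) by (apply Rabs_def1; lra).
    assert (Rabs (- t1) < rho) by (apply Rabs_def1; lra).
    assert (Rabs 0 < rho) by (rewrite Rabs_R0; lra).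
    apply filter_and; [apply locally_lt|apply locally_gt]; auto;
      unfold y0; rewrite <- (flow_0 lam d0 vy); apply Y; auto; lra. }
  destruct L2 as [e2 He2].
  destruct (close_sdata s t (Rmin e1 e2)) as [delta [Hdelta Hclose]].
  { destruct HS as [_ [_ [_ H]]]; now apply H. }
  { apply Rmin_case; apply cond_pos. }
  exists delta; split; [exact Fam|split; [exact Hdelta|]].
  intros s' t' As' Dt' Cl.
  destruct (proj1 (HA s') As') as [HS' Ss'].
  set (d := sdata s' t').
  assert (Hd : forall v, Rabs (d v - d0 v) < Rmin e1 e2) by (intros v; now apply Hclose).
  assert (Ad : admissible lam d) by now apply soliton_admissible.
  assert (Bx : forall x, Rabs x < e1 -> forall v, Rabs (flow lam d x v) < C).
  { intros x Hx v; apply (He1 ((d, x) : data_space rvar * R)); split.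
    - intros w; change (Rabs (d w - d0 w) < e1).
      generalize (Hd w) (Rmin_l e1 e2); lra.
    - change (Rabs (x - 0) < e1); now rewrite Rminus_0_r. }
  assert (Bd : forall v, Rabs (d v) < C).
  { intros v; rewrite <- (flow_0 lam); apply Bx; rewrite Rabs_R0; apply cond_pos. }
  destruct (reg_soliton lam rho d Hrho (Conv d Bd) Ad) as [Q1 Q2].
  destruct (He2 d) as [Y1 Y2].
  { intros w; change (Rabs (d w - d0 w) < e2); generalize (Hd w) (Rmin_r e1 e2); lra. }
  destruct (IVT_interv (fun x => y0 - flow lam d x vy) (- t1) t1) as [c [Hc Ec]]; try lra.
  { intros x Hx; apply continuity_pt_minus; [now apply continuity_pt_const|].
    apply continuity_pt_filterlim, (flow_continuous lam d rho x vy (Conv d Bd)).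
    apply Rabs_def1; lra. }
  assert (Dc : dom (reg lam rho d) c) by (apply dom_reg, Rabs_def1; lra).
  assert (Dc' : forall z, dom (reg lam rho z) (0 - c))
    by (intros z; apply dom_reg, Rabs_def1; lra).
  destruct (Hsurj (sdata (reg lam rho d) c)) as [p [Hp Ep]].
  { now apply soliton_admissible. }
  { apply (Hsym (reg lam rho d) 0); auto.
    apply (Hext d); [intros v; now rewrite Q2, flow_0 by apply Dz|now apply Ss']. }
  { rewrite Q2 by assumption; lra. }
  assert (Up : U p).
  { split; [exact Hp|]; intros v; rewrite Ep, Q2 by assumption.
    apply Bx, Rabs_def1; lra. }
  exists p; split; [exact Up|].
  destruct (HSp p Up) as [H1 _].
  assert (EE : forall v, sdata (reg lam rho d) 0 v = sdata (S p) (0 - c) v).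
  { apply (soliton_unique lam (reg lam rho d) (S p) c c); auto; rewrite ?Rminus_diag; try apply Dz; try apply Dc'.
    intros v; now rewrite S0. }
  (* Time [t'] of [s'] is time 0 of the flow from [d], which is time [- c] of [S p], started at the
     crossing point. *)
  apply (sdata_same lam s' (S p) (t' + c) t'); auto;
    replace (t' - (t' + c)) with (0 - c) by ring; [apply Dc'|].
  intros v; rewrite <- EE, Q2, flow_0 by apply Dz; reflexivity.
Qed.

(** * Coordinates on the level sets of the volume *)

Lemma continuous_pair {T U V : UniformSpace} (g : T -> U) (h : T -> V) x :
  continuous g x -> continuous h x -> continuous (fun y => (g y, h y)) x.
Proof.
  intros Hg Hh; apply (continuous_comp_2 g h (fun a b => (a, b))); auto.
  apply (continuous_ext (fun z => z)); [now intros []|apply continuous_id].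
Qed.

(** The slice is a graph over [(F_1, F_2, sigma_1, sigma_2)]: [F_3] is solved from
    [y0 ^ 2 F_1 F_2 F_3 = 1] and [sigma_3] from [sum sigma_i = 2 lam / y0]. *)
Definition slice_F (y0 : R) (p : Euclid4) (i : summand) : R :=
  match i with
  | s1 => fst (fst p)
  | s2 => snd (fst p)
  | s3 => / (y0 ^ 2 * (fst (fst p) * snd (fst p)))
  end.

Definition slice (lam y0 : R) (p : Euclid4) (v : rvar) : R :=
  match v with
  | vF i => slice_F y0 p i
  | vx i => / slice_F y0 p i
  | vs s1 => fst (snd p)
  | vs s2 => snd (snd p)
  | vs s3 => 2 * lam / y0 - fst (snd p) - snd (snd p)
  | vy => y0
  end.

Definition slice_pos (p : Euclid4) : Prop := 0 < fst (fst p) /\ 0 < snd (fst p).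

Lemma slice_F_pos y0 p i : 0 < y0 -> slice_pos p -> 0 < slice_F y0 p i.
Proof.
  intros H [H1 H2]; destruct i; auto; simpl; apply Rinv_0_lt_compat.
  repeat apply Rmult_lt_0_compat; auto; lra.
Qed.

Lemma continuous_proj4 (p : Euclid4) :
  continuous (fun p : Euclid4 => fst (fst p)) p /\ continuous (fun p : Euclid4 => snd (fst p)) p
  /\ continuous (fun p : Euclid4 => fst (snd p)) p /\ continuous (fun p : Euclid4 => snd (snd p)) p.
Proof.
  destruct p as [[a b] [c d]]; repeat split.
  - apply (continuous_comp (fst : Euclid4 -> Euclid2) (fst : Euclid2 -> R)); apply continuous_fst.
  - apply (continuous_comp (fst : Euclid4 -> Euclid2) (snd : Euclid2 -> R));
      [apply continuous_fst|apply continuous_snd].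
  - apply (continuous_comp (snd : Euclid4 -> Euclid2) (fst : Euclid2 -> R));
      [apply continuous_snd|apply continuous_fst].
  - apply (continuous_comp (snd : Euclid4 -> Euclid2) (snd : Euclid2 -> R)); apply continuous_snd.
Qed.

Lemma slice_continuous lam y0 p v :
  0 < y0 -> slice_pos p -> continuous (fun p => slice lam y0 p v) p.
Proof.
  intros Hy Hp; destruct (continuous_proj4 p) as [K1 [K2 [K3 K4]]].
  assert (CF : forall i, continuous (fun p => slice_F y0 p i) p).
  { intros [| |]; simpl; auto.
    apply (continuous_inv (fun p : Euclid4 => y0 ^ 2 * (fst (fst p) * snd (fst p)))).
    - apply (continuous_mul (fun _ => y0 ^ 2)); [apply continuous_const|].
      now apply continuous_mul.
    - destruct Hp; apply Rgt_not_eq; repeat apply Rmult_lt_0_compat; auto; lra. }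
  destruct v as [i|i|[| |]|]; simpl; auto.
  - apply continuous_inv; auto; now apply Rgt_not_eq, slice_F_pos.
  - apply continuous_sub; auto; apply continuous_sub; auto; apply continuous_const.
  - apply continuous_const.
Qed.

Lemma slice_admissible lam y0 p : 0 < y0 -> slice_pos p -> admissible lam (slice lam y0 p).
Proof.
  intros Hy Hp; assert (Hp' := Hp); destruct Hp' as [H1 H2].
  split; [|split; [|split; [|split]]]; simpl.
  - intros; now apply slice_F_pos.
  - reflexivity.
  - exact Hy.
  - field; repeat split; apply Rgt_not_eq; auto.
  - unfold sum3; ring.
Qed.

Lemma slice_pos_open p : slice_pos p -> locally p slice_pos.
Proof.
  intros [H1 H2]; destruct (continuous_proj4 p) as [K1 [K2 _]].
  apply filter_and; [now apply (locally_gt (fun p : Euclid4 => fst (fst p)))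
    |now apply (locally_gt (fun p : Euclid4 => snd (fst p)))].
Qed.

Lemma slice_ext lam y0 p (d : rvar -> R) :
  0 < y0 -> admissible lam d -> d vy = y0 ->
  fst (fst p) = d (vF s1) -> snd (fst p) = d (vF s2) ->
  fst (snd p) = d (vs s1) -> snd (snd p) = d (vs s2) ->
  slice_pos p /\ forall v, slice lam y0 p v = d v.
Proof.
  intros Hy [A1 [A2 [A3 [A4 A5]]]] E.
  destruct p as [[a b] [c e]]; simpl; intros -> -> -> ->.
  assert (EF : forall i, slice_F y0 ((d (vF s1), d (vF s2)), (d (vs s1), d (vs s2))) i = d (vF i)).
  { intros [| |]; simpl; auto.
    generalize (A1 s1) (A1 s2) (A1 s3); intros; rewrite E in A4.
    apply (Rmult_eq_reg_l (y0 ^ 2 * (d (vF s1) * d (vF s2)))).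
    - rewrite Rinv_r; [symmetry; etransitivity; [|exact A4]; ring|].
      apply Rgt_not_eq; repeat apply Rmult_lt_0_compat; auto; lra.
    - apply Rgt_not_eq; repeat apply Rmult_lt_0_compat; auto; lra. }
  split; [split; apply A1|].
  rewrite E in A5; unfold sum3 in A5.
  intros [i|i|[| |]|]; cbn [slice]; rewrite ?EF; simpl; auto; lra.
Qed.

Lemma SU3_charts lam : locally_modelled_on Euclid4 (SU3_soliton lam).
Proof.
  apply (slice_charts Euclid4 lam (SU3_soliton lam) (fun _ => True)); auto.
  - intros s; tauto.
  - intros y0 Hy; exists slice_pos, (slice lam y0); split; [|split].
    + intros p Hp; split; [now apply slice_pos_open|split; [|split; [now apply slice_admissible|]]].
      * intros v; now apply slice_continuous.
      * split; [exact I|reflexivity].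
    + intros [[a b] [c d]] [[a' b'] [c' d']] _ _ H.
      generalize (H (vF s1)) (H (vF s2)) (H (vs s1)) (H (vs s2)); simpl; congruence.
    + intros d Hd _ E.
      exists ((d (vF s1), d (vF s2)), (d (vs s1), d (vs s2))); now apply slice_ext.
Qed.

(** * The Sp(2)-invariant solitons as fixed points of a symmetry *)

Definition swap (i : summand) : summand := match i with s1 => s1 | s2 => s3 | s3 => s2 end.

Lemma swap_injective : injective swap.
Proof. intros [| |] [| |]; simpl; congruence. Qed.

Definition balanced (d : rvar -> R) : Prop := d (vF s2) = d (vF s3) /\ d (vs s2) = d (vs s3).

(** Exchanging [s2] and [s3] gives a soliton with the same data at [t0], hence, by uniqueness, the
    same data everywhere. *)
Lemma balanced_propagates lam s t0 :
  SU3_soliton lam s -> dom s t0 -> balanced (sdata s t0) ->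
  forall t, dom s t -> balanced (sdata s t).
Proof.
  intros HS D0 [B1 B2] t Dt.
  assert (HS' := permute_soliton lam swap s swap_injective HS).
  destruct (permute_fields swap s swap_injective) as [A [B C]].
  assert (E : forall v, sdata s t v = sdata (permute swap s) (t - 0) v).
  { apply (soliton_unique lam s (permute swap s) 0 t0); auto; rewrite ?Rminus_0_r; auto.
    intros v; cbn [sdata] in B1, B2.
    destruct v as [[| |]|[| |]|[| |]|]; cbn [sdata]; rewrite ?C, ?A; auto;
      change (f (permute swap s)) with (fun i => f s (swap i)); cbn [swap];
      change (u (permute swap s)) with (u s); auto; now rewrite B1. }
  rewrite Rminus_0_r in E; split.
  - apply (E (vF s2)).
  - rewrite (E (vs s2)); cbn [sdata]; now rewrite C.
Qed.

Lemma Sp2_balanced lam s :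
  Sp2_soliton lam s <-> SU3_soliton lam s /\ forall t, dom s t -> balanced (sdata s t).
Proof.
  split; intros [HS H]; split; auto; intros t Ht; destruct (H t Ht) as [H1 H2].
  - split; cbn [sdata]; now rewrite H1, ?H2.
  - cbn [sdata] in H1, H2; destruct HS as [_ [_ [_ HS]]]; destruct (HS t Ht) as [Hf _].
    split; [generalize (Hf s2) (Hf s3); intros; nra|].
    rewrite H1 in H2; lra.
Qed.

(** Here [F_2] and [sigma_2] are free; the volume and the constraint determine the data of the first
    summand. *)
Definition embed (lam y0 : R) (p : Euclid2) : Euclid4 :=
  ((/ (y0 ^ 2 * fst p ^ 2), fst p), (2 * lam / y0 - 2 * snd p, snd p)).

Lemma Sp2_charts lam : locally_modelled_on Euclid2 (Sp2_soliton lam).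
Proof.
  apply (slice_charts Euclid2 lam (Sp2_soliton lam) balanced).
  - apply Sp2_balanced.
  - apply balanced_propagates.
  - intros d d' E [H1 H2]; split; rewrite <- !E; auto.
  - intros y0 Hy.
    assert (Pos : forall p : Euclid2, 0 < fst p -> slice_pos (embed lam y0 p)).
    { intros p Hp; split; simpl; auto; apply Rinv_0_lt_compat.
      repeat apply Rmult_lt_0_compat; auto; lra. }
    exists (fun p => 0 < fst p), (fun p => slice lam y0 (embed lam y0 p)); split; [|split].
    + intros [a c] Hp; assert (Hp' := Pos _ Hp); split; [|split; [|split; [|split; [|reflexivity]]]].
      * apply (locally_gt (fun p : Euclid2 => fst p)); auto; apply continuous_fst.
      * intros v; apply (continuous_comp (embed lam y0) (fun q => slice lam y0 q v));
          [|now apply slice_continuous].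
        assert (K1 : continuous (fun p : Euclid2 => fst p) (a, c)) by apply continuous_fst.
        assert (K2 : continuous (fun p : Euclid2 => snd p) (a, c)) by apply continuous_snd.
        unfold embed; apply continuous_pair; apply continuous_pair; auto.
        -- apply (continuous_inv (fun p : Euclid2 => y0 ^ 2 * fst p ^ 2)).
           ++ apply (continuous_mul (fun _ => y0 ^ 2)); [apply continuous_const|].
              now apply continuous_pow.
           ++ apply Rgt_not_eq; repeat apply Rmult_lt_0_compat; simpl in *; lra.
        -- apply (continuous_sub (fun _ => 2 * lam / y0)); [apply continuous_const|].
           apply (continuous_mul (fun _ => 2)); [apply continuous_const|exact K2].
      * now apply slice_admissible.
      * assert (G : forall x : R, 0 < x -> x = / (y0 ^ 2 * (/ (y0 ^ 2 * x ^ 2) * x)))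
          by (intros; field; lra).
        assert (G' : forall x : R, x = 2 * lam / y0 - (2 * lam / y0 - 2 * x) - x)
          by (intros; ring).
        split; [exact (G a Hp)|exact (G' c)].
    + intros [a c] [a' c'] _ _ H.
      generalize (H (vF s2)) (H (vs s2)); simpl; congruence.
    + intros d Hd [B1 B2] E; exists (d (vF s2), d (vs s2)).
      destruct Hd as [A1 [A2 [A3 [A4 A5]]]]; split; [apply A1|].
      apply slice_ext; simpl; auto.
      * now repeat split.
      * rewrite E, <- B1 in A4; generalize (A1 s1) (A1 s2); intros.
        apply (Rmult_eq_reg_l (y0 ^ 2 * (d (vF s2) * (d (vF s2) * 1)))).
        -- rewrite Rinv_r; [symmetry; etransitivity; [|exact A4]; ring|].
           apply Rgt_not_eq; repeat apply Rmult_lt_0_compat; auto; lra.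
        -- apply Rgt_not_eq; repeat apply Rmult_lt_0_compat; auto; lra.
      * rewrite E in A5; unfold sum3 in A5; lra.
Qed.

(** * The singular initial value problem *)

(* [S], [1 / W], [1 / (F_2 F_3)], [E], [Y = W - S / 2] and [K]. *)
Inductive svar := cS | cw | cq | cE | cY | cK.

Definition svars : list svar := cS :: cw :: cq :: cE :: cY :: cK :: nil.

Lemma in_svars v : In v svars.
Proof. destruct v; simpl; tauto. Qed.

Definition scale {I : Type} (c : R) (e : expr I) : expr I := Mul (Cst c) e.

(* [eG] is [F_2 F_3], [eS], [eQ] and [eH] are the right-hand sides for [2 S'], for
   [2 r Y' = - Y + r Q] and for [2 W'], and the other names are those of the header, with
   [D = L S - K E]. *)
Definition eG : expr svar :=
  scale (/ 4) (Add (Mul (Var cS) (Var cS)) (scale (-1) (Shift (Mul (Var cE) (Var cE))))).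
Definition eW : expr svar := Add (scale (/ 2) (Var cS)) (Var cY).
Definition eA : expr svar := Mul (Mul eW eW) (Var cq).
Definition eB (lam : R) : expr svar := Int 1 (scale lam eA).
Definition eL (lam : R) : expr svar := Add (scale (2 * lam) eW) (scale (-1) (Shift (eB lam))).
Definition eD (lam : R) : expr svar :=
  Add (Mul (eL lam) (Var cS)) (scale (-1) (Mul (Var cK) (Var cE))).
(** [- / 3] times [sum sigma_i / F_i], divided by [t]: one has [sigma_1 / F_1 = t B / A] with
    [1 / A = w ^ 2 G], and [sigma_2 / F_2 + sigma_3 / F_3 = t q D / 2]. *)
Definition eV (lam : R) : expr svar :=
  scale (- / 3) (Add (Mul (Mul (eB lam) (Mul (Var cw) (Var cw))) eG)
    (scale (/ 2) (Mul (Var cq) (eD lam)))).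
Definition eAw : expr svar := Mul eA (Var cw).
Definition eS (lam : R) : expr svar :=
  Add (Add (eL lam) (Mul (eV lam) (Var cS)))
    (Add (scale (-1) (Mul (Mul (Var cE) (Var cE)) (Var cw))) (Mul eAw (Var cS))).
Definition eQ (lam : R) : expr svar := scale (/ 2) (Add eA (scale (-1) (eS lam))).
Definition eH (lam : R) : expr svar :=
  Add (Add (scale (/ 2) (eS lam)) (eQ lam)) (scale (-1) (Int 1 (eQ lam))).

(** Expressions cannot divide by [r]. The quotients that occur are themselves solutions of Euler
    equations: [Int 1 (eQ lam)] is [Y / r], and [Int 0] applied to [lam E] is [(K - 3 c) / r]. *)
Definition srhs (lam : R) (v : svar) : expr svar :=
  match v with
  | cS => eS lam
  | cw => scale (-1) (Mul (Mul (Var cw) (Var cw)) (eH lam))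
  | cq => scale (-1) (Mul (Var cq)
      (Add (scale (/ 2) (Mul (Var cq) (eD lam))) (scale 2 (Add (eV lam) eAw))))
  | cE => Add (Int 0 (scale lam (Var cE)))
      (Mul (Add (scale 2 (Mul (Int 1 (eQ lam)) (Var cw))) (Add (eV lam) eAw)) (Var cE))
  | cY => eQ lam
  | cK => scale lam (Var cE)
  end.

(** [V = t W] and [V' = (r A + S) / 2] give [2 r W' = - W + (r A + S) / 2], hence the 1 for
    [Y = W - S / 2]. For [t E = F_2 - F_3] one gets [2 r E' = - E - S w E + K] up to terms of order
    [r]; as [S w = 2] at [r = 0], the coefficient is 3, and regularity demands [K(0) = 3 E(0)]. *)
Definition sks (v : svar) : nat := match v with cE => 3 | cY => 1 | _ => O end.

Definition sinit (b c : R) (v : svar) : R :=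
  match v with
  | cS => 2 * b | cw => / b | cq => / b ^ 2 | cE => c | cY => 0 | cK => 3 * c
  end.

Definition ssol (lam b c : R) : svar -> nat -> R := sol (srhs lam) sks (sinit b c).

Definition sval (lam b c : R) (e : expr svar) (r : R) : R := ev (ssol lam b c) e r.

(** Turns an evaluated expression into an algebraic one, with the unknowns and the [Int] terms as
    atoms. *)
Fixpoint unfold_ev {I : Type} (x : I -> nat -> R) (r : R) (e : expr I) : R :=
  match e with
  | Cst c => c
  | Var i => ev x (Var i) r
  | Add e1 e2 => unfold_ev x r e1 + unfold_ev x r e2
  | Mul e1 e2 => unfold_ev x r e1 * unfold_ev x r e2
  | Shift e => r * unfold_ev x r e
  | Int k e => ev x (Int k e) r
  end.

Lemma ev_unfold {I : Type} (x : I -> nat -> R) e r rho :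
  converges x rho -> Rabs r < rho -> ev x e r = unfold_ev x r e.
Proof.
  intros H Hr; induction e as [k|i|e1 H1 e2 H2|e1 H1 e2 H2|e H1|m e H1]; simpl; auto.
  - apply ev_Cst.
  - rewrite (ev_Add _ _ _ _ rho), H1, H2; auto.
  - rewrite (ev_Mul _ _ _ _ rho), H1, H2; auto.
  - now rewrite ev_Shift, H1.
Qed.

(** The interface between the syntactic system and the calculations below. With [Y = r T] and
    [K = 3 c + r T0] the derivative of [Y] is free of division by [r]. *)
Lemma sval_equations lam b c rho r :
  converges (ssol lam b c) rho -> Rabs r < rho ->
  let x e := sval lam b c e r in
  let S := x (Var cS) in let w := x (Var cw) in let q := x (Var cq) in
  let E := x (Var cE) in let Y := x (Var cY) in let K := x (Var cK) in
  let W := x eW in let A := x eA in let B := x (eB lam) in let v := x (eV lam) in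
  let G := x eG in let L := x (eL lam) in let D := x (eD lam) in
  let P := x (eS lam) in let Q := x (eQ lam) in let H := x (eH lam) in
  let T := x (Int 1 (eQ lam)) in let T0 := x (Int 0 (scale lam (Var cE))) in
  (G = / 4 * (S * S + -1 * (r * (E * E))) /\ W = / 2 * S + Y /\ A = W * W * q
   /\ L = 2 * lam * W + -1 * (r * B) /\ D = L * S + -1 * (K * E)
   /\ v = - / 3 * (B * (w * w) * G + / 2 * (q * D))
   /\ P = L + v * S + (-1 * (E * E * w) + A * w * S)
   /\ Q = / 2 * (A + -1 * P) /\ H = / 2 * P + Q + -1 * T)
  /\ (Y = r * T /\ K = 3 * c + r * T0)
  /\ is_derive (sval lam b c (Var cS)) r (P / 2)
  /\ is_derive (sval lam b c (Var cw)) r (- (w * w * H) / 2)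
  /\ is_derive (sval lam b c (Var cq)) r (- (q * (/ 2 * (q * D) + 2 * (v + A * w))) / 2)
  /\ is_derive (sval lam b c (Var cK)) r (lam * E / 2)
  /\ is_derive (sval lam b c (Var cY)) r ((Q - T) / 2)
  /\ (exists E', is_derive (sval lam b c (Var cE)) r E'
       /\ 2 * r * E' = -3 * (E - c) + r * (T0 + (2 * (T * w) + (v + A * w)) * E))
  /\ (exists B', is_derive (sval lam b c (eB lam)) r B' /\ 2 * r * B' + 3 * B = lam * A).
Proof.
  intros Hc Hr x S w q E Y K W A B v G L D P Q H T T0.
  assert (U : forall e, x e = unfold_ev (ssol lam b c) r e)
    by (intros e; exact (ev_unfold _ _ _ _ Hc Hr)).
  (* [Y] vanishes at order 0, and its coefficient of order [n + 1] is that of [Q] of order [n] over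
     [2 n + 2 + 1], as for [Int 1]. *)
  assert (EY : forall s, sval lam b c (Var cY) s = s * sval lam b c (Int 1 (eQ lam)) s).
  { intros s; unfold sval; rewrite <- ev_Shift; apply PSeries_ext; intros [|n]; [reflexivity|].
    unfold ssol; cbn [coef]; now rewrite sol_S. }
  assert (EK : K = 3 * c + r * T0).
  { unfold K, T0, x, sval; rewrite <- ev_Shift, <- (ev_Cst (ssol lam b c) (3 * c) r).
    rewrite <- (ev_Add _ _ _ _ rho) by assumption.
    apply PSeries_ext; intros [|n]; unfold ssol; cbn [coef]; unfold PS_plus, plus; simpl.
    - change (@zero _) with 0; rewrite sol_0; simpl; ring.
    - rewrite sol_S, Rplus_0_l; reflexivity. }
  assert (DD : forall e, is_derive (sval lam b c e) r (Derive (sval lam b c e) r)).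
  { intros e; apply Derive_correct; eexists; exact (ev_derivable _ e r rho Hc Hr). }
  split; [|split; [split; [apply EY|exact EK]|]].
  - unfold G, W, A, L, D, v, P, Q, H, B, T, S, w, q, E, Y, K.
    repeat split; rewrite !U; reflexivity.
  - assert (Reg : forall v, sks v = O ->
      is_derive (sval lam b c (Var v)) r (x (srhs lam v) / 2)).
    { intros i Hi; exact (ev_sol_regular (srhs lam) sks (sinit b c) i r rho Hi Hc Hr). }
    split; [exact (Reg cS eq_refl)|split; [|split; [|split; [|split; [|split]]]]].
    + replace (- (w * w * H)) with (x (srhs lam cw)); [exact (Reg cw eq_refl)|].
      unfold w, H; rewrite !U; simpl; ring.
    + replace (- (q * (/ 2 * (q * D) + 2 * (v + A * w)))) with (x (srhs lam cq));
        [exact (Reg cq eq_refl)|].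
      unfold q, D, v, A, w; rewrite !U; cbn -[unfold_ev eD eV eA]; simpl; ring.
    + replace (lam * E) with (x (srhs lam cK)); [exact (Reg cK eq_refl)|].
      unfold E; rewrite !U; reflexivity.
    + apply (is_derive_ext (fun s => s * sval lam b c (Int 1 (eQ lam)) s));
        [intros s; symmetry; apply EY|].
      assert (I1 : 2 * r * Derive (sval lam b c (Int 1 (eQ lam))) r + 3 * T = Q).
      { assert (I2 := ev_Int (ssol lam b c) 1 (eQ lam) r rho Hc Hr).
        change (2 * r * Derive (sval lam b c (Int 1 (eQ lam))) r + INR 3 * T = Q) in I2.
        simpl INR in I2; lra. }
      replace ((Q - T) / 2)
        with (1 * sval lam b c (Int 1 (eQ lam)) r + r * Derive (sval lam b c (Int 1 (eQ lam))) r)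
        by (unfold T, x in *; lra).
      apply (is_derive_mul (fun s => s)); [apply (is_derive_id (K := R_AbsRing))|apply DD].
    + exists (Derive (sval lam b c (Var cE)) r); split; [apply DD|].
      assert (Eu := ev_sol_euler (srhs lam) sks (sinit b c) cE r rho Hc Hr).
      change (2 * r * Derive (sval lam b c (Var cE)) r + INR 3 * (E - c)
        = r * x (srhs lam cE)) in Eu.
      replace (T0 + (2 * (T * w) + (v + A * w)) * E) with (x (srhs lam cE)).
      * simpl INR in Eu; lra.
      * unfold T0, T, w, v, A, E; rewrite !U; reflexivity.
    + exists (Derive (sval lam b c (eB lam)) r); split; [apply DD|].
      replace (lam * A) with (x (scale lam eA)) by (unfold A; rewrite !U; reflexivity).
      assert (I2 := ev_Int (ssol lam b c) 1 (scale lam eA) r rho Hc Hr).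
      change (2 * r * Derive (sval lam b c (eB lam)) r + INR 3 * B = x (scale lam eA)) in I2.
      simpl INR in I2; lra.
Qed.

Lemma sval_continuous lam b c rho e r :
  converges (ssol lam b c) rho -> Rabs r < rho -> continuous (sval lam b c e) r.
Proof.
  intros H Hr; apply (ex_derive_continuous (V := R_NormedModule)).
  eexists; exact (ev_derivable _ e r rho H Hr).
Qed.

Lemma sval_var_0 lam b c v : sval lam b c (Var v) 0 = sinit b c v.
Proof. apply ev_sol_0. Qed.

(* [w W - 1] solves a homogeneous linear equation. *)
Lemma sval_wW lam b c rho r :
  0 < b -> converges (ssol lam b c) rho -> Rabs r < rho ->
  sval lam b c (Var cw) r * sval lam b c eW r = 1.
Proof.
  intros Hb Hc Hr.
  destruct (sval_equations lam b c rho r Hc Hr) as [[_ [-> _]] _].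
  apply Rminus_diag_uniq.
  apply (linear_ode_zero_at_0
    (fun r => sval lam b c (Var cw) r * (/ 2 * sval lam b c (Var cS) r + sval lam b c (Var cY) r) - 1)
    (fun r => - (sval lam b c (Var cw) r * (/ 2 * sval lam b c (eH lam) r))) rho); auto.
  - clear r Hr; intros r Hr.
    destruct (sval_equations lam b c rho r Hc Hr) as
      [[_ [_ [_ [_ [_ [_ [_ [_ EH]]]]]]]] [_ [DS [Dw [_ [_ [DY _]]]]]]].
    split.
    + set (S := sval lam b c (Var cS) r) in *; set (w := sval lam b c (Var cw) r) in *.
      set (Y := sval lam b c (Var cY) r) in *; set (H := sval lam b c (eH lam) r) in *.
      set (P := sval lam b c (eS lam) r) in *; set (Q := sval lam b c (eQ lam) r) in *.
      set (T := sval lam b c (Int 1 (eQ lam)) r) in *.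
      replace (- (w * (/ 2 * H)) * (w * (/ 2 * S + Y) - 1))
        with (- (w * w * H) / 2 * (/ 2 * S + Y)
          + w * (/ 2 * (P / 2) + (Q - T) / 2) - 0).
      * apply (is_derive_minus (V := R_NormedModule)
          (fun r => sval lam b c (Var cw) r * (/ 2 * sval lam b c (Var cS) r + sval lam b c (Var cY) r))
          (fun _ => 1)); [|exact (is_derive_const (V := R_NormedModule) 1 r)].
        apply (is_derive_mul (sval lam b c (Var cw))
          (fun r => / 2 * sval lam b c (Var cS) r + sval lam b c (Var cY) r)); [exact Dw|].
        apply (is_derive_plus (V := R_NormedModule) (fun r => / 2 * sval lam b c (Var cS) r)
          (sval lam b c (Var cY))); [|exact DY].
        apply (is_derive_scal (sval lam b c (Var cS)) r (/ 2)); exact DS.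
      * rewrite EH; field.
    + apply continuous_opp_mul; [now apply sval_continuous with rho|].
      apply (continuous_mul (fun _ => / 2)); [apply continuous_const|].
      now apply sval_continuous with rho.
  - rewrite !sval_var_0; simpl; field; lra.
Qed.

(** Again the defect [q G - 1] solves a homogeneous linear equation, because
    [G' = G (v + A w) + D / 4]. This last identity uses [w W = 1], in the form [w S = 2 - 2 w Y], to
    cancel the terms in [E ^ 2]. *)
Lemma sval_qG lam b c rho r :
  0 < b -> converges (ssol lam b c) rho -> Rabs r < rho ->
  sval lam b c (Var cq) r * sval lam b c eG r = 1.
Proof.
  intros Hb Hc Hr.
  destruct (sval_equations lam b c rho r Hc Hr) as [[-> _] _].
  apply Rminus_diag_uniq.
  apply (linear_ode_zero_at_0
    (fun r => sval lam b c (Var cq) r * (/ 4 * (sval lam b c (Var cS) r * sval lam b c (Var cS) r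
      + -1 * (r * (sval lam b c (Var cE) r * sval lam b c (Var cE) r)))) - 1)
    (fun r => - (sval lam b c (Var cq) r * (/ 4 * sval lam b c (eD lam) r))) rho); auto.
  - clear r Hr; intros r Hr.
    assert (WW := sval_wW lam b c rho r Hb Hc Hr).
    destruct (sval_equations lam b c rho r Hc Hr) as
      [[_ [EW [_ [_ [ED [_ [EP _]]]]]]] [[EY EK] [DS [_ [Dq [_ [_ [[E' [DE EE]] _]]]]]]]].
    split.
    + set (S := sval lam b c (Var cS) r) in *; set (w := sval lam b c (Var cw) r) in *.
      set (q := sval lam b c (Var cq) r) in *; set (E := sval lam b c (Var cE) r) in *.
      set (Y := sval lam b c (Var cY) r) in *; set (K := sval lam b c (Var cK) r) in *.
      set (P := sval lam b c (eS lam) r) in *; set (A := sval lam b c eA r) in *.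
      set (T := sval lam b c (Int 1 (eQ lam)) r) in *; set (D := sval lam b c (eD lam) r) in *.
      set (L := sval lam b c (eL lam) r) in *; set (v := sval lam b c (eV lam) r) in *.
      set (T0 := sval lam b c (Int 0 (scale lam (Var cE))) r) in *.
      set (W := sval lam b c eW r) in *.
      assert (Hg : / 4 * ((P / 2) * S + S * (P / 2) + -1 * (1 * (E * E) + r * (E' * E + E * E')))
        = / 4 * (S * S + -1 * (r * (E * E))) * (v + A * w) + D / 4).
      { replace (r * (E' * E + E * E')) with (E * (2 * r * E')) by ring; rewrite EE.
        replace (-3 * (E - c) + r * (T0 + (2 * (T * w) + (v + A * w)) * E))
          with (-3 * E + K + 2 * Y * w * E + r * (v + A * w) * E) by (rewrite EK, EY; ring).
        rewrite EP, ED.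
        assert (Z : w * S = 2 - 2 * w * Y) by (rewrite EW in WW; lra).
        replace ((L + v * S + (-1 * (E * E * w) + A * w * S)) / 2 * S)
          with ((L * S + v * S * S + (-1 * (E * E * (w * S)) + A * w * S * S)) / 2) by field.
        replace (S * ((L + v * S + (-1 * (E * E * w) + A * w * S)) / 2))
          with ((L * S + v * S * S + (-1 * (E * E * (w * S)) + A * w * S * S)) / 2) by field.
        replace (E * E * (w * S)) with (E * E * (2 - 2 * w * Y)) by (rewrite Z; ring).
        field. }
      replace (- (q * (/ 4 * D)) * (q * (/ 4 * (S * S + -1 * (r * (E * E)))) - 1))
        with (- (q * (/ 2 * (q * D) + 2 * (v + A * w))) / 2
            * (/ 4 * (S * S + -1 * (r * (E * E))))
          + q * (/ 4 * ((P / 2) * S + S * (P / 2)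
            + -1 * (1 * (E * E) + r * (E' * E + E * E')))) - 0)
        by (rewrite Hg; field).
      apply (is_derive_minus (V := R_NormedModule)
          (fun r => sval lam b c (Var cq) r * (/ 4 * (sval lam b c (Var cS) r * sval lam b c (Var cS) r
             + -1 * (r * (sval lam b c (Var cE) r * sval lam b c (Var cE) r)))))
          (fun _ => 1)); [|exact (is_derive_const (V := R_NormedModule) 1 r)].
      apply (is_derive_mul (sval lam b c (Var cq))
        (fun r => / 4 * (sval lam b c (Var cS) r * sval lam b c (Var cS) r
           + -1 * (r * (sval lam b c (Var cE) r * sval lam b c (Var cE) r))))); [exact Dq|].
      apply (is_derive_scal (fun r => sval lam b c (Var cS) r * sval lam b c (Var cS) r
           + -1 * (r * (sval lam b c (Var cE) r * sval lam b c (Var cE) r))) r (/ 4)).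
      apply (is_derive_plus (V := R_NormedModule)
        (fun r => sval lam b c (Var cS) r * sval lam b c (Var cS) r)
        (fun r => -1 * (r * (sval lam b c (Var cE) r * sval lam b c (Var cE) r)))).
      * apply (is_derive_mul (sval lam b c (Var cS)) (sval lam b c (Var cS))); exact DS.
      * apply (is_derive_scal (fun r => r * (sval lam b c (Var cE) r * sval lam b c (Var cE) r)) r (-1)).
        apply (is_derive_mul (fun r => r) (fun r => sval lam b c (Var cE) r * sval lam b c (Var cE) r));
          [apply (is_derive_id (K := R_AbsRing))|].
        apply (is_derive_mul (sval lam b c (Var cE)) (sval lam b c (Var cE))); exact DE.
    + apply continuous_opp_mul; [now apply sval_continuous with rho|].
      apply (continuous_mul (fun _ => / 4)); [apply continuous_const|].
      now apply sval_continuous with rho.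
  - rewrite !sval_var_0; simpl; field; lra.
Qed.

(** [A(0) = 1] whatever [b] and [c] are: the closing condition [f_1'(0) = 1] imposes nothing on the
    parameters. *)
Lemma sval_0 lam b c rho :
  0 < b -> 0 < rho -> converges (ssol lam b c) rho ->
  sval lam b c eW 0 = b /\ sval lam b c eA 0 = 1.
Proof.
  intros Hb Hr Hc.
  destruct (sval_equations lam b c rho 0 Hc) as [[_ [EW [EA _]]] _]; [now rewrite Rabs_R0|].
  rewrite EA, EW, !sval_var_0; simpl; split; field; lra.
Qed.

Lemma sval_pos lam b c rho r :
  0 < b -> converges (ssol lam b c) rho -> Rabs r < rho ->
  0 < sval lam b c eW r /\ 0 < sval lam b c (Var cw) r /\ 0 < sval lam b c (Var cq) r
  /\ 0 < sval lam b c eG r /\ 0 < sval lam b c eA r.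
Proof.
  intros Hb Hc Hr.
  assert (Hrho : 0 < rho) by (generalize (Rabs_pos r); lra).
  destruct (sval_0 lam b c rho Hb Hrho Hc) as [W0 A0].
  assert (PW : 0 < sval lam b c eW r).
  { revert r Hr; apply nonzero_pos; [intros; now apply sval_continuous with rho| |lra].
    intros r Hr E; generalize (sval_wW lam b c rho r Hb Hc Hr); rewrite E; lra. }
  assert (Pq : 0 < sval lam b c (Var cq) r).
  { clear PW; revert r Hr; apply nonzero_pos; [intros; now apply sval_continuous with rho| |].
    - intros r Hr E; generalize (sval_qG lam b c rho r Hb Hc Hr); rewrite E; lra.
    - rewrite sval_var_0; simpl; apply Rinv_0_lt_compat; nra. }
  assert (E1 := sval_wW lam b c rho r Hb Hc Hr).
  assert (E2 := sval_qG lam b c rho r Hb Hc Hr).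
  destruct (sval_equations lam b c rho r Hc Hr) as [[_ [_ [EA _]]] _].
  repeat split; auto.
  - apply Rnot_le_lt; intros N; nra.
  - apply Rnot_le_lt; intros N; nra.
  - rewrite EA; repeat apply Rmult_lt_0_compat; auto.
Qed.

(** * Back to the variable t *)

Definition sing_F (lam b c : R) (i : summand) (t : R) : R :=
  let x e := sval lam b c e (t ^ 2) in
  match i with
  | s1 => t ^ 2 * x eA
  | s2 => / 2 * (x (Var cS) + t * x (Var cE))
  | s3 => / 2 * (x (Var cS) - t * x (Var cE))
  end.

Definition sing_sigma (lam b c : R) (i : summand) (t : R) : R :=
  let x e := sval lam b c e (t ^ 2) in
  match i with
  | s1 => t ^ 3 * x (eB lam)
  | s2 => / 2 * (2 * lam * (t * x eW) - t ^ 3 * x (eB lam) + x (Var cK))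
  | s3 => / 2 * (2 * lam * (t * x eW) - t ^ 3 * x (eB lam) - x (Var cK))
  end.

Definition sing_u (lam b c : R) (t : R) : R := t * sval lam b c (eV lam) (t ^ 2).

Definition sing (lam d b c : R) : profile :=
  Profile 0 d (fun i t => sqrt (sing_F lam b c i t)) (sing_u lam b c).

Lemma is_derive_sq_arg (g : R -> R) t l :
  is_derive g (t ^ 2) l -> is_derive (fun s => g (s ^ 2)) t (2 * t * l).
Proof.
  intros H; apply (is_derive_comp g (fun s => s ^ 2) t l (2 * t)); [exact H|].
  auto_derive; [exact I|ring].
Qed.

Lemma locally_disk rho r : Rabs r < rho -> locally r (fun s => Rabs s < rho).
Proof. apply (locally_Rabs_lt (fun s => s)), continuous_id. Qed.

Lemma sval_eW_eA_derive lam b c rho r :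
  converges (ssol lam b c) rho -> Rabs r < rho ->
  let x e := sval lam b c e r in
  is_derive (sval lam b c eW) r (x (eH lam) / 2)
  /\ is_derive (sval lam b c eA) r (x eW * x (eH lam) * x (Var cq)
     - x eW * x eW * (x (Var cq) * (/ 2 * (x (Var cq) * x (eD lam))
         + 2 * (x (eV lam) + x eA * x (Var cw)))) / 2).
Proof.
  intros Hc Hr x.
  destruct (sval_equations lam b c rho r Hc Hr) as
    [[_ [EW [_ [_ [_ [_ [_ [_ EH]]]]]]]] [_ [DS [_ [Dq [_ [DY _]]]]]]].
  assert (DW : is_derive (sval lam b c eW) r (x (eH lam) / 2)).
  { apply (is_derive_ext_loc (fun s => / 2 * sval lam b c (Var cS) s + sval lam b c (Var cY) s)).
    - generalize (locally_disk rho r Hr); apply filter_imp; intros s Hs.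
      now destruct (sval_equations lam b c rho s Hc Hs) as [[_ [-> _]] _].
    - replace (x (eH lam) / 2) with (/ 2 * (x (eS lam) / 2)
        + (x (eQ lam) - x (Int 1 (eQ lam))) / 2) by (unfold x; rewrite EH; field).
      apply (is_derive_plus (V := R_NormedModule) (fun s => / 2 * sval lam b c (Var cS) s)
        (sval lam b c (Var cY))); [|exact DY].
      apply (is_derive_scal (sval lam b c (Var cS)) r (/ 2)); exact DS. }
  split; [exact DW|].
  apply (is_derive_ext_loc (fun s => sval lam b c eW s * sval lam b c eW s * sval lam b c (Var cq) s)).
  - generalize (locally_disk rho r Hr); apply filter_imp; intros s Hs.
    now destruct (sval_equations lam b c rho s Hc Hs) as [[_ [_ [-> _]]] _].
  - replace (_ - _) with ((x (eH lam) / 2 * x eW + x eW * (x (eH lam) / 2)) * x (Var cq)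
      + x eW * x eW * (- (x (Var cq) * (/ 2 * (x (Var cq) * x (eD lam))
         + 2 * (x (eV lam) + x eA * x (Var cw)))) / 2)) by field.
    apply (is_derive_mul (fun s => sval lam b c eW s * sval lam b c eW s) (sval lam b c (Var cq)));
      [|exact Dq].
    apply (is_derive_mul (sval lam b c eW) (sval lam b c eW)); exact DW.
Qed.

Lemma sing_F_continuous lam b c rho d i t :
  converges (ssol lam b c) rho -> (forall t, Rabs t < d -> Rabs (t ^ 2) < rho) -> Rabs t < d ->
  continuous (sing_F lam b c i) t.
Proof.
  intros Hc Hd Ht.
  assert (K : forall e, continuous (fun s => sval lam b c e (s ^ 2)) t).
  { intros e; apply (continuous_comp (fun s => s ^ 2) (sval lam b c e)).
    - apply (continuous_pow (fun s => s)), continuous_id.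
    - apply sval_continuous with rho; auto. }
  destruct i; cbn [sing_F].
  - apply (continuous_mul (fun s => s ^ 2)); [|apply K].
    apply (continuous_pow (fun s => s)), continuous_id.
  - apply (continuous_mul (fun _ => / 2)); [apply continuous_const|].
    apply continuous_add; [apply K|].
    apply (continuous_mul (fun s => s)); [apply continuous_id|apply K].
  - apply (continuous_mul (fun _ => / 2)); [apply continuous_const|].
    apply continuous_sub; [apply K|].
    apply (continuous_mul (fun s => s)); [apply continuous_id|apply K].
Qed.

Lemma sing_F_0 lam b c : sing_F lam b c s1 0 = 0 /\ sing_F lam b c s2 0 = b /\ sing_F lam b c s3 0 = b.
Proof.
  cbn [sing_F]; replace (0 ^ 2) with 0 by ring; rewrite !sval_var_0; simpl; repeat split; field.
Qed.

(** The product [F_2 F_3 = G] has no zero on the disk, so neither factor can change sign from its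
    value [b] at 0. *)
Lemma sing_F_pos lam b c rho d t :
  0 < b -> converges (ssol lam b c) rho -> (forall t, Rabs t < d -> Rabs (t ^ 2) < rho) ->
  Rabs t < d -> 0 < sing_F lam b c s2 t /\ 0 < sing_F lam b c s3 t.
Proof.
  intros Hb Hc Hd Ht.
  assert (NZ : forall t, Rabs t < d -> sing_F lam b c s2 t * sing_F lam b c s3 t <> 0).
  { intros s Hs.
    destruct (sval_pos lam b c rho (s ^ 2) Hb Hc (Hd s Hs)) as [_ [_ [_ [PG _]]]].
    destruct (sval_equations lam b c rho (s ^ 2) Hc (Hd s Hs)) as [[EG _] _].
    replace (sing_F lam b c s2 s * sing_F lam b c s3 s) with (sval lam b c eG (s ^ 2)); [lra|].
    rewrite EG; cbn [sing_F]; field. }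
  destruct (sing_F_0 lam b c) as [_ [E2 E3]].
  split; revert t Ht; apply nonzero_pos; try lra;
    try (intros; now apply sing_F_continuous with rho d);
    intros t Ht E; apply (NZ t Ht); rewrite E; ring.
Qed.

Lemma sing_soliton lam b c rho d :
  0 < b -> 0 < d -> converges (ssol lam b c) rho ->
  (forall t, Rabs t < d -> Rabs (t ^ 2) < rho) ->
  SU3_soliton lam (sing lam d b c)
  /\ forall t, dom (sing lam d b c) t -> vol (sing lam d b c) t = t * sval lam b c eW (t ^ 2)
     /\ forall i, f (sing lam d b c) i t ^ 2 = sing_F lam b c i t
        /\ tau (sing lam d b c) i t = sing_sigma lam b c i t + sing_u lam b c t * sing_F lam b c i t.
Proof.
  intros Hb Hd0 Hc Hd.
  assert (HD := open_dom (sing lam d b c)).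
  assert (Ht : forall t, dom (sing lam d b c) t -> 0 < t /\ Rabs t < d).
  { intros t [H1 H2]; simpl in H1, H2; split; [exact H1|apply Rabs_def1; lra]. }
  assert (Sq : smooth_on (dom (sing lam d b c)) (fun t => t ^ 2))
    by (apply smooth_sq; [exact HD|now apply smooth_id]).
  assert (Sx : forall e, smooth_on (dom (sing lam d b c)) (fun t => sval lam b c e (t ^ 2))).
  { intros e; apply (smooth_comp _ (fun r => Rabs r < rho)); auto.
    - intros t H; apply Hd; now apply Ht.
    - intros n r Hr; apply (ev_smooth _ e rho Hc n r Hr). }
  assert (Si := smooth_id _ HD).
  apply (soliton_of_ode lam 0 d (sing_F lam b c) (sing_sigma lam b c) (sing_u lam b c)
    (fun t => t * sval lam b c eW (t ^ 2))).
  - exact Hd0.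
  - assert (St : smooth_on (dom (sing lam d b c)) (fun t => t * sval lam b c (Var cE) (t ^ 2)))
      by now apply smooth_mul.
    assert (Sc := smooth_const _ (/ 2) HD).
    intros [| |]; cbn [sing_F].
    + now apply smooth_mul.
    + apply smooth_mul; auto; now apply smooth_add.
    + apply (smooth_ext _ (fun t => / 2 * (sval lam b c (Var cS) (t ^ 2)
        + -1 * (t * sval lam b c (Var cE) (t ^ 2))))); auto; [intros t _; cbn [sing_F]; ring|].
      apply smooth_mul; auto; apply smooth_add; auto.
      apply smooth_mul; auto; now apply smooth_const.
  - now apply smooth_mul.
  - intros t Dt; destruct (Ht t Dt) as [P0 Pt]; assert (Pr := Hd t Pt).
    destruct (sing_F_pos lam b c rho d t Hb Hc Hd Pt) as [PF2 PF3].
    destruct (sval_pos lam b c rho (t ^ 2) Hb Hc Pr) as [PW [Pw [Pq [PG PA]]]].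
    assert (WW := sval_wW lam b c rho _ Hb Hc Pr).
    assert (QG := sval_qG lam b c rho _ Hb Hc Pr).
    destruct (sval_eW_eA_derive lam b c rho _ Hc Pr) as [DW DA].
    destruct (sval_equations lam b c rho _ Hc Pr) as
      [[EG [EW [EA [EL [ED [Ev [EP [EQ EH]]]]]]]] [[EY EK] [DS [_ [_ [DK [_ [[E' [DE EE]]
        [B' [DB EB]]]]]]]]]].
    apply is_derive_sq_arg in DW, DA, DS, DK, DE, DB.
    set (S := sval lam b c (Var cS) (t ^ 2)) in *; set (w := sval lam b c (Var cw) (t ^ 2)) in *.
    set (q := sval lam b c (Var cq) (t ^ 2)) in *; set (E := sval lam b c (Var cE) (t ^ 2)) in *.
    set (Y := sval lam b c (Var cY) (t ^ 2)) in *; set (K := sval lam b c (Var cK) (t ^ 2)) in *.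
    set (P := sval lam b c (eS lam) (t ^ 2)) in *; set (A := sval lam b c eA (t ^ 2)) in *.
    set (T := sval lam b c (Int 1 (eQ lam)) (t ^ 2)) in *; set (D := sval lam b c (eD lam) (t ^ 2)) in *.
    set (L := sval lam b c (eL lam) (t ^ 2)) in *; set (v := sval lam b c (eV lam) (t ^ 2)) in *.
    set (T0 := sval lam b c (Int 0 (scale lam (Var cE))) (t ^ 2)) in *.
    set (W := sval lam b c eW (t ^ 2)) in *; set (G := sval lam b c eG (t ^ 2)) in *.
    set (H := sval lam b c (eH lam) (t ^ 2)) in *; set (Q := sval lam b c (eQ lam) (t ^ 2)) in *.
    set (B := sval lam b c (eB lam) (t ^ 2)) in *.
    (* The equation [2 r W' = - W + (r A + S) / 2], recovered from those for [S] and [Y]; it becomes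
       [2 V' = sum F_j]. *)
    assert (EHt : t ^ 2 * H = (t ^ 2 * A + S) / 2 - W)
      by (rewrite EW, EY, EH, EQ; field).
    assert (Ew : w = / W) by (apply (Rmult_eq_reg_r W); [rewrite WW; field; lra|lra]).
    assert (Eq : q = / G) by (apply (Rmult_eq_reg_r G); [rewrite QG; field; lra|lra]).
    (* Undoes the Fuchsian normal form: [c], [T] and [T0] are eliminated in favour of [K], [S] and
       [w]. *)
    assert (EE2 : 2 * t ^ 2 * E' = - E + K - S * w * E + t ^ 2 * (v + A * w) * E).
    { rewrite EE.
      replace (-3 * (E - c) + t ^ 2 * (T0 + (2 * (T * w) + (v + A * w)) * E))
        with (-3 * E + K + 2 * Y * w * E + t ^ 2 * (v + A * w) * E) by (rewrite EK, EY; ring).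
      replace (2 * Y * w * E) with (2 * (w * W) * E - S * w * E) by (rewrite EW; field).
      rewrite WW; ring. }
    assert (DV : is_derive (fun s => s * sval lam b c eW (s ^ 2)) t ((t ^ 2 * A + S) / 2)).
    { replace ((t ^ 2 * A + S) / 2) with (1 * W + t * (2 * t * (H / 2))) by
        (replace (t * (2 * t * (H / 2))) with (t ^ 2 * H) by field; rewrite EHt; field).
      apply (is_derive_mul (fun s => s) (fun s => sval lam b c eW (s ^ 2)));
        [apply (is_derive_id (K := R_AbsRing))|exact DW]. }
    assert (DE2 : is_derive (fun s => s * sval lam b c (Var cE) (s ^ 2)) t (E + 2 * t ^ 2 * E')).
    { replace (E + 2 * t ^ 2 * E') with (1 * E + t * (2 * t * E')) by ring.
      apply (is_derive_mul (fun s => s) (fun s => sval lam b c (Var cE) (s ^ 2)));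
        [apply (is_derive_id (K := R_AbsRing))|exact DE]. }
    assert (DB3 : is_derive (fun s => s ^ 3 * sval lam b c (eB lam) (s ^ 2)) t (lam * (t ^ 2 * A))).
    { replace (lam * (t ^ 2 * A)) with (3 * t ^ 2 * B + t ^ 3 * (2 * t * B'))
        by (replace (lam * (t ^ 2 * A)) with (t ^ 2 * (lam * A)) by ring; rewrite <- EB; ring).
      apply (is_derive_mul (fun s => s ^ 3) (fun s => sval lam b c (eB lam) (s ^ 2)));
        [auto_derive; [exact I|ring]|exact DB]. }
    assert (DVB : is_derive (fun s => 2 * lam * (s * sval lam b c eW (s ^ 2))
        - s ^ 3 * sval lam b c (eB lam) (s ^ 2)) t (lam * S)).
    { replace (lam * S) with (2 * lam * ((t ^ 2 * A + S) / 2) - lam * (t ^ 2 * A)) by field.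
      apply (is_derive_minus (V := R_NormedModule)
        (fun s => 2 * lam * (s * sval lam b c eW (s ^ 2))) _ t _ _); [|exact DB3].
      apply (is_derive_scal (fun s => s * sval lam b c eW (s ^ 2)) t (2 * lam)); exact DV. }
    assert (Sum : sum3 (fun i => sing_F lam b c i t) = t ^ 2 * A + S)
      by (unfold sum3; cbn [sing_F]; fold A S E; field).
    rewrite Sum.
    split; [|split; [|split; [|split; [|split; [|split]]]]].
    + intros [| |]; auto; cbn [sing_F]; apply Rmult_lt_0_compat; [|exact PA].
      apply pow_lt, P0.
    + now apply Rmult_lt_0_compat.
    + cbn [sing_F]; fold A S E W.
      transitivity (t ^ 2 * A * G); [|rewrite EG; field].
      rewrite EA, Eq; field; lra.
    + exact DV.
    + intros [| |]; cbn [sing_F sing_sigma]; fold A S E W B K; unfold sing_u; fold v.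
      * match goal with |- is_derive _ _ ?l =>
          replace l with (2 * t * A + t ^ 2 * (2 * t * (W * H * q
            - W * W * (q * (/ 2 * (q * D) + 2 * (v + A * w))) / 2))) end.
        -- apply (is_derive_mul (fun s => s ^ 2) (fun s => sval lam b c eA (s ^ 2)));
             [auto_derive; [exact I|ring]|exact DA].
        -- replace (t ^ 2 * (2 * t * (W * H * q
             - W * W * (q * (/ 2 * (q * D) + 2 * (v + A * w))) / 2)))
             with (2 * t * (W * q * (t ^ 2 * H)
               - t ^ 2 * W * W * (q * (/ 2 * (q * D) + 2 * (v + A * w))) / 2)) by field.
           rewrite EHt, Ev, EA, Ew, Eq; field; lra.
      * match goal with |- is_derive _ _ ?l =>
          replace l with (/ 2 * (2 * t * (P / 2) + (E + 2 * t ^ 2 * E'))) end.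
        -- apply (is_derive_scal (fun s => sval lam b c (Var cS) (s ^ 2)
             + s * sval lam b c (Var cE) (s ^ 2)) t (/ 2)).
           now apply (is_derive_plus (V := R_NormedModule)).
        -- rewrite EE2, EP, EL, Ew; field; lra.
      * match goal with |- is_derive _ _ ?l =>
          replace l with (/ 2 * (2 * t * (P / 2) - (E + 2 * t ^ 2 * E'))) end.
        -- apply (is_derive_scal (fun s => sval lam b c (Var cS) (s ^ 2)
             - s * sval lam b c (Var cE) (s ^ 2)) t (/ 2)).
           now apply (is_derive_minus (V := R_NormedModule)).
        -- rewrite EE2, EP, EL, Ew; field; lra.
    + intros [| |]; cbn [sing_F sing_sigma]; fold A S E W B K.
      * exact DB3.
      * replace (lam * (/ 2 * (S + t * E))) with (/ 2 * (lam * S + 2 * t * (lam * E / 2))) by field.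
        apply (is_derive_scal (fun s => 2 * lam * (s * sval lam b c eW (s ^ 2))
          - s ^ 3 * sval lam b c (eB lam) (s ^ 2) + sval lam b c (Var cK) (s ^ 2)) t (/ 2)).
        now apply (is_derive_plus (V := R_NormedModule) (fun s => 2 * lam * (s * sval lam b c eW (s ^ 2))
          - s ^ 3 * sval lam b c (eB lam) (s ^ 2))).
      * replace (lam * (/ 2 * (S - t * E))) with (/ 2 * (lam * S - 2 * t * (lam * E / 2))) by field.
        apply (is_derive_scal (fun s => 2 * lam * (s * sval lam b c eW (s ^ 2))
          - s ^ 3 * sval lam b c (eB lam) (s ^ 2) - sval lam b c (Var cK) (s ^ 2)) t (/ 2)).
        now apply (is_derive_minus (V := R_NormedModule) (fun s => 2 * lam * (s * sval lam b c eW (s ^ 2))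
          - s ^ 3 * sval lam b c (eB lam) (s ^ 2))).
    + unfold sum3; cbn [sing_sigma]; fold W B K; field.
Qed.

(** * Smoothly closing solitons *)

Lemma PS_mult_zero (a b : nat -> R) n :
  (forall k, (k <= n)%nat -> b k = 0) -> PS_mult a b n = 0.
Proof.
  intros H; unfold PS_mult; rewrite (sum_eq _ (fun _ => 0)).
  - rewrite sum_cte; ring.
  - intros k Hk; rewrite H; [ring|lia].
Qed.

(** Every term in the equations for [E] and [K] has [E] as a factor, so zero initial values
    propagate through the recursion. *)
Lemma ssol_balanced lam b n : ssol lam b 0 cE n = 0 /\ ssol lam b 0 cK n = 0.
Proof.
  induction n as [n IH] using lt_wf_ind; destruct n as [|n].
  - unfold ssol; rewrite !sol_0; simpl; split; ring.
  - assert (Z : forall e, coef (ssol lam b 0) (Mul e (Var cE)) n = 0).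
    { intros e; apply PS_mult_zero; intros k Hk; apply IH; lia. }
    unfold ssol; rewrite !sol_S; fold (ssol lam b 0); cbn [srhs]; split.
    + change (coef (ssol lam b 0) (Add ?e1 ?e2) n)
        with (coef (ssol lam b 0) e1 n + coef (ssol lam b 0) e2 n).
      rewrite Z; cbn [coef]; change (PS_mult _ (ssol lam b 0 cE) n)
        with (coef (ssol lam b 0) (scale lam (Var cE)) n).
      unfold scale; rewrite Z; unfold Rdiv; ring.
    + unfold scale; rewrite Z; unfold Rdiv; ring.
Qed.

Lemma sval_balanced lam b r : sval lam b 0 (Var cE) r = 0 /\ sval lam b 0 (Var cK) r = 0.
Proof.
  assert (Z : PSeries (fun _ => 0) r = 0) by apply PSeries_const_0.
  split; (etransitivity; [|exact Z]); apply PSeries_ext; intros n; apply ssol_balanced.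
Qed.

Lemma sing_Sp2 lam b rho d :
  0 < b -> 0 < d -> converges (ssol lam b 0) rho ->
  (forall t, Rabs t < d -> Rabs (t ^ 2) < rho) -> Sp2_soliton lam (sing lam d b 0).
Proof.
  intros Hb Hd0 Hc Hd; destruct (sing_soliton lam b 0 rho d Hb Hd0 Hc Hd) as [HS H].
  split; [exact HS|]; intros t Ht; destruct (H t Ht) as [_ H'].
  assert (EF : sing_F lam b 0 s2 t = sing_F lam b 0 s3 t).
  { cbn [sing_F]; destruct (sval_balanced lam b (t ^ 2)) as [-> _]; ring. }
  split; [exact (f_equal sqrt EF)|].
  destruct (H' s2) as [_ ->]; destruct (H' s3) as [_ ->]; rewrite EF; f_equal.
  cbn [sing_sigma]; destruct (sval_balanced lam b (t ^ 2)) as [_ ->]; ring.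
Qed.

(** For [s1] the root of [t ^ 2 A] is taken as [t * sqrt A], the odd smooth extension;
    [sqrt (t ^ 2 A)] would give the factor [|t|]. *)
Definition sing_g (lam b c : R) (i : summand) (t : R) : R :=
  match i with
  | s1 => t * sqrt (sval lam b c eA (t ^ 2))
  | i => sqrt (sing_F lam b c i t)
  end.

Lemma sing_extends lam b c rho d :
  0 < b -> 0 < d -> converges (ssol lam b c) rho ->
  (forall t, Rabs t < d -> Rabs (t ^ 2) < rho) ->
  extends (sing lam d b c) d (sing_g lam b c) (sing_u lam b c)
  /\ Derive (sing_g lam b c s1) 0 = 1
  /\ sing_g lam b c s2 0 = sing_g lam b c s3 0 /\ 0 < sing_g lam b c s2 0.
Proof.
  intros Hb Hd0 Hc Hd.
  set (D := fun t => - d < t < d).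
  assert (HD : open D) by (apply open_and; [apply open_gt|apply open_lt]).
  assert (HDa : forall t, D t -> Rabs t < d) by (intros t [H1 H2]; apply Rabs_def1; lra).
  assert (Sq : smooth_on D (fun t => t ^ 2)) by (apply smooth_sq; [exact HD|now apply smooth_id]).
  assert (Sx : forall e, smooth_on D (fun t => sval lam b c e (t ^ 2))).
  { intros e; apply (smooth_comp _ (fun r => Rabs r < rho)); auto.
    intros n r Hr; apply (ev_smooth _ e rho Hc n r Hr). }
  assert (Si := smooth_id _ HD).
  assert (Sc := fun k => smooth_const _ k HD).
  assert (St : smooth_on D (fun t => t * sval lam b c (Var cE) (t ^ 2))) by now apply smooth_mul.
  assert (SA : smooth_on D (fun t => sqrt (sval lam b c eA (t ^ 2)))).
  { apply smooth_sqrt; auto; intros t Ht; apply (sval_pos lam b c rho); auto. }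
  destruct (sing_F_0 lam b c) as [_ [E2 E3]].
  split; [|split; [|split]].
  - split; [reflexivity|split; [exact Hd0|split; [|split]]].
    + intros [| |]; cbn [sing_g].
      * now apply smooth_mul.
      * apply smooth_sqrt; auto; [intros t Ht; apply (sing_F_pos lam b c rho d); auto|].
        cbn [sing_F]; apply smooth_mul; auto; now apply smooth_add.
      * apply smooth_sqrt; auto; [intros t Ht; apply (sing_F_pos lam b c rho d); auto|].
        apply (smooth_ext _ (fun t => / 2 * (sval lam b c (Var cS) (t ^ 2)
          + -1 * (t * sval lam b c (Var cE) (t ^ 2))))); auto; [intros; cbn [sing_F]; ring|].
        apply smooth_mul; auto; apply smooth_add; auto; now apply smooth_mul.
    + now apply smooth_mul.
    + intros t [H1 H2] H3; split; [|reflexivity]; simpl in H1.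
      intros [| |]; try reflexivity; cbn [sing f sing_F sing_g].
      rewrite sqrt_mult_alt by apply pow2_ge_0; rewrite sqrt_pow2 by lra; reflexivity.
  - apply is_derive_unique.
    assert (L : ex_derive (fun t => sqrt (sval lam b c eA (t ^ 2))) 0)
      by (apply (smooth_derivable D); auto; unfold D; lra).
    assert (Hrho : 0 < rho).
    { generalize (Hd 0); rewrite Rabs_R0; intros H0; specialize (H0 Hd0).
      eapply Rle_lt_trans; [apply Rabs_pos|exact H0]. }
    destruct (sval_0 lam b c rho Hb Hrho Hc) as [_ A0].
    replace 1 with (1 * sqrt (sval lam b c eA (0 ^ 2))
      + 0 * Derive (fun t => sqrt (sval lam b c eA (t ^ 2))) 0).
    + apply (is_derive_mul (fun t => t) (fun t => sqrt (sval lam b c eA (t ^ 2))));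
        [apply (is_derive_id (K := R_AbsRing))|now apply Derive_correct].
    + replace (0 ^ 2) with 0 by ring; rewrite A0, sqrt_1; ring.
  - cbn [sing_g]; now rewrite E2, E3.
  - cbn [sing_g]; rewrite E2; now apply sqrt_lt_R0.
Qed.

(** All coefficient functions are even in [t]; a reflection changes only the sign of [t E], which
    exchanges [F_2] and [F_3]. *)
Lemma sing_closes_CP2 lam b c rho d :
  0 < b -> 0 < d -> converges (ssol lam b c) rho ->
  (forall t, Rabs t < d -> Rabs (t ^ 2) < rho) -> closes_CP2 (sing lam d b c).
Proof.
  intros Hb Hd0 Hc Hd; destruct (sing_extends lam b c rho d Hb Hd0 Hc Hd) as [H1 [H2 H3]].
  exists d, (sing_g lam b c), (sing_u lam b c); split; [exact H1|split; [|split; [exact H2|exact H3]]].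
  assert (E : forall t, (- t) ^ 2 = t ^ 2) by (intros; ring).
  intros t _; unfold sing_u; cbn [sing_g sing_F]; rewrite !E; split; [ring|split; [|ring]].
  do 3 f_equal; ring.
Qed.

Lemma sing_closes_S4 lam b rho d :
  0 < b -> 0 < d -> converges (ssol lam b 0) rho ->
  (forall t, Rabs t < d -> Rabs (t ^ 2) < rho) -> closes_S4 (sing lam d b 0).
Proof.
  intros Hb Hd0 Hc Hd; destruct (sing_extends lam b 0 rho d Hb Hd0 Hc Hd) as [H1 [H2 H3]].
  exists d, (sing_g lam b 0), (sing_u lam b 0); split; [exact H1|split; [|split; [exact H2|exact H3]]].
  assert (E : forall t, (- t) ^ 2 = t ^ 2) by (intros; ring).
  intros t _; unfold sing_u; cbn [sing_g sing_F]; rewrite !E.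
  destruct (sval_balanced lam b (t ^ 2)) as [-> _].
  rewrite !Rmult_0_r; repeat split; ring.
Qed.

(** * A common interval of existence, and distinctness *)

(** A bounded box with [b] away from 0 keeps the initial values bounded, which gives one radius for
    the family. Their largest bound is [|3 c| < 6], so 7 is a safe size. *)
Definition in_range (b c : R) : Prop := 1 < b < 2 /\ Rabs c < 2.

Lemma sinit_bound b c v : in_range b c -> Rabs (sinit b c v) < 7.
Proof.
  intros [Hb Hc]; apply Rabs_def2 in Hc.
  assert (0 < / b < 1).
  { split; [apply Rinv_0_lt_compat; lra|]; rewrite <- Rinv_1; apply Rinv_lt_contravar; lra. }
  assert (E : / b ^ 2 = / b * / b) by (field; lra).
  apply Rabs_def1; destruct v; cbn [sinit]; try rewrite E; nra.
Qed.

Lemma singular_radius lam :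
  exists rho d, 0 < d /\ (forall t, Rabs t < d -> Rabs (t ^ 2) < rho)
    /\ (forall b c, in_range b c -> converges (ssol lam b c) rho)
    /\ forall (P : UniformSpace) (b c : P -> R) (p : P) (t : R),
      in_range (b p) (c p) -> continuous b p -> continuous c p -> Rabs t < d ->
      forall e, continuous (fun z : P * R => sval lam (b (fst z)) (c (fst z)) e (snd z ^ 2)) (p, t).
Proof.
  destruct (series_flow (srhs lam) sks svars 7) as [rho [Hrho [Hconv Hcont]]];
    [lra|apply in_svars|].
  (* The 1 ensures [t ^ 2 <= |t| < rho]. *)
  exists rho, (Rmin 1 rho).
  assert (Hd : forall t, Rabs t < Rmin 1 rho -> Rabs (t ^ 2) < rho).
  { intros t Ht; rewrite <- RPow_abs; generalize (Rmin_l 1 rho) (Rmin_r 1 rho) (Rabs_pos t).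
    intros; simpl; nra. }
  split; [apply Rmin_case; lra|split; [exact Hd|split]].
  - intros b c H; apply Hconv; intros v; left; now apply sinit_bound.
  - intros P b c p t Hp Hb Hc Ht e.
    apply (continuous_family svars (fun w : data_space svar * R =>
      ev (sol (srhs lam) sks (fst w)) e (snd w ^ 2)) (fun p => sinit (b p) (c p)) p t in_svars).
    + intros v; assert (b p <> 0) by (destruct Hp; lra).
      destruct v; cbn [sinit]; try exact Hc; try apply continuous_const.
      * apply (continuous_mul (fun _ => 2)); [apply continuous_const|exact Hb].
      * now apply continuous_inv.
      * apply (continuous_inv (fun p => b p ^ 2)); [now apply continuous_pow|].
        now apply pow_nonzero.
      * apply (continuous_mul (fun _ => 3)); [apply continuous_const|exact Hc].
    + apply (continuous_comp_2 (fun w : data_space svar * R => fst w)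
        (fun w : data_space svar * R => snd w ^ 2)
        (fun (z : data_space svar) r => ev (sol (srhs lam) sks z) e r)).
      * apply continuous_fst.
      * apply (continuous_pow (fun w : data_space svar * R => snd w)), continuous_snd.
      * apply Hcont; [|now apply Hd].
        apply (filter_finite _ svars (fun v (y : data_space svar) => Rabs (y v) <= 7) in_svars).
        intros v; assert (B := sinit_bound _ _ v Hp).
        generalize (locally_Rabs_lt (fun y : data_space svar => y v) (sinit (b p) (c p)) 7
          (continuous_coordinate _ v) B); apply filter_imp; intros; lra.
Qed.

(* Here [vol] tends to 0 at the left end of both domains. *)
Lemma no_shift_at_0 lam (s s' : profile) (g : R -> R) (d c t0 : R) :
  SU3_soliton lam s ->
  (forall t, dom s t <-> 0 < t < d) -> (forall t, dom s' t <-> 0 < t < d) ->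
  (forall t, dom s' t -> vol s' t = g t) -> continuous g 0 -> g 0 = 0 ->
  dom s t0 -> dom s' (t0 - c) ->
  (forall t, dom s t -> dom s' (t - c) -> vol s t = vol s' (t - c)) ->
  c <= 0.
Proof.
  intros HS D D' Hg Cg G0 T0 T0' E; apply Rnot_lt_le; intros Hc.
  apply D in T0; apply D' in T0'.
  assert (Dc : dom s c) by (apply D; lra).
  assert (P := vol_pos lam s c HS Dc).
  (* Just to the right of [c] the volume of [s] equals that of [s'] just to the right of 0, which is
     small, although it must exceed [vol s c]. *)
  destruct (locally_lt g 0 (vol s c) Cg) as [e He]; [lra|].
  set (x := Rmin e (d - c) / 2).
  assert (Hx : 0 < x /\ x < e /\ x < d - c).
  { assert (0 < Rmin e (d - c)) by (apply Rmin_case; [apply cond_pos|lra]).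
    unfold x; generalize (Rmin_l e (d - c)) (Rmin_r e (d - c)); lra. }
  assert (D1 : dom s (c + x)) by (apply D; lra).
  assert (D2 : dom s' (c + x - c)) by (apply D'; lra).
  specialize (E _ D1 D2); rewrite (Hg _ D2) in E; replace (c + x - c) with x in E by ring.
  assert (K : g x < vol s c).
  { apply He; change (Rabs (x - 0) < e); rewrite Rminus_0_r, Rabs_right; lra. }
  assert (vol s c < vol s (c + x)) by (apply (vol_increasing lam); auto; lra).
  lra.
Qed.

Lemma continuous_eq_0 (g h : R -> R) d :
  0 < d -> continuous g 0 -> continuous h 0 -> (forall t, 0 < t < d -> g t = h t) -> g 0 = h 0.
Proof.
  intros Hd Hg Hh E; destruct (Req_dec (g 0) (h 0)) as [|N]; [assumption|exfalso].
  assert (Ck := continuous_sub g h 0 Hg Hh).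
  assert (P : 0 < Rabs (g 0 - h 0)) by (apply Rabs_pos_lt; lra).
  destruct (locally_Rabs (fun t => g t - h t) 0 _ Ck P) as [e He].
  set (x := Rmin e d / 2).
  assert (Hx : 0 < x /\ x < e /\ x < d).
  { assert (0 < Rmin e d) by (apply Rmin_case; [apply cond_pos|lra]).
    unfold x; generalize (Rmin_l e d) (Rmin_r e d); lra. }
  assert (K : Rabs (g x - h x - (g 0 - h 0)) < Rabs (g 0 - h 0)).
  { apply (He x); change (Rabs (x - 0) < e); rewrite Rminus_0_r, Rabs_right; lra. }
  rewrite E in K by lra; replace (h x - h x - (g 0 - h 0)) with (- (g 0 - h 0)) in K by ring.
  rewrite Rabs_Ropp in K; lra.
Qed.

Lemma sval_sq_continuous lam b c rho d e :
  0 < d -> converges (ssol lam b c) rho -> (forall t, Rabs t < d -> Rabs (t ^ 2) < rho) ->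
  continuous (fun t => sval lam b c e (t ^ 2)) 0.
Proof.
  intros Hd0 Hc Hd; apply (continuous_comp (fun s => s ^ 2) (sval lam b c e)).
  - apply (continuous_pow (fun s => s)), continuous_id.
  - apply sval_continuous with rho; auto; apply Hd; now rewrite Rabs_R0.
Qed.

(** The vanishing volume at the orbit excludes a translation. At [t = 0] only [F_1] vanishes, so
    [sg] fixes [s1]; what remains is the identity or the exchange of [s2] and [s3]. The parameters
    are then read off as limits at 0: [b] from [F_2], and [c], up to sign, from [E]. *)
Lemma sing_injective lam rho d b c b' c' (sg : summand -> summand) :
  0 < d -> (forall t, Rabs t < d -> Rabs (t ^ 2) < rho) -> injective sg ->
  0 < b -> 0 < b' -> 0 <= c -> 0 <= c' ->
  converges (ssol lam b c) rho -> converges (ssol lam b' c') rho ->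
  same (sing lam d b c) (permute sg (sing lam d b' c')) -> b = b' /\ c = c'.
Proof.
  intros Hd0 Hd Hsg Hb Hb' Hc Hc' Cv Cv' Hsame.
  set (s := sing lam d b c) in *; set (s' := permute sg (sing lam d b' c')) in *.
  destruct (sing_soliton lam b c rho d Hb Hd0 Cv Hd) as [HS H].
  destruct (sing_soliton lam b' c' rho d Hb' Hd0 Cv' Hd) as [HS0 H0].
  destruct (permute_fields sg (sing lam d b' c') Hsg) as [EV _].
  assert (HS' : SU3_soliton lam s') by now apply permute_soliton.
  assert (D : forall t, dom s t <-> 0 < t < d) by (intros; unfold dom; simpl; tauto).
  assert (D' : forall t, dom s' t <-> 0 < t < d) by (intros; unfold dom; simpl; tauto).
  destruct (same_sdata lam s s' HS HS' Hsame) as [k [t0 [T1 [T2 E]]]].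
  assert (Vs : forall t, dom s t -> dom s' (t - k) -> vol s t = vol s' (t - k))
    by (intros x X1 X2; rewrite !vol_sdata, E; auto).
  assert (Ct : forall b c, converges (ssol lam b c) rho ->
    continuous (fun t => t * sval lam b c eW (t ^ 2)) 0).
  { intros b0 c0 H1; apply (continuous_mul (fun t => t)); [apply continuous_id|].
    now apply sval_sq_continuous with rho d. }
  assert (K1 : k <= 0).
  { apply (no_shift_at_0 lam s s' (fun t => t * sval lam b' c' eW (t ^ 2)) d k t0); auto.
    - intros t Ht; unfold s'; rewrite EV; now apply H0.
    - ring. }
  assert (K2 : - k <= 0).
  { apply (no_shift_at_0 lam s' s (fun t => t * sval lam b c eW (t ^ 2)) d (- k) (t0 - k)); auto.
    - intros t Ht; now apply H.
    - ring.
    - replace (t0 - k - - k) with t0 by ring; exact T1.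
    - intros x X1 X2; rewrite (Vs (x - - k)); [f_equal; ring|exact X2|].
      replace (x - - k - k) with x by ring; exact X1. }
  assert (k = 0) by lra; subst k; clear K1 K2.
  assert (EF : forall i t, 0 < t < d -> sing_F lam b c i t = sing_F lam b' c' (sg i) t).
  { intros i t Ht; assert (Dt := proj2 (D t) Ht); assert (Dt' := proj2 (D' t) Ht).
    destruct (H t Dt) as [_ H1]; destruct (H0 t Dt') as [_ H2].
    destruct (H1 i) as [<- _]; destruct (H2 (sg i)) as [<- _].
    specialize (E t Dt); rewrite Rminus_0_r in E; exact (E Dt' (vF i)). }
  assert (EF0 : forall i, sing_F lam b c i 0 = sing_F lam b' c' (sg i) 0).
  { intros i; apply (continuous_eq_0 _ _ d Hd0); [| |apply EF];
      (apply sing_F_continuous with rho d; auto; now rewrite Rabs_R0). }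
  destruct (sing_F_0 lam b c) as [F1 [F2 F3]]; destruct (sing_F_0 lam b' c') as [F1' [F2' F3']].
  assert (G1 : sg s1 = s1).
  { specialize (EF0 s1); destruct (sg s1); auto; exfalso; lra. }
  assert (Ce : forall b c k, converges (ssol lam b c) rho ->
    continuous (fun t => k * sval lam b c (Var cE) (t ^ 2)) 0).
  { intros b0 c0 k0 H1; apply (continuous_mul (fun _ => k0)); [apply continuous_const|].
    now apply sval_sq_continuous with rho d. }
  assert (E0 : forall b c, sval lam b c (Var cE) (0 ^ 2) = c).
  { intros; replace (0 ^ 2) with 0 by ring; apply sval_var_0. }
  assert (G23 : (sg s2 = s2 /\ sg s3 = s3) \/ (sg s2 = s3 /\ sg s3 = s2)).
  { generalize (Hsg s1 s2) (Hsg s1 s3) (Hsg s2 s3); rewrite G1.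
    destruct (sg s2), (sg s3); intros A1 A2 A3; auto;
      try discriminate (A1 eq_refl); try discriminate (A2 eq_refl); discriminate (A3 eq_refl). }
  (* Subtracting the equalities for [s2] and [s3] isolates [t E], and [k = -1] is the exchanged
     case. The limit at 0 gives [c = k c']; with both nonnegative, [k = -1] leaves only
     [c = c' = 0]. *)
  assert (EE : exists k, (k = 1 \/ k = -1) /\ forall t, 0 < t < d ->
    1 * sval lam b c (Var cE) (t ^ 2) = k * sval lam b' c' (Var cE) (t ^ 2)).
  { destruct G23 as [[G2 G3]|[G2 G3]]; [exists 1|exists (-1)]; split; auto; intros t Ht;
      generalize (EF s2 t Ht) (EF s3 t Ht); rewrite G2, G3; cbn [sing_F]; intros K2 K3;
      apply (Rmult_eq_reg_l t); lra. }
  destruct EE as [k [Hk EE]].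
  assert (K := continuous_eq_0 _ _ d Hd0 (Ce b c 1 Cv) (Ce b' c' k Cv') EE).
  cbv beta in K; rewrite !E0 in K.
  split.
  - specialize (EF0 s2); destruct G23 as [[G2 _]|[G2 _]]; rewrite G2 in EF0; lra.
  - destruct Hk as [->| ->]; lra.
Qed.

(** Isolates the continuity of the phase-space coordinates, which is common to both groups;
    membership and distinctness are left to each case. *)
Lemma sing_family (P : UniformSpace) lam rho d (eqv : profile -> profile -> Prop)
    (A : profile -> Prop) (U : P -> Prop) (b c : P -> R) :
  0 < d -> (forall t, Rabs t < d -> Rabs (t ^ 2) < rho) ->
  (forall b c, in_range b c -> converges (ssol lam b c) rho) ->
  (forall (p : P) (t : R), in_range (b p) (c p) -> continuous b p -> continuous c p -> Rabs t < d ->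
      forall e, continuous (fun z : P * R => sval lam (b (fst z)) (c (fst z)) e (snd z ^ 2)) (p, t)) ->
  open U -> (exists p, U p) ->
  (forall p, U p -> in_range (b p) (c p) /\ continuous b p /\ continuous c p) ->
  (forall p, U p -> A (sing lam d (b p) (c p))) ->
  (forall p q, U p -> U q -> eqv (sing lam d (b p) (c p)) (sing lam d (b q) (c q)) -> p = q) ->
  is_family eqv A U (fun p => sing lam d (b p) (c p)).
Proof.
  intros Hd0 Hd Hconv Hcont HU HU0 HbC HA Hinj.
  split; [exact HU|split; [exact HU0|split; [exact HA|split; [exact Hinj|]]]].
  intros p t Up Dt; assert (Dt' := Dt); destruct Dt' as [H1 H2]; simpl in H1, H2.
  destruct (HbC p Up) as [R1 [R2 R3]].
  assert (Ht : Rabs t < d) by (apply Rabs_def1; lra).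
  assert (K := Hcont p t R1 R2 R3 Ht).
  assert (Ks : continuous (fun z : P * R => snd z) (p, t)) by apply continuous_snd.
  assert (L : locally ((p, t) : P * R) (fun z => U (fst z)
      /\ dom (sing lam d (b (fst z)) (c (fst z))) (snd z))).
  { apply filter_and; [apply (continuous_fst p t); now apply HU|].
    apply filter_and; [now apply (locally_gt (fun z : P * R => snd z))
      |now apply (locally_lt (fun z : P * R => snd z))]. }
  assert (KF : forall i, continuous (fun z : P * R =>
    sing_F lam (b (fst z)) (c (fst z)) i (snd z)) (p, t)).
  { intros [| |]; cbn [sing_F].
    - apply (continuous_mul (fun z : P * R => snd z ^ 2)); [now apply continuous_pow|apply K].
    - apply (continuous_mul (fun _ => / 2)); [apply continuous_const|].
      apply continuous_add; [apply K|].
      apply (continuous_mul (fun z : P * R => snd z)); [exact Ks|apply K].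
    - apply (continuous_mul (fun _ => / 2)); [apply continuous_const|].
      apply continuous_sub; [apply K|].
      apply (continuous_mul (fun z : P * R => snd z)); [exact Ks|apply K]. }
  assert (KG : forall i, continuous (fun z : P * R =>
    sing_sigma lam (b (fst z)) (c (fst z)) i (snd z)) (p, t)).
  { assert (K3 : continuous (fun z : P * R => snd z ^ 3
      * sval lam (b (fst z)) (c (fst z)) (eB lam) (snd z ^ 2)) (p, t)).
    { apply (continuous_mul (fun z : P * R => snd z ^ 3)); [now apply continuous_pow|apply K]. }
    assert (KV : continuous (fun z : P * R => 2 * lam * (snd z
      * sval lam (b (fst z)) (c (fst z)) eW (snd z ^ 2))) (p, t)).
    { apply (continuous_mul (fun _ => 2 * lam)); [apply continuous_const|].
      apply (continuous_mul (fun z : P * R => snd z)); [exact Ks|apply K]. }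
    intros [| |]; cbn [sing_sigma]; [exact K3| |];
      (apply (continuous_mul (fun _ => / 2)); [apply continuous_const|]).
    - apply continuous_add; [now apply continuous_sub|apply K].
    - apply continuous_sub; [now apply continuous_sub|apply K]. }
  assert (Ku : continuous (fun z : P * R => sing_u lam (b (fst z)) (c (fst z)) (snd z)) (p, t)).
  { apply (continuous_mul (fun z : P * R => snd z)); [exact Ks|apply K]. }
  split; [|split; [intros i; split|exact Ku]].
  - revert L; apply filter_imp; now intros z [_ Z2].
  - apply (continuous_comp (fun z : P * R => sing_F lam (b (fst z)) (c (fst z)) i (snd z)) sqrt);
      [apply KF|apply continuous_sqrt].
  - apply (continuous_ext_loc _ (fun z : P * R => sing_sigma lam (b (fst z)) (c (fst z)) i (snd z)
      + sing_u lam (b (fst z)) (c (fst z)) (snd z) * sing_F lam (b (fst z)) (c (fst z)) i (snd z))).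
    + revert L; apply filter_imp; intros z [Z1 Z2].
      destruct (HbC _ Z1) as [Z3 _].
      assert (0 < b (fst z)) by (destruct Z3; lra).
      destruct (sing_soliton lam (b (fst z)) (c (fst z)) rho d) as [_ HS]; auto.
      destruct (HS _ Z2) as [_ H']; destruct (H' i) as [_ E]; exact (eq_sym E).
    + apply continuous_add; [apply KG|]; apply continuous_mul; [exact Ku|apply KF].
Qed.

Theorem theorem2 (lam : R) :
  (locally_modelled_on Euclid2 (Sp2_soliton lam)
   /\ has_family Euclid1 same (fun s => Sp2_soliton lam s /\ closes_S4 s))
  /\
  (locally_modelled_on Euclid4 (SU3_soliton lam)
   /\ has_family Euclid2 same_up_to_symmetry
        (fun s => SU3_soliton lam s /\ closes_CP2 s)).
Proof.
  destruct (singular_radius lam) as [rho [d [Hd0 [Hd [Hconv Hcont]]]]].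
  split; (split; [apply Sp2_charts || apply SU3_charts|]).
  - exists (fun p : Euclid1 => 1 < p /\ p < 2), (fun p : Euclid1 => sing lam d p 0).
    assert (R0 : forall p : R, 1 < p /\ p < 2 -> in_range p 0 /\ 0 < p).
    { intros p Hp; repeat split; try rewrite Rabs_R0; lra. }
    apply (sing_family Euclid1 lam rho d same _ _ (fun p => p) (fun _ => 0)); auto.
    + exact (Hcont Euclid1 (fun p => p) (fun _ => 0)).
    + apply open_and; [apply open_gt|apply open_lt].
    + exists (3 / 2); lra.
    + intros p Hp; split; [now apply R0|split; [apply continuous_id|apply continuous_const]].
    + intros p Hp; destruct (R0 p Hp) as [R1 R2].
      split; [apply sing_Sp2 with rho|apply sing_closes_S4 with rho]; auto.
    + intros p q Hp Hq E; destruct (R0 p Hp) as [R1 R2]; destruct (R0 q Hq) as [R3 R4].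
      (* [same] without symmetries is the case of the identity permutation. *)
      apply (sing_injective lam rho d p 0 q 0 (fun i => i)); auto; try lra.
      intros i j H; exact H.
  (* Only [c > 0], since [c] and [- c] give solitons that agree up to the exchange of [s2] and
     [s3]. *)
  - set (U := fun p : Euclid2 => (1 < fst p /\ fst p < 2) /\ (0 < snd p /\ snd p < 2)).
    exists U, (fun p : Euclid2 => sing lam d (fst p) (snd p)).
    assert (R0 : forall p : Euclid2, U p -> in_range (fst p) (snd p) /\ 0 < fst p /\ 0 < snd p).
    { intros p [H1 H2]; split; [split; [exact H1|apply Rabs_def1]|]; lra. }
    assert (C1 : forall p : Euclid2, continuous (fun p : Euclid2 => fst p) p)
      by (intros []; apply continuous_fst).
    assert (C2 : forall p : Euclid2, continuous (fun p : Euclid2 => snd p) p)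
      by (intros []; apply continuous_snd).
    apply (sing_family Euclid2 lam rho d same_up_to_symmetry _ _ (fun p => fst p)
      (fun p => snd p)); auto.
    + intros p [[H1 H2] [H3 H4]]; repeat apply filter_and.
      * now apply (locally_gt (fun p : Euclid2 => fst p)).
      * now apply (locally_lt (fun p : Euclid2 => fst p)).
      * now apply (locally_gt (fun p : Euclid2 => snd p)).
      * now apply (locally_lt (fun p : Euclid2 => snd p)).
    + exists (3 / 2, 1); unfold U; simpl; lra.
    + intros p Hp; split; [now apply R0|split; [apply C1|apply C2]].
    + intros p Hp; destruct (R0 p Hp) as [R1 [R2 R3]].
      split; [apply (sing_soliton lam (fst p) (snd p) rho d)|apply sing_closes_CP2 with rho]; auto.
    + intros p q Hp Hq [sg [Hsg E]].
      destruct (R0 p Hp) as [R1 [R2 R3]]; destruct (R0 q Hq) as [R4 [R5 R6]].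
      destruct (sing_injective lam rho d (fst p) (snd p) (fst q) (snd q) sg) as [E1 E2];
        auto; try lra.
      destruct p, q; simpl in *; congruence.
Qed.
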